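(* Let $\mu$ be a locally finite positive Borel measure on $\mathbb{R}^d$ satisfying the doubling condition $$K_\mu:=\sup_{Q\subset\mathbb{R}^d\ \text{cube}}\frac{\mu(2Q)}{\mu(Q)}<\infty,$$ let $\mathcal{D}$ be a dyadic grid in $\mathbb{R}^d$, let $\mathcal{H}$ be a separable Hilbert space, and let $W:\mathbb{R}^d\to\mathcal{B}(\mathcal{H})$ be a dyadic $\mathcal{A}_2(\mu)$-weight. Then $$\sup_{\psi,\varphi,\mathcal{S}}\big\|T^{\mathcal{S}}_{\psi,\varphi}\otimes\mathbf{1}\big\|_{L^2_W\to L^2_W}\ \le\ C_\mu\,[W]^{1/2}_{\mathcal{A}_2(\mu)}\,[W]^{1/2}_{\mathcal{A}_\infty(\mu)}\,[W^{-1}]^{1/2}_{\mathcal{A}_\infty(\mu)}$$ for some constant $C_\mu>0$ depending only on $\mu$, where the supremum is taken over all sparse collections $\mathcal{S}\subset\mathcal{D}$ and all admissible sequences $\psi=\{\psi_Q\}_{Q\in\mathcal{S}}$, $\varphi=\{\varphi_Q\}_{Q\in\mathcal{S}}$.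
   Context: $2Q$ denotes the dilate of the cube $Q$ by a factor $2$. Dyadic grid: a countable collection $\mathcal{D}$ of cubes in $\mathbb{R}^d$ such that every $Q\in\mathcal{D}$ has sidelength $2^k$ for some $k\in\mathbb{Z}$; for each $k$ the cubes of sidelength $2^k$ in $\mathcal{D}$ form a partition of $\mathbb{R}^d$; and $Q\cap Q'\in\{\emptyset,Q,Q'\}$ for all $Q,Q'\in\mathcal{D}$. Sparse: $\mathcal{S}\subset\mathcal{D}$ is sparse (with respect to $\mu$) if for any $Q\in\mathcal{D}$, $\sum_{Q'\in \mathbf{Ch}_{\mathcal{S}}(Q)}\mu(Q')\le\frac12\mu(Q)$, where $\mathbf{Ch}_{\mathcal{S}}(Q)$ is the set of maximal (with respect to inclusion) cubes of $\mathcal{S}$ strictly contained in $Q$. Averages: $\langle f\rangle_{\mu,Q}=\frac{1}{\mu(Q)}\int_Q f\,d\mu$. Operator-valued weight: $W:\mathbb{R}^d\to\mathcal{B}(\mathcal{H})$, with values positive, invertible operators ($\mu$-a.e.), such that for every $e\in\mathcal{H}$, $w_e(x)=(W(x)e\,|\,e)_{\mathcal{H}}$ is a usual scalar weight, and such that both $W$ and $W^{-1}$ are weakly locally $\mu$-integrable: for all $u,v\in\mathcal{H}$, $x\mapsto (W^{\pm1}(x)u\,|\,v)_{\mathcal{H}}$ is $\mu$-integrable on compact sets and $\big|\int_Q (W^{\pm1}(x)u\,|\,v)_{\mathcal{H}}\,d\mu(x)\big|\le C_{\mu,Q}\|u\|_{\mathcal{H}}\|v\|_{\mathcal{H}}$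 for every dyadic cube $Q$. Thus $\langle W^{\pm1}\rangle_{\mu,Q}$ are bounded positive operators on $\mathcal{H}$ (defined weakly). $W$ is a dyadic $\mathcal{A}_2(\mu)$-weight if $[W]_{\mathcal{A}_2(\mu)}:=\sup_{Q\in\mathcal{D}}\big\|\langle W\rangle^{1/2}_{\mu,Q}\langle W^{-1}\rangle^{1/2}_{\mu,Q}\big\|^2_{\mathcal{B}(\mathcal{H})}<\infty$. Dyadic $\mathcal{A}_\infty(\mu)$ constants: for a scalar weight $w$, $[w]_{A_\infty(\mu)}:=\sup_{Q\in\mathcal{D}}\frac{1}{w(Q)}\int_Q M^{\mathcal{D}}_\mu(1_Qw)\,d\mu$, where $w(Q)=\int_Q w\,d\mu$ and $M^{\mathcal{D}}_\mu f(x)=\sup_{Q\in\mathcal{D}}1_Q(x)\langle f\rangle_{\mu,Q}$ is the dyadic maximal function. For an operator-valued weight, $[W]_{\mathcal{A}_\infty(\mu)}:=\sup_{e}[w_e]_{A_\infty(\mu)}$, the supremum over (nonzero) $e\in\mathcal{H}$; similarly for $W^{-1}$. $L^2_W=L^2_W(\mu,\mathcal{H})$ is the space of weakly locally $\mu$-integrable $\mathcal{H}$-valued functions on $\mathbb{R}^d$ with $\|f\|^2_{L^2_W}=\int_{\mathbb{R}^d}\|W^{1/2}f\|^2_{\mathcal{H}}\,d\mu<\infty$. $L^\infty_0(\mu)$ denotes complex-valued $\mu$-essentially bounded functions with compact support; $L^\infty_0(\mu)\otimes\mathcal{H}$ is the space of finite sums $\sum f\otimes e$ with $f\in L^\infty_0(\mu)$,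 $e\in\mathcal{H}$, which is dense in $L^2_W$. For a linear operator $T$ on scalar functions, $T\otimes\mathbf{1}$ is defined on $L^\infty_0(\mu)\otimes\mathcal{H}$ by $(T\otimes\mathbf{1})(\sum f\otimes e)=\sum T(f)\otimes e$, and, when bounded, also denotes its unique continuous extension to $L^2_W$. Sparse Lerner operators: sequences $\psi=\{\psi_Q\}_{Q\in\mathcal{S}}$, $\varphi=\{\varphi_Q\}_{Q\in\mathcal{S}}$ are admissible if $\psi_Q,\varphi_Q$ are complex-valued functions supported on $Q$ with $\|\psi_Q\|_{L^\infty(\mu)}\le1$ and $\|\varphi_Q\|_{L^\infty(\mu)}\le1$. Then $$T^{\mathcal{S}}_{\psi,\varphi}f(x)=\sum_{Q\in\mathcal{S}}\psi_Q(x)\,\langle\varphi_Q f\rangle_{\mu,Q}.$$ *)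

(* Defs.v *)
From HB Require Import structures.
From mathcomp Require Import all_boot all_order all_algebra.
From mathcomp Require Import complex.
From mathcomp Require Import all_classical all_reals all_analysis.
Set Implicit Arguments.
Unset Strict Implicit.
Unset Printing Implicit Defensive.
Import Order.TTheory GRing.Theory Num.Theory.
Import numFieldNormedType.Exports.
Local Open Scope classical_set_scope.
Local Open Scope ring_scope.

(* R^d with its Borel sigma-algebra. *)
Notation euclidean R d := (g_sigma_algebraType (@open 'rV[R]_d)).

Section cubes.
Context {R : realType} {d : nat}.
Local Notation E := (euclidean R d).
Implicit Types (mu : {measure set E -> \bar R}) (D S : set (set E)).

(* The cube of center c and sidelength l. Each face may be included or not:
   (o i).1 = true includes the lower i-th face, (o i).2 = false the upper. *)
Definition cube (c : 'rV[R]_d) (l : R) (o : 'I_d -> bool * bool) : set E :=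
  [set x : 'rV[R]_d | forall i, x ord0 i \in
    Interval (BSide (o i).1 (c ord0 i - l / 2))
             (BSide (o i).2 (c ord0 i + l / 2))].

Definition is_cube (l : R) (Q : set E) : Prop := exists c o, Q = cube c l o.

(* In \bar R, x / 0 = +oo for x > 0 while 0 / 0 = 0: finiteness forces mu to
   be zero or to charge every cube. *)
Definition doubling_const mu : \bar R :=
  ereal_sup [set K | exists c l o, 0 < l /\
    K = (mu (cube c (2 * l) o) / mu (cube c l o))%E].

Definition locally_finite mu : Prop :=
  forall x : 'rV[R]_d, exists U : set 'rV[R]_d,
    [/\ open U, U x & (mu U < +oo)%E].

Definition dyadic_grid D : Prop :=
  [/\ countable D,
      forall Q, D Q -> exists k : int, is_cube ((2 : R) ^ k) Q,
      forall k : int,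
        partition [set Q | D Q /\ is_cube ((2 : R) ^ k) Q] id setT &
      forall Q Q', D Q -> D Q' ->
        [\/ Q `&` Q' = set0, Q `&` Q' = Q | Q `&` Q' = Q']].

Definition children S (Q : set E) : set (set E) :=
  [set Q' | [/\ S Q', Q' `<` Q &
     forall Q'', S Q'' -> Q'' `<` Q -> Q' `<=` Q'' -> Q'' = Q']].

Definition sparse mu D S : Prop :=
  S `<=` D /\ forall Q, D Q ->
    (\esum_(Q' in children S Q) mu Q' <= 2^-1%:E * mu Q)%E.

End cubes.

Section complex_functions.
Context {R : realType} {d : nat}.
Local Notation E := (euclidean R d).
Local Notation C := R[i].
Implicit Types (mu : {measure set E -> \bar R}) (D S : set (set E)).
Implicit Types (A Q : set E) (f : E -> C) (w : E -> R).

(* Norms of a normed module over C are themselves elements of C. *)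
Definition rnorm (V : normedZmodType C) (v : V) : R := complex.Re `|v|.

Definition cmeasurable f : Prop :=
  measurable_fun setT (fun x => complex.Re (f x)) /\
  measurable_fun setT (fun x => complex.Im (f x)).

Definition cintegrable mu A f : Prop :=
  mu.-integrable A (fun x => (complex.Re (f x))%:E) /\
  mu.-integrable A (fun x => (complex.Im (f x))%:E).

Definition cintegral mu A f : C :=
  Complex (\int[mu]_(x in A) complex.Re (f x))
          (\int[mu]_(x in A) complex.Im (f x)).

Definition loc_cintegrable mu f : Prop :=
  forall K : set 'rV[R]_d, compact K -> cintegrable mu K f.

Definition cavg mu Q f : C :=
  ((fine (mu Q))^-1)%:C%C * cintegral mu Q f.

Definition ravg mu Q w : R :=
  (fine (mu Q))^-1 * \int[mu]_(x in Q) w x.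

Definition Linfty_norm mu f : \bar R := Lnorm mu +oo%E (fun x => (rnorm (f x))%:E).

Definition L0infty mu f : Prop :=
  [/\ cmeasurable f, (Linfty_norm mu f < +oo)%E &
      exists2 K : set 'rV[R]_d, compact K & forall x, ~ K x -> f x = 0].

Definition scalar_weight mu w : Prop :=
  {ae mu, forall x, 0 < w x} /\
  forall K : set 'rV[R]_d, compact K -> mu.-integrable K (fun x => (w x)%:E).

Definition dyadic_maximal mu D w (x : E) : \bar R :=
  ereal_sup [set (\1_Q x * ravg mu Q w)%:E | Q in D].

Definition Ainfty_const mu D w : \bar R :=
  ereal_sup [set ((\int[mu]_(x in Q) dyadic_maximal mu D (\1_Q \* w)%R x)
                  / (\int[mu]_(x in Q) (w x)%:E))%E | Q in D].

(* Sum of an absolutely summable family, by real and imaginary, positive and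
   negative parts. *)
Definition rsum (T : choiceType) (A : set T) (a : T -> R) : R :=
  fine (\esum_(i in A) ((EFin \o a)^\+ i) - \esum_(i in A) ((EFin \o a)^\- i))%E.

Definition csum (T : choiceType) (A : set T) (a : T -> C) : C :=
  Complex (rsum A (fun i => complex.Re (a i)))
          (rsum A (fun i => complex.Im (a i))).

Definition admissible mu S (psi : set E -> E -> C) : Prop :=
  forall Q, S Q -> [/\ cmeasurable (psi Q), forall x, ~ Q x -> psi Q x = 0 &
                       (Linfty_norm mu (psi Q) <= 1)%E].

(* For f in L0infty, mu doubling and S sparse, the series converges absolutely
   mu-almost everywhere. *)
Definition lerner mu S (psi phi : set E -> E -> C) f (x : E) : C :=
  csum S (fun Q => psi Q x * cavg mu Q (fun y => phi Q y * f y)).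

End complex_functions.

Definition separable_space (T : topologicalType) : Prop :=
  exists2 A : set T, countable A & dense A.

Section operators.
Context {R : realType} {H : completeNormedModType R[i]}.
Variable dot : {dot H for Num.conj}.
Implicit Types T S : H -> H.

(* {dot H for conj} is a positive definite sesquilinear form, linear in its
   first argument; hilbert_norm says that it induces the (complete) norm. *)
Definition hilbert_norm : Prop := forall x : H, `|x| ^+ 2 = dot x x.

Definition bounded_op T : Prop := linear T /\ continuous T.

Definition positive_op T : Prop := forall u, 0 <= dot (T u) u.

Definition is_inverse T S : Prop :=
  [/\ bounded_op S, cancel T S & cancel S T].

Definition invertible_op T : Prop := exists S, is_inverse T S.

Definition op_inv T : H -> H := xget (fun=> 0) [set S | is_inverse T S].

Definition op_sqrt T : H -> H :=
  xget (fun=> 0) [set S | [/\ bounded_op S, positive_op S &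
                              forall u, S (S u) = T u]].

Definition op_norm T : \bar R :=
  ereal_sup [set (rnorm (T u))%:E | u in [set u : H | `|u| <= 1]].

End operators.

Section operator_weights.
Context {R : realType} {d : nat} {H : completeNormedModType R[i]}.
Variable dot : {dot H for Num.conj}.
Local Notation E := (euclidean R d).
Local Notation C := R[i].
Implicit Types (mu : {measure set E -> \bar R}) (D S : set (set E)).
Implicit Types (W : E -> H -> H) (f : E -> H).

Definition inv_weight W : E -> H -> H := fun x => op_inv (W x).

Definition quad_weight W (e : H) : E -> R :=
  fun x => complex.Re (dot (W x e) e).

Definition op_weakly_loc_integrable mu D W : Prop :=
  (forall u v, loc_cintegrable mu (fun x => dot (W x u) v)) /\
  forall Q, D Q -> exists K : R, forall u v : H,
    `|cintegral mu Q (fun x => dot (W x u) v)| <= K%:C%C * (`|u| * `|v|).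

Definition operator_weight mu D W : Prop :=
  [/\ forall x, bounded_op (W x),
      {ae mu, forall x, positive_op dot (W x) /\ invertible_op (W x)},
      forall e, e != 0 -> scalar_weight mu (quad_weight W e),
      op_weakly_loc_integrable mu D W &
      op_weakly_loc_integrable mu D (inv_weight W)].

Definition op_avg mu W (Q : set E) : H -> H :=
  xget (fun=> 0) [set A | bounded_op A /\
    forall u v, dot (A u) v = cavg mu Q (fun x => dot (W x u) v)].

Definition A2_const mu D W : \bar R :=
  ereal_sup [set (op_norm (op_sqrt dot (op_avg mu W Q)
                           \o op_sqrt dot (op_avg mu (inv_weight W) Q)) ^+ 2)%E
            | Q in D].

Definition op_Ainfty_const mu D W : \bar R :=
  ereal_sup [set Ainfty_const mu D (quad_weight W e) | e in [set e | e != 0]].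

Definition weakly_loc_integrable mu f : Prop :=
  forall v, loc_cintegrable mu (fun x => dot (f x) v).

(* The norm of L^2_W, equal to +oo outside of this space. *)
Definition L2W_norm mu W f : \bar R :=
  if `[< weakly_loc_integrable mu f >] then
    sqrte (\int[mu]_x (rnorm (op_sqrt dot (W x) (f x)) ^+ 2)%:E)
  else +oo%E.

(* tensor_op T g e = (T (x) 1) (\sum_i g_i (x) e_i); for T = idfun this is the
   function \sum_i g_i (x) e_i itself. *)
Definition tensor_op (T : (E -> C) -> (E -> C)) n (g : 'I_n -> E -> C)
    (e : 'I_n -> H) : E -> H :=
  fun x => \sum_(i < n) T (g i) x *: e i.

(* Norm of T (x) 1 with respect to the norm of L^2_W, on its dense domain
   L0infty (x) H; it is also the norm of its continuous extension. *)
Definition tensor_op_norm mu W (T : (E -> C) -> (E -> C)) : \bar R :=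
  ereal_sup [set N | exists n (g : 'I_n -> E -> C) (e : 'I_n -> H),
    [/\ forall i, L0infty mu (g i),
        (L2W_norm mu W (tensor_op idfun g e) <= 1)%E &
        N = L2W_norm mu W (tensor_op T g e)]].

End operator_weights.

(* Main.v *)
Require Import Defs.
From HB Require Import structures.
From mathcomp Require Import all_boot all_order all_algebra.
From mathcomp Require Import complex.
From mathcomp Require Import all_classical all_reals all_analysis.
From mathcomp Require Import measurable_realfun ess_sup_inf ring lra.
Set Implicit Arguments.
Unset Strict Implicit.
Unset Printing Implicit Defensive.
Import Order.TTheory GRing.Theory Num.Theory.
Import numFieldNormedType.Exports.
Local Open Scope classical_set_scope.
Local Open Scope ring_scope.

(** For a vector b write w_b(x) = (W(x)b|b) and v_b(x) = (W(x)^-1 b|b). The idea is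
    to keep one vector fixed on each cube, so that every integral that occurs is the
    integral of a scalar weight w_b or v_b; no dimension enters, and the constant
    is 12.

    Let f = sum_i g_i e_i be normalized in L^2_W, put c_Q = <phi_Q f>_Q, so that
    the image of f is the sum of psi_Q c_Q, and let t_Q = sqrt(w_{c_Q}). The triangle
    inequality for the seminorm |W(x)^(1/2) u| bounds the norm of the image at x by
    the scalar sum of the t_Q(x) over the cubes Q containing x
    ([vec_lerner_le]).

    The square of such a sum is handled by [sparse_embedding]: if each density t_Q^2
    satisfies a Carleson condition with constant K on the cubes inside Q, then
    the integral of (sum_Q 1_Q t_Q)^2 is at most 6 K sum_Q x_Q, with
    x_Q = int_Q t_Q^2. Cauchy-Schwarz is used with weights that depend on the
    number n of selected cubes between x and Q; these weights have sum at most K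
    along any chain, while the Carleson condition, applied twice, bounds the
    second moment of n. For w_b with b fixed, the condition holds with K equal to
    twice the A_infty constant ([sparse_carleson]): the part of Q outside smaller
    selected cubes carries half of its measure, these parts are disjoint, and on
    them the maximal function of w_b exceeds the average of w_b over Q.

    To bound sum_Q x_Q, let A_Q be the average of W over Q, so that
    x_Q = mu(Q) (A_Q c_Q|c_Q), and test c_Q against b_Q = A_Q c_Q. Pointwise
    |(f|b)| <= |W^(1/2) f| |W^(-1/2) b|, hence x_Q is at most the integral over Q
    of |W^(1/2) f| s_Q, where s_Q = sqrt(v_{b_Q}) ([vec_testing]). The A_2 condition
    says exactly that int_Q s_Q^2 <= [W]_{A_2} x_Q ([A2_testing]). Applying the
    embedding to the s_Q, with the A_infty constant of the inverse weight, and
    absorbing sum_Q x_Q gives sum_Q x_Q <= 12 [W^-1] [W]_{A_2}, and a second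
    embedding, for the t_Q, gives 144 [W^-1] [W]_{A_2} [W] ([sparse_duality],
    [vec_lerner_bound]).

    The remaining parts make these expressions meaningful. Averages of weights
    exist by the Riesz theorem ([riesz], [represent_form]) and positive operators
    have square roots ([positive_sqrt_exists]). The scalar series converges
    almost everywhere and is locally integrable because [sparse_duality] also
    applies to the constant functions s_Q = t_Q = <|g|>_Q ([lerner_cvg_bound],
    [lerner_loc]). If mu and H are nonzero then the A_2 constant is positive
    and the A_infty constants are at least 1, so an infinite constant
    makes the right-hand side infinite. *)

(** * Weighted sums along chains of nested sets *)

Section weighted_sums.
Context {R : realType}.

(** Cauchy-Schwarz with weights p, obtained by expanding the square and applying
    2 t_i t_j <= p_i t_j^2 / p_j + p_j t_i^2 / p_i to each term. *)
Lemma sqr_sum_le_weighted (I : Type) (r : seq I) (P : pred I) (p t : I -> R) :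
  (forall i, P i -> 0 < p i) ->
  (\sum_(i <- r | P i) t i) ^+ 2 <=
    (\sum_(i <- r | P i) p i) * (\sum_(i <- r | P i) (p i)^-1 * t i ^+ 2).
Proof.
move=> p0.
have key i j : P i -> P j ->
    t i * t j <= 2^-1 * (p i * ((p j)^-1 * t j ^+ 2)) +
                 2^-1 * (p j * ((p i)^-1 * t i ^+ 2)).
  move=> Pi Pj; have := p0 _ Pi; have := p0 _ Pj => pj pi.
  have : 0 <= (p i * t j - p j * t i) ^+ 2 / (2 * (p i * p j)).
    by apply: divr_ge0; rewrite ?sqr_ge0// !mulr_ge0// ltW.
  suff -> : (p i * t j - p j * t i) ^+ 2 / (2 * (p i * p j)) =
     2^-1 * (p i * ((p j)^-1 * t j ^+ 2)) +
     2^-1 * (p j * ((p i)^-1 * t i ^+ 2)) - t i * t j by rewrite subr_ge0.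
  by field; rewrite !gt_eqF.
rewrite expr2 big_distrlr/= (_ : _ * _ =
  \sum_(i <- r | P i) \sum_(j <- r | P j)
    (2^-1 * (p i * ((p j)^-1 * t j ^+ 2)) +
     2^-1 * (p j * ((p i)^-1 * t i ^+ 2)))); last first.
  under [RHS]eq_bigr do rewrite big_split/=.
  rewrite [RHS]big_split/= [X in _ = _ + X]exchange_big/= big_distrlr/=.
  under [X in _ = X + _]eq_bigr do rewrite -mulr_sumr.
  under [X in _ = _ + X]eq_bigr do rewrite -mulr_sumr.
  rewrite -mulr_sumr -mulrDl.
  by rewrite -[LHS]mul1r; congr (_ * _); field.
by apply: ler_sum => i Pi; apply: ler_sum => j Pj; exact: key.
Qed.

(** The summand is K^2 (1 / (K + m - 1) - 1 / (K + m)), so the sum over all m > 0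
    telescopes to K. *)
Lemma sum_telescope_le (K : R) (s : seq nat) : 0 < K -> uniq s -> 0%N \notin s ->
  \sum_(m <- s) K ^+ 2 / ((K + m%:R) * (K + m%:R - 1)) <= K.
Proof.
move=> K0 us s0.
pose N := \max_(m <- s) m.
have sN m : m \in s -> m \in iota 1 N.
  move=> ms; rewrite mem_iota add1n ltnS (@leq_bigmax_seq _ s xpredT id m)// andbT.
  by rewrite lt0n; apply: contraNneq s0 => <-.
have p0 m : m \in iota 1 N -> 0 <= K ^+ 2 / ((K + m%:R) * (K + m%:R - 1)).
  rewrite mem_iota => /andP[m0 _].
  have m1 : (1 : R) <= m%:R by rewrite ler1n.
  by apply: divr_ge0; rewrite ?sqr_ge0// mulr_ge0//; lra.
have -> : \sum_(m <- s) K ^+ 2 / ((K + m%:R) * (K + m%:R - 1)) =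
    \sum_(m <- iota 1 N | m \in s) K ^+ 2 / ((K + m%:R) * (K + m%:R - 1)).
  rewrite -[RHS]big_filter; apply: perm_big; apply: uniq_perm => //.
    by rewrite filter_uniq// iota_uniq.
  by move=> m; rewrite mem_filter andb_idr//; exact: sN.
apply: (@le_trans _ _ (\sum_(m <- iota 1 N)
    K ^+ 2 / ((K + m%:R) * (K + m%:R - 1)))).
  rewrite big_mkcond [leRHS]big_seq big_seq; apply: ler_sum => m mN.
  by case: ifP => // _; exact: p0.
rewrite (_ : \sum_(m <- _) _ = K - K ^+ 2 / (K + N%:R)).
  by rewrite gerBl divr_ge0// ?sqr_ge0// addr_ge0// ltW.
elim: N {sN p0} => [|n IH]; first by rewrite big_nil addr0 expr2 mulfK ?subrr// gt_eqF.
rewrite -[n.+1]addn1 iotaD big_cat/= {}IH big_seq1 add1n addn1 -natr1.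
have n0 : (0 : R) <= n%:R by [].
by field; rewrite !gt_eqF//; lra.
Qed.
End weighted_sums.

(** Enumerates a family of sets by nat; unused indices carry the empty set, which
    is therefore the only set allowed to repeat. *)
Record nested_sequence d (T : measurableType d) (Q : nat -> set T) : Prop := {
  nested_meas : forall k, measurable (Q k) ;
  nested_or_disjoint : forall j k, [\/ Q j `&` Q k = set0, Q j `<=` Q k | Q k `<=` Q j] ;
  nested_inj : forall j k, Q j = Q k -> Q j !=set0 -> j = k }.

Section rank.
Context {R : realType} d (T : measurableType d).
Variable Q : nat -> set T.
Hypothesis nQ : nested_sequence Q.

Definition rank n k x := (\sum_(j < n) ((x \in Q j) && `[< Q j `<=` Q k >]))%N.

Lemma rank_gt0 n k x : (k < n)%N -> Q k x -> (0 < rank n k x)%N.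
Proof.
move=> kn kx; rewrite /rank (bigD1 (Ordinal kn))//= (mem_set kx).
by rewrite asboolT.
Qed.

(** The sets that contain x form a chain, and a strictly larger set of the chain
    counts at least itself in addition. *)
Lemma rank_inj n j k x : (j < n)%N -> (k < n)%N -> Q j x -> Q k x ->
  rank n j x = rank n k x -> j = k.
Proof.
wlog jk : j k / Q j `<=` Q k => [hw|].
  move=> jn kn jx kx E.
  have [jk0|jk|kj] := nested_or_disjoint nQ j k.
  - by have : (Q j `&` Q k) x by []; rewrite jk0.
  - exact: hw.
  - by apply/esym; exact: hw.
move=> jn kn jx kx E; apply: (nested_inj nQ); last by exists x.
apply/seteqP; split => //.
apply: contrapT => kj; move: E; apply/eqP; rewrite ltn_eqF//.
rewrite /rank (bigD1 (Ordinal kn))//= [ltnRHS](bigD1 (Ordinal kn))//=.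
rewrite (mem_set kx) (asboolF kj) asboolT// add0n add1n ltnS.
apply: leq_sum => i _; case: (x \in Q i) => //=.
by case: asboolP => // ij; rewrite asboolT//; exact: subset_trans jk.
Qed.

(** Decays like K^2 / m^2 beyond m = K, which makes the sum over m of order K,
    and is chosen among such sequences because it telescopes. *)
Definition rank_weight (K : R) (m : nat) : R :=
  (K ^+ 2 / ((K + m%:R) * (K + m%:R - 1))).

Lemma rank_weight_gt0 K m : 0 < K -> (0 < m)%N -> 0 < rank_weight K m.
Proof.
move=> K0 m0; have m1 : (1 : R) <= m%:R by rewrite ler1n.
by rewrite divr_gt0 ?exprn_gt0// mulr_gt0//; lra.
Qed.

Lemma sum_rank_weight_le (K : R) n x : 0 < K ->
  \sum_(k < n | x \in Q k) rank_weight K (rank n k x) <= K.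
Proof.
move=> K0.
rewrite -(big_mkord (fun k => x \in Q k) (fun k => rank_weight K (rank n k x))) -big_filter.
rewrite -(big_map (fun k => rank n k x) xpredT).
apply: sum_telescope_le => //.
  rewrite map_inj_in_uniq ?filter_uniq ?iota_uniq// => j k.
  rewrite !mem_filter !mem_index_iota/= => /andP[/set_mem jx jn] /andP[/set_mem kx kn].
  exact: rank_inj.
apply/mapP => -[k]; rewrite mem_filter mem_index_iota => /andP[/set_mem kx kn] /eqP.
by rewrite ltn_eqF//; exact: rank_gt0.
Qed.

(** The square of the rank counts pairs of sets inside Q k that contain x. The two
    sets of a pair are nested, so the smaller one determines a term on the right;
    2 accounts for the order of the pair. *)
Lemma sqr_rank_le n k x :
  ((rank n k x)%:R : R) ^+ 2 <=
  2 * \sum_(j < n | `[< Q j `<=` Q k >]) \sum_(i < n | `[< Q i `<=` Q j >]) \1_(Q i) x.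
Proof.
have -> : ((rank n k x)%:R : R) = \sum_(j < n | `[< Q j `<=` Q k >]) \1_(Q j) x.
  rewrite /rank natr_sum [RHS]big_mkcond; apply: eq_bigr => j _.
  by rewrite indicE; case: asboolP; rewrite ?andbT ?andbF.
rewrite expr2 big_distrlr/=.
have key (i j : nat) : (\1_(Q i) x * \1_(Q j) x : R) <=
   (`[< Q i `<=` Q j >]%:R) * \1_(Q i) x + (`[< Q j `<=` Q i >]%:R) * \1_(Q j) x.
  rewrite !indicE.
  have [ij|ij|ij] := nested_or_disjoint nQ i j.
  - case: (boolP (x \in Q i)) => /= [/set_mem ix|_]; last first.
      by rewrite mul0r addr_ge0// mulr_ge0.
    case: (boolP (x \in Q j)) => /= [/set_mem jx|_]; last first.
      by rewrite mulr0 addr_ge0// mulr_ge0.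
    by have : (Q i `&` Q j) x by []; rewrite ij.
  - by rewrite (asboolT ij) mul1r ler_wpDr ?mulr_ge0// ler_piMr// lern1 leq_b1.
  - by rewrite (asboolT ij) mul1r ler_wpDl ?mulr_ge0// ler_piMl// lern1 leq_b1.
apply: (@le_trans _ _ (\sum_(i < n | `[< Q i `<=` Q k >]) \sum_(j < n | `[< Q j `<=` Q k >])
   (`[< Q i `<=` Q j >]%:R * \1_(Q i) x + `[< Q j `<=` Q i >]%:R * \1_(Q j) x))).
  by apply: ler_sum => i ik; apply: ler_sum => j jk; exact: key.
under [leLHS]eq_bigr do rewrite big_split/=.
rewrite big_split/= exchange_big/= mulr2n mulrDl mul1r.
have A0 (i j : nat) : 0 <= (`[< Q i `<=` Q j >]%:R * \1_(Q i) x : R) by rewrite mulr_ge0.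
have M : \sum_(j < n | `[< Q j `<=` Q k >]) \sum_(i < n | `[< Q i `<=` Q k >])
     (`[< Q i `<=` Q j >]%:R * \1_(Q i) x : R) <=
   \sum_(j < n | `[< Q j `<=` Q k >]) \sum_(i < n | `[< Q i `<=` Q j >]) \1_(Q i) x.
  apply: ler_sum => j _; rewrite big_mkcond [leRHS]big_mkcond; apply: ler_sum => i _.
  by case: (`[< Q i `<=` Q k >]); case: (`[< Q i `<=` Q j >]); rewrite ?mul1r ?mul0r.
exact: lerD.
Qed.

Lemma rank_weight_inv_le (K : R) m : 0 < K -> (0 < m)%N ->
  (rank_weight K m)^-1 <= 2 + 2 * K ^- 2 * m%:R ^+ 2.
Proof.
move=> K0 m0; have m1 : (1 : R) <= m%:R by rewrite ler1n.
rewrite /rank_weight invf_div ler_pdivrMr ?exprn_gt0//.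
have -> : (2 + 2 * K ^- 2 * m%:R ^+ 2) * K ^+ 2 = 2 * K ^+ 2 + 2 * m%:R ^+ 2.
  by field; rewrite gt_eqF.
have := sqr_ge0 (K - m%:R); nra.
Qed.

End rank.

(** * The scalar embedding and the duality argument *)

Section nonneg_real_integrals.
Context {R : realType} d (T : measurableType d) (mu : {measure set T -> \bar R}).
Local Notation mf f := (measurable_fun [set: T] (f : T -> R)).

Lemma measurable_bigsum (I : Type) (s : seq I) (P : pred I) (f : I -> T -> R) :
  (forall i, mf (f i)) -> mf (fun x => \sum_(i <- s | P i) f i x).
Proof.
move=> mff; elim: s => [|i s IH].
  by under eq_fun do rewrite big_nil; exact: measurable_cst.
under eq_fun do rewrite big_cons; case: (P i) => //; exact: measurable_funD.
Qed.

Lemma nnint_le (f g : T -> R) : mf f -> mf g -> (forall x, 0 <= f x <= g x) ->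
  (\int[mu]_x (f x)%:E <= \int[mu]_x (g x)%:E)%E.
Proof.
move=> mff mg fg; apply: ge0_le_integral => //.
- by move=> x _; rewrite lee_fin; case/andP: (fg x).
- exact/measurable_EFinP.
- exact/measurable_EFinP.
- by move=> x _; rewrite lee_fin; case/andP: (fg x).
Qed.

Lemma nnintZ (k : R) (f : T -> R) : mf f -> (forall x, 0 <= f x) -> 0 <= k ->
  (\int[mu]_x (k * f x)%:E)%E = (k%:E * \int[mu]_x (f x)%:E)%E.
Proof.
move=> mff f0 k0; under eq_integral do rewrite EFinM.
by rewrite ge0_integralZl_EFin//; [move=> x _; rewrite lee_fin|exact/measurable_EFinP].
Qed.

Lemma nnintD (f g : T -> R) : mf f -> mf g -> (forall x, 0 <= f x) -> (forall x, 0 <= g x) ->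
  (\int[mu]_x (f x + g x)%:E)%E = (\int[mu]_x (f x)%:E + \int[mu]_x (g x)%:E)%E.
Proof.
move=> mff mg f0 g0; under eq_integral do rewrite EFinD.
by rewrite ge0_integralD//; [move=> x _; rewrite lee_fin|exact/measurable_EFinP|
  move=> x _; rewrite lee_fin|exact/measurable_EFinP].
Qed.

Lemma nnint_sum (I : Type) (s : seq I) (P : pred I) (f : I -> T -> R) :
  (forall i, mf (f i)) -> (forall i x, 0 <= f i x) ->
  (\int[mu]_x (\sum_(i <- s | P i) f i x)%R%:E)%E = (\sum_(i <- s | P i) \int[mu]_x (f i x)%:E)%E.
Proof.
move=> mff f0; rewrite -big_filter; under eq_integral do rewrite -big_filter -sumEFin.
rewrite ge0_integral_sum//; [move=> i; exact/measurable_EFinP|by move=> i x _; rewrite lee_fin].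
Qed.

Lemma int_indic (A : set T) (f : T -> R) :
  (\int[mu]_x (\1_A x * f x)%:E = \int[mu]_(x in A) (f x)%:E)%E.
Proof.
rewrite [RHS]integral_mkcond; apply: eq_integral => x _.
by rewrite patchE indicE; case: ifP; rewrite ?mul1r ?mul0r.
Qed.

End nonneg_real_integrals.

Section embedding.
Context {R : realType} d (T : measurableType d) (mu : {measure set T -> \bar R}).
Variable Q : nat -> set T.
Hypothesis nQ : nested_sequence Q.
Local Notation mf f := (measurable_fun [set: T] (f : T -> R)).

Definition carleson n (K : R) (w : T -> R) (A : set T) : Prop :=
  (\sum_(i < n | `[< Q i `<=` A >]) \int[mu]_(x in Q i) (w x)%:E <=
    K%:E * \int[mu]_(x in A) (w x)%:E)%E.

Let mQ k : measurable (Q k). Proof. exact: nested_meas nQ k. Qed.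

Let mindic k : mf (\1_(Q k)).
Proof. exact: measurable_indic. Qed.

(** Cauchy-Schwarz along the chain of sets containing a point, with weights
    given by the rank, costs the factor K. What remains is the integral of
    (2 + 2 rank^2 / K^2) t_k^2 over Q k; expanding rank^2 as a sum over pairs and
    using the Carleson condition for the inner and then for the outer set of a pair
    bounds it by (2 + 4) times the integral of t_k^2. *)
Lemma sparse_embedding n (K : R) (t : nat -> T -> R) : 0 < K ->
  (forall k, mf (t k)) -> (forall k x, 0 <= t k x) ->
  (forall j k, Q j `<=` Q k -> carleson n K (fun x => t k x ^+ 2) (Q j)) ->
  (\int[mu]_x ((\sum_(k < n) \1_(Q k) x * t k x) ^+ 2)%R%:E <=
    (6 * K)%:E * \sum_(k < n) \int[mu]_(x in Q k) (t k x ^+ 2)%:E)%E.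
Proof.
move=> K0 mt t0 C.
pose S k x : R := \sum_(j < n | `[< Q j `<=` Q k >])
  \sum_(i < n | `[< Q i `<=` Q j >]) \1_(Q i) x * t k x ^+ 2.
have mt2 k : mf (fun x => t k x ^+ 2) by exact: measurable_funX.
have m1t2 i k : mf (fun x => \1_(Q i) x * t k x ^+ 2) by exact: measurable_funM.
have m0 i k x : 0 <= \1_(Q i) x * t k x ^+ 2 :> R by rewrite mulr_ge0// sqr_ge0.
have mS k : mf (S k).
  by apply: measurable_bigsum => j; apply: measurable_bigsum => i.
have S0 k x : 0 <= S k x by apply: sumr_ge0 => j _; apply: sumr_ge0 => i _.
have pw x : (\sum_(k < n) \1_(Q k) x * t k x) ^+ 2 <=
   K * \sum_(k < n) (2 * (\1_(Q k) x * t k x ^+ 2) + 4 * K ^- 2 * S k x).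
  rewrite (_ : \sum_(k < n) \1_(Q k) x * t k x = \sum_(k < n | x \in Q k) t k x); last first.
    rewrite [RHS]big_mkcond; apply: eq_bigr => k _; rewrite indicE.
    by case: ifP; rewrite ?mul1r ?mul0r.
  apply: le_trans (@sqr_sum_le_weighted R _ _ _ (fun k : 'I_n => rank_weight K (rank Q n k x)) _ _) _.
    by move=> k /set_mem kx; apply: rank_weight_gt0 => //; exact: rank_gt0.
  have B0 (k : 'I_n) : x \in Q k -> 0 <= (rank_weight K (rank Q n k x))^-1 * t k x ^+ 2.
    move=> /set_mem kx; rewrite mulr_ge0 ?sqr_ge0// invr_ge0 ltW//.
    by apply: rank_weight_gt0 => //; exact: rank_gt0.
  apply: le_trans (ler_wpM2r (sumr_ge0 _ B0) (sum_rank_weight_le nQ n x K0)) _.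
  apply: ler_wpM2l; first exact: ltW.
  rewrite big_mkcond; apply: ler_sum => k _.
  case: ifPn => [kx|_]; last first.
    by rewrite addr_ge0// mulr_ge0// mulr_ge0// invr_ge0 sqr_ge0.
  have kx' := set_mem kx.
  rewrite indicE kx mul1r.
  apply: le_trans (ler_wpM2r (sqr_ge0 _) (rank_weight_inv_le K0 (rank_gt0 (ltn_ord k) kx'))) _.
  rewrite mulrDl lerD2l.
  apply: (@le_trans _ _ (2 * K ^- 2 * (2 * \sum_(j < n | `[< Q j `<=` Q k >])
       \sum_(i < n | `[< Q i `<=` Q j >]) \1_(Q i) x) * t k x ^+ 2)).
    apply: ler_wpM2r; rewrite ?sqr_ge0//; apply: ler_wpM2l; last exact: sqr_rank_le.
    by rewrite mulr_ge0// invr_ge0 sqr_ge0.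
  rewrite /S; under [X in _ <= _ * X]eq_bigr do rewrite -mulr_suml.
  rewrite -mulr_suml le_eqVlt; apply/orP; left; apply/eqP.
  by field; rewrite gt_eqF.
have K20 : 0 <= 4 * K ^- 2 by rewrite mulr_ge0// invr_ge0 sqr_ge0.
have mG k : mf (fun x => 2 * (\1_(Q k) x * t k x ^+ 2) + 4 * K ^- 2 * S k x).
  by apply: measurable_funD; apply: measurable_funM.
have G0 k x : 0 <= 2 * (\1_(Q k) x * t k x ^+ 2) + 4 * K ^- 2 * S k x.
  by rewrite addr_ge0// mulr_ge0.
apply: (@le_trans _ _ (\int[mu]_x (K * \sum_(k < n)
     (2 * (\1_(Q k) x * t k x ^+ 2) + 4 * K ^- 2 * S k x))%R%:E)%E).
  apply: nnint_le.
  - apply: measurable_funX; apply: measurable_bigsum => k; exact: measurable_funM.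
  - by apply: measurable_funM => //; exact: measurable_bigsum.
  - by move=> x; rewrite sqr_ge0/=.
rewrite nnintZ ?(ltW K0)//; last 2 first.
- exact: measurable_bigsum.
- by move=> x; exact: sumr_ge0.
rewrite nnint_sum// (mulrC 6) EFinM -muleA.
rewrite lee_pmul2l ?lte_fin//.
rewrite ge0_sume_distrr; last first.
  by move=> k _; apply: integral_ge0 => x _; rewrite lee_fin sqr_ge0.
apply: lee_sum => k _.
rewrite nnintD//; last 4 first.
- exact: measurable_funM.
- exact: measurable_funM.
- by move=> x; rewrite mulr_ge0.
- by move=> x; rewrite mulr_ge0.
rewrite nnintZ// nnintZ// int_indic.
set X := (\int[mu]_(x in Q k) _)%E.
have X0 : (0 <= X)%E by apply: integral_ge0 => x _; rewrite lee_fin sqr_ge0.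
have -> : (6%:E * X = 2%:E * X + 4%:E * X)%E.
  by rewrite -ge0_muleDl// -EFinD; congr (_%:E * _)%E; ring.
rewrite leeD2l//.
have SX : (\int[mu]_x (S k x)%:E <= (K ^+ 2)%:E * X)%E.
  rewrite nnint_sum//; last 2 first.
  - by move=> j; exact: measurable_bigsum.
  - by move=> j x; apply: sumr_ge0.
  apply: (@le_trans _ _ (\sum_(j < n | `[< Q j `<=` Q k >])
      K%:E * \int[mu]_(x in Q j) (t k x ^+ 2)%:E)%E).
    apply: lee_sum => j /asboolP jk; rewrite nnint_sum//.
    under eq_bigr do rewrite int_indic.
    exact: C.
  rewrite -ge0_sume_distrr; last first.
    by move=> j _; apply: integral_ge0 => x _; rewrite lee_fin sqr_ge0.
  by rewrite expr2 EFinM -muleA lee_pmul2l ?lte_fin//; exact: C.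
apply: le_trans (lee_wpmul2l _ SX) _; first by rewrite lee_fin.
rewrite muleA -EFinM (_ : 4 * K ^- 2 * K ^+ 2 = 4)//.
by field; rewrite gt_eqF.
Qed.

End embedding.

Section duality.
Context {R : realType} d (T : measurableType d) (mu : {measure set T -> \bar R}).
Variable Q : nat -> set T.
Hypothesis nQ : nested_sequence Q.
Local Notation mf f := (measurable_fun [set: T] (f : T -> R)).

Variables (K1 K2 B N : R) (h : T -> R) (s t : nat -> T -> R) (x : nat -> R).
Hypotheses (K10 : 0 < K1) (K20 : 0 < K2) (B0 : 0 < B).
Hypotheses (mh : mf h) (h0 : forall z, 0 <= h z).
Hypotheses (ms : forall k, mf (s k)) (s0 : forall k z, 0 <= s k z).
Hypotheses (mt : forall k, mf (t k)) (t0 : forall k z, 0 <= t k z).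
Hypothesis hN : (\int[mu]_z (h z ^+ 2)%:E <= N%:E)%E.
Hypothesis tx : forall k, (\int[mu]_(z in Q k) (t k z ^+ 2)%:E = (x k)%:E)%E.
Hypothesis sx : forall k, (\int[mu]_(z in Q k) (s k z ^+ 2)%:E <= (B * x k)%:E)%E.
Hypothesis xhs : forall k, ((x k)%:E <= \int[mu]_(z in Q k) (h z * s k z)%:E)%E.
Hypothesis sC : forall n j k, Q j `<=` Q k -> carleson mu Q n K1 (fun z => s k z ^+ 2) (Q j).
Hypothesis tC : forall n j k, Q j `<=` Q k -> carleson mu Q n K2 (fun z => t k z ^+ 2) (Q j).

Let mQ k : measurable (Q k). Proof. exact: nested_meas nQ k. Qed.

Let mindic k : mf (\1_(Q k)).
Proof. exact: measurable_indic. Qed.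

(** Summing the hypotheses xhs gives the integral of h G, with G the sum of the
    functions s k on Q k. The inequality 2 h G <= M h^2 + G^2 / M and the
    embedding for G, with M = 6 K1 B, bound it by (M N + sum x) / 2; the
    sum of the x k is finite and can be absorbed. *)
Lemma sum_testing_le n : \sum_(k < n) x k <= 6 * K1 * B * N.
Proof.
set X := \sum_(k < n) x k; pose M := 6 * K1 * B.
have M0 : 0 < M by rewrite !mulr_gt0.
pose G z := \sum_(k < n) \1_(Q k) z * s k z.
have mG : mf G by apply: measurable_bigsum => k; exact: measurable_funM.
have G0 z : 0 <= G z by apply: sumr_ge0 => k _; rewrite mulr_ge0.
have mh2 : mf (fun z => h z ^+ 2) by exact: measurable_funX.
have mG2 : mf (fun z => G z ^+ 2) by exact: measurable_funX.
have G2 : (\int[mu]_z (G z ^+ 2)%:E <= (M * X)%:E)%E.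
  apply: le_trans (sparse_embedding nQ K10 ms s0 (sC n)) _.
  rewrite (_ : M * X = 6 * K1 * (B * X)); last by rewrite /M; ring.
  rewrite [leRHS]EFinM lee_pmul2l ?lte_fin ?mulr_gt0//.
  by rewrite /X mulr_sumr -sumEFin; apply: lee_sum => k _; exact: sx.
have XE : (X%:E <= (2^-1 * (M * N + X))%:E)%E.
  apply: (@le_trans _ _ (\int[mu]_z (h z * G z)%:E)%E).
    rewrite /G; under eq_integral do rewrite mulr_sumr.
    rewrite nnint_sum; last 2 first.
    - by move=> k; apply: measurable_funM => //; exact: measurable_funM.
    - by move=> k z; rewrite mulr_ge0// mulr_ge0.
    rewrite /X -sumEFin; apply: lee_sum => k _.
    under eq_integral do rewrite mulrCA.
    by rewrite int_indic.
  apply: (@le_trans _ _ (\int[mu]_z (2^-1 * (M * h z ^+ 2 + M^-1 * G z ^+ 2))%:E)%E).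
    apply: nnint_le.
    - exact: measurable_funM.
    - by apply: measurable_funM => //; apply: measurable_funD; exact: measurable_funM.
    - move=> z; rewrite mulr_ge0//=.
      have : 0 <= (M * h z - G z) ^+ 2 / (2 * M).
        by rewrite divr_ge0 ?sqr_ge0// mulr_ge0// ltW.
      rewrite (_ : _ / _ = 2^-1 * (M * h z ^+ 2 + M^-1 * G z ^+ 2) - h z * G z).
        by rewrite subr_ge0.
      by field; rewrite gt_eqF.
  have A0 z : 0 <= M * h z ^+ 2 by rewrite mulr_ge0 ?sqr_ge0// ltW.
  have A1 z : 0 <= M^-1 * G z ^+ 2 by rewrite mulr_ge0 ?sqr_ge0// invr_ge0 ltW.
  have mA : mf (fun z => M * h z ^+ 2) by exact: measurable_funM.
  have mA' : mf (fun z => M^-1 * G z ^+ 2) by exact: measurable_funM.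
  rewrite nnintZ//; [|exact: measurable_funD|by move=> z; rewrite addr_ge0].
  rewrite nnintD// nnintZ// ?(ltW M0)//; last by move=> z; rewrite sqr_ge0.
  rewrite nnintZ// ?invr_ge0 ?(ltW M0)//; last by move=> z; rewrite sqr_ge0.
  rewrite [in leRHS]EFinM lee_pmul2l ?lte_fin// EFinD leeD//.
    by rewrite [leRHS]EFinM lee_pmul2l ?lte_fin.
  by rewrite lee_pdivrMl// -EFinM.
by move: XE; rewrite lee_fin -/M; lra.
Qed.

Lemma sparse_duality_partial n :
  (\int[mu]_z ((\sum_(k < n) \1_(Q k) z * t k z) ^+ 2)%R%:E <=
   (36 * K1 * K2 * B * N)%:E)%E.
Proof.
apply: le_trans (sparse_embedding nQ K20 mt t0 (tC n)) _.
under eq_bigr do rewrite tx.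
rewrite sumEFin -EFinM lee_fin.
have -> : 36 * K1 * K2 * B * N = (6 * K2) * (6 * K1 * B * N) by ring.
apply: ler_wpM2l; first by rewrite mulr_ge0// ltW.
exact: sum_testing_le.
Qed.

(** The majorant L is the increasing limit of the squares of the partial sums. *)
Theorem sparse_duality : exists L : T -> \bar R,
  [/\ measurable_fun [set: T] L,
      forall n z, (((\sum_(k < n) \1_(Q k) z * t k z) ^+ 2)%R%:E <= L z)%E &
      (\int[mu]_z L z <= (36 * K1 * K2 * B * N)%:E)%E].
Proof.
pose g n z := ((\sum_(k < n) \1_(Q k) z * t k z) ^+ 2)%R%:E.
have mg n : measurable_fun [set: T] (g n).
  apply/measurable_EFinP; apply: measurable_funX; apply: measurable_bigsum => k.
  exact: measurable_funM.
have p0 k z : 0 <= \1_(Q k) z * t k z by rewrite mulr_ge0.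
have nd z : {homo g^~ z : n m / (n <= m)%N >-> (n <= m)%E}.
  apply/nondecreasing_seqP => n; rewrite lee_fin.
  rewrite ler_sqr ?nnegrE ?sumr_ge0//.
  by rewrite big_ord_recr/= lerDl.
exists (fun z => limn (g^~ z)); split.
- apply: (@emeasurable_fun_cvg _ _ _ _ g) => // z _.
  exact: ereal_nondecreasing_is_cvgn.
- move=> n z; rewrite (cvg_lim _ (ereal_nondecreasing_cvgn (nd z)))//.
  by apply: ereal_sup_ubound; exists n.
- rewrite monotone_convergence//; last by move=> n z _; rewrite lee_fin sqr_ge0.
  apply: lime_le.
    apply: ereal_nondecreasing_is_cvgn; apply/nondecreasing_seqP => n.
    apply: ge0_le_integral => //; first by move=> z _; rewrite lee_fin sqr_ge0.
    by move=> z _; exact: (nd z).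
  by apply: nearW => n; exact: sparse_duality_partial.
Qed.

End duality.

(** * Cubes and dyadic grids *)

Section geometry.
Context {R : realType} {d : nat}.
Local Notation E := (euclidean R d).
Implicit Types (A B Q : set E).

Lemma open_meas A : open (A : set 'rV[R]_d) -> measurable A.
Proof. by move=> oA; apply: sub_sigma_algebra. Qed.

Lemma closed_meas A : closed (A : set 'rV[R]_d) -> measurable A.
Proof. by move=> cA; rewrite -[A]setCK; apply: measurableC; apply: open_meas; rewrite openC. Qed.

Lemma compact_meas A : compact (A : set 'rV[R]_d) -> measurable A.
Proof. by move=> cA; apply: closed_meas; apply: compact_closed => //; exact: norm_hausdorff. Qed.

Lemma measurable_coord (i : 'I_d) :
  measurable_fun [set: E] (fun x : E => (x : 'rV[R]_d) ord0 i).
Proof.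
apply: (measurability _ (RGenOInfty.measurableE R)) => //.
move=> _ [_ [a ->] <-]; rewrite setTI; apply: open_meas.
by apply: open_comp => // x _; exact: coord_continuous.
Qed.

Lemma cube_meas c l o : measurable (cube c l o : set E).
Proof.
rewrite (_ : cube c l o = \bigcap_(i in [set: 'I_d]) [set x : E | (x : 'rV[R]_d) ord0 i \in
    Interval (BSide (o i).1 (c ord0 i - l / 2))
             (BSide (o i).2 (c ord0 i + l / 2))]); last first.
  by apply/seteqP; split => [x xQ i _|x xQ i]; [exact: xQ|exact: (xQ i I)].
apply: fin_bigcap_measurable => [|i _]; first exact: finite_finset.
rewrite -[X in measurable X]setTI.
exact: (measurable_coord i measurableT (measurable_itv _)).
Qed.

Definition closed_cube (c : 'rV[R]_d) (l : R) : set E :=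
  [set x : 'rV[R]_d | forall i, x ord0 i \in `[c ord0 i - l / 2, c ord0 i + l / 2]].

Lemma compact_closed_cube c l : compact (closed_cube c l : set 'rV[R]_d).
Proof.
exact: (@rV_compact R d (fun i => `[c ord0 i - l / 2, c ord0 i + l / 2]%classic)
  (fun i => @segment_compact _ _ _)).
Qed.

Lemma cube_sub_closed c l o : cube c l o `<=` closed_cube c l.
Proof.
move=> x xQ i; move: (xQ i); rewrite /= !itv_boundlr => /andP[xl xr].
apply/andP; split; [apply: le_trans xl|apply: le_trans xr _] => /=.
  by case: ((o i).1); rewrite ?lexx// bnd_simp.
by case: ((o i).2); rewrite ?lexx// bnd_simp.
Qed.

Lemma compact_fin_meas (mu : {measure set E -> \bar R}) (A : set E) :
  locally_finite mu -> compact (A : set 'rV[R]_d) -> (mu A < +oo)%E.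
Proof.
move=> lf cA.
have /choice[U HU] : forall x : 'rV[R]_d, exists U : set 'rV[R]_d,
    [/\ open U, U x & (mu U < +oo)%E] by exact: lf.
have mA : measurable A by exact: compact_meas.
move: cA; rewrite compact_cover => /(_ _ A U).
case=> [x _|x Ax|F FA AF]; first by case: (HU x).
  by exists x => //; case: (HU x).
have [X finX AX] : exists2 X : set 'rV[R]_d, finite_set X & A `<=` cover X U.
  by eexists; [exact: (finite_fset F)|exact: AF].
have AU : (mu A <= \sum_(i \in X) mu (U i : set E))%E.
  apply: content_sub_fsum => //.
  by move=> i _; apply: open_meas; case: (HU i).
apply: (le_lt_trans AU).
rewrite fsbig_finite//=; apply: lte_sum_pinfty => i _.
by case: (HU i).
Qed.

End geometry.

Section grid.
Context {R : realType} {d : nat}.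
Local Notation E := (euclidean R d).
Implicit Types (A B Q : set E) (D S : set (set E)).

(** Compares the two points of the small cube on its diagonal at distance
    t = (l + l') / 4 < l / 2 from the center on either side. The argument is
    insensitive to which faces belong to the cubes. *)
Lemma cube_side_le (c c' : 'rV[R]_d) l l' o o' : (0 < d)%N -> 0 < l ->
  cube c l o `<=` cube c' l' o' -> l <= l'.
Proof.
move=> d0 l0 sub; rewrite leNgt; apply/negP => ll'.
pose i := Ordinal d0.
pose p (t : R) : 'rV[R]_d := \row_j (c ord0 j + t).
have inp t : `|t| < l / 2 -> cube c l o (p t).
  rewrite ltr_norml => /andP[t1 t2] j; rewrite mxE itv_boundlr.
  by apply/andP; split; case: (o j) => [[] []] /=; rewrite bnd_simp; lra.
have inp' t : cube c' l' o' (p t) -> `|c ord0 i + t - c' ord0 i| <= l' / 2.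
  move=> /(_ i); rewrite mxE itv_boundlr => /andP[x1 x2].
  have {}x1 : c' ord0 i - l' / 2 <= c ord0 i + t.
    by move: x1; case: ((o' i).1); rewrite bnd_simp// => /ltW.
  have {}x2 : c ord0 i + t <= c' ord0 i + l' / 2.
    by move: x2; case: ((o' i).2); rewrite bnd_simp// => /ltW.
  by rewrite ler_norml; lra.
have l'0 : 0 <= l'.
  have /sub/inp' : cube c l o (p 0) by apply: inp; rewrite normr0; lra.
  by move=> /(le_trans (normr_ge0 _)); lra.
pose t := (l + l') / 4.
have tl : `|t| < l / 2 by rewrite ger0_norm /t; lra.
have /sub/inp' : cube c l o (p t) by exact: inp.
have /sub/inp' : cube c l o (p (- t)) by apply: inp; rewrite normrN.
by rewrite !ler_norml => /andP[x1 x2] /andP[x3 x4]; rewrite /t in x1 x4; lra.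
Qed.

Section with_grid.
Variable D : set (set E).
Hypothesis gD : dyadic_grid D.

Lemma grid_cube Q : D Q -> exists k c o, Q = cube c ((2 : R) ^ (k : int)) o.
Proof. by case: gD => _ q _ _ /q[k [c [u ->]]]; exists k, c, u. Qed.

Lemma grid_meas Q : D Q -> measurable Q.
Proof. by move=> /grid_cube[k [c [u ->]]]; exact: cube_meas. Qed.

Lemma grid_compact Q : D Q -> exists2 K : set E, compact (K : set 'rV[R]_d) & Q `<=` K.
Proof.
move=> /grid_cube[k [c [u ->]]]; exists (closed_cube c (2 ^ k)).
  exact: compact_closed_cube.
exact: cube_sub_closed.
Qed.

Lemma grid_nonempty Q : D Q -> Q !=set0.
Proof.
move=> DQ; have [k [c [u QE]]] := grid_cube DQ.
by case: gD => _ _ p _; case: (p k) => _ _; apply; split => //; exists c, u.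
Qed.

Lemma grid_same_side Q Q' (k : int) : D Q -> D Q' ->
  is_cube (2 ^ k) Q -> is_cube (2 ^ k) Q' -> Q `&` Q' !=set0 -> Q = Q'.
Proof.
move=> DQ DQ' kQ kQ' QQ'.
by case: gD => _ _ p _; case: (p k) => _ tr _; apply: (tr Q Q').
Qed.

Lemma grid_nested Q Q' : D Q -> D Q' ->
  [\/ Q `&` Q' = set0, Q `<=` Q' | Q' `<=` Q].
Proof.
move=> DQ DQ'; case: gD => _ _ _ q; case: (q _ _ DQ DQ') => QQ'.
- by apply: Or31.
- by apply: Or32; apply/setIidPl.
- by apply: Or33; apply/setIidPr.
Qed.

(** In dimension 0 all cubes coincide and no strict inclusion exists. *)
Lemma grid_side_le Q Q' (k k' : int) : D Q -> D Q' -> is_cube (2 ^ k) Q ->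
  is_cube (2 ^ k') Q' -> Q `<` Q' -> (k <= k')%R.
Proof.
move=> DQ DQ' [c [u QE]] [c' [u' QE']] QQ'.
have [d0|d0] := posnP d.
  exfalso; case: QQ' => _; apply; move: (grid_nonempty DQ) => [x Qx].
  move=> y _; suff -> : y = x by [].
  apply/rowP => i; suff: False by [].
  by have := ltn_ord i; rewrite {2}d0.
rewrite leNgt; apply/negP => kk'.
have := properW QQ'; rewrite QE QE' => /(cube_side_le d0).
rewrite exprz_gt0// => /(_ isT).
by rewrite leNgt ltr_eXz2l ?kk'// ltr1n.
Qed.

(** Strictly increasing chains of grid cubes have strictly increasing sidelengths,
    so among the cubes of S between Q' and Q one of largest sidelength exists, and it
    is maximal. *)
Lemma sub_child S Q Q' : S `<=` D -> D Q -> S Q' -> Q' `<` Q ->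
  exists2 P, children S Q P & Q' `<=` P.
Proof.
move=> SD DQ SQ' Q'Q.
have [b [cb [ob QE]]] := grid_cube DQ.
have [a [ca [oa QE']]] := grid_cube (SD _ SQ').
have isQ : is_cube (2 ^ b) Q by exists cb, ob.
have isQ' : is_cube (2 ^ a) Q' by exists ca, oa.
pose ok (n : nat) := exists P, [/\ S P, Q' `<=` P, P `<` Q & is_cube (2 ^ (b - n%:Z)) P].
have side P (k : int) : S P -> P `<` Q -> is_cube (2 ^ k) P ->
    exists2 n : nat, k = b - n%:Z & True.
  move=> SP PQ kP; have kb := grid_side_le (SD _ SP) DQ kP isQ PQ.
  by exists `|b - k|%N => //; rewrite gez0_abs ?subr_ge0//; lra.
have : exists n, `[< ok n >].
  have [n an _] := side _ _ SQ' Q'Q isQ'.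
  by exists n; apply/asboolP; exists Q'; split => //; rewrite -an.
move=> /ex_minnP[n /asboolP[P [SP Q'P PQ nP]] minn].
exists P => //; split => // P' SP' P'Q PP'.
apply: contrapT => nPP'.
have sPP' : P `<` P'.
  by split => // P'P; apply: nPP'; apply/seteqP.
have [k [c [u P'E]]] := grid_cube (SD _ SP').
have kP' : is_cube (2 ^ k) P' by exists c, u.
have [m km _] := side _ _ SP' P'Q kP'.
have le1 := grid_side_le (SD _ SP) (SD _ SP') nP kP' sPP'.
have mn : (n <= m)%N.
  apply: minn; apply/asboolP; exists P'; split => //; first exact: subset_trans PP'.
  by rewrite -km.
have nm : n = m by apply/eqP; rewrite eqn_leq mn/=; move: le1; rewrite km lerD2l lerN2.
apply: nPP'; apply/esym; apply: (@grid_same_side _ _ (b - n%:Z)) => //; try exact: SD.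
  by rewrite nm -km.
have /setIidPl -> := PP'; exact: grid_nonempty (SD _ SP).
Qed.

(** The value set0 stands for the natural numbers that encode no cube. *)
Lemma grid_enum S : S `<=` D -> exists Q : nat -> set E,
  [/\ nested_sequence Q, forall k, S (Q k) \/ Q k = set0 &
      forall A, S A -> exists k, Q k = A].
Proof.
move=> SD.
have /countable_injP[f finj] : countable S.
  by case: gD => cD _ _ _; exact: sub_countable (subset_card_le SD) cD.
pose Q k := xget set0 [set A | S A /\ f A = k].
have QP k : (S (Q k) /\ f (Q k) = k) \/ Q k = set0.
  by rewrite /Q; case: xgetP => [A -> [SA fA]|_]; [left|right].
have Q0 k : measurable (Q k).
  by case: (QP k) => [[/SD/grid_meas]|->].
exists Q; split => //.
- split => //.
  + move=> j k; case: (QP j) => [[Sj _]|->]; last by apply: Or31; rewrite set0I.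
    case: (QP k) => [[Sk _]|->]; last by apply: Or31; rewrite setI0.
    by apply: grid_nested; exact: SD.
  + move=> j k jk [x jx]; case: (QP j) => [[_ fj]|j0]; last by rewrite j0 in jx.
    case: (QP k) => [[_ fk]|k0]; last by rewrite jk k0 in jx.
    by rewrite -fj -fk jk.
- by move=> k; case: (QP k) => [[]|]; [left|right].
- move=> A SA; exists (f A); rewrite /Q; case: xgetP => [B _ [SB fB]|/(_ A)[]//].
  by apply: finj; rewrite ?inE.
Qed.

End with_grid.
End grid.

(** * Integrals of functions that need not be measurable *)

Section integral_comparison.
Context {R : realType} d (T : measurableType d) (mu : {measure set T -> \bar R}).
Import HBNNSimple.
Local Open Scope ereal_scope.

(** A simple function below f can be cut off on the exceptional null set; the result
    has the same integral and lies below g. Only the simple function is measurable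
    here; the comparison serves the norm of W^(1/2) f and dyadic maximal functions,
    whose measurability is not at hand. *)
Lemma ge0_le_integral_ae (f g : T -> \bar R) :
  (forall x, 0 <= f x) -> (forall x, 0 <= g x) -> {ae mu, forall x, f x <= g x} ->
  \int[mu]_x f x <= \int[mu]_x g x.
Proof.
move=> f0 g0 [N [mN N0 fgN]].
rewrite ge0_integralTE//; apply: ge_ereal_sup => _ [h /= hf <-].
pose k := mul_nnsfun h (indic_nnsfun R (measurableC mN)).
have -> : sintegral mu h = sintegral mu k.
  rewrite -!integralT_nnsfun; apply: ae_eq_integral => //.
  - exact/measurable_EFinP.
  - exact/measurable_EFinP.
  - exists N; split => // x /= hk; apply: contrapT => Nx; apply: hk => _.
    change ((h x)%:E = (h x * \1_(~` N) x)%:E).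
    by rewrite indicE mem_set// mulr1.
rewrite ge0_integralTE//; apply: ereal_sup_ubound; exists k => // x.
change ((h x * \1_(~` N) x)%:E <= g x).
rewrite indicE; case: (boolP (x \in ~` N)) => [xN|_]; rewrite ?mulr0// mulr1.
apply: le_trans (hf x) _; apply: contrapT => fg.
by move: (set_mem xN); apply; exact: fgN.
Qed.

Lemma ge0_eq_integral_ae (f g : T -> \bar R) :
  (forall x, 0 <= f x) -> (forall x, 0 <= g x) -> {ae mu, forall x, f x = g x} ->
  \int[mu]_x f x = \int[mu]_x g x.
Proof.
move=> f0 g0 fg; apply/eqP; rewrite eq_le; apply/andP; split.
  by apply: ge0_le_integral_ae => //; apply: filterS fg => x ->.
by apply: ge0_le_integral_ae => //; apply: filterS fg => x ->.
Qed.

Lemma ge0_le_integral_on (A : set T) (f g : T -> \bar R) :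
  (forall x, A x -> 0 <= f x) -> (forall x, A x -> f x <= g x) ->
  \int[mu]_(x in A) f x <= \int[mu]_(x in A) g x.
Proof.
move=> f0 fg; rewrite integral_mkcond [leRHS]integral_mkcond.
apply: ge0_le_integral_ae.
- by move=> x; rewrite patchE; case: ifP => // /set_mem; exact: f0.
- move=> x; rewrite patchE; case: ifP => // /set_mem Ax.
  exact: le_trans (f0 _ Ax) (fg _ Ax).
- by apply: aeW => x; rewrite !patchE; case: ifP => // /set_mem; exact: fg.
Qed.

(** When y = 0 the quotient is finite only if X = 0, because 0^-1 = +oo. *)
Lemma le_of_ratio_le (X y : \bar R) (a : R) : 0 <= X -> 0 <= y -> y < +oo ->
  X / y <= a%:E -> X <= a%:E * y.
Proof.
move: y => [y| |]// X0; rewrite lee_fin => y0 _.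
have [->|y1] := eqVneq y 0%R.
  rewrite inve0 => Xa; have [->|X1] := eqVneq X 0; first by rewrite mule0.
  by move: Xa; rewrite gt0_muley ?lt_def ?X1.
by rewrite inver (negbTE y1) lee_pdivrMr ?lt_def ?y1.
Qed.
End integral_comparison.

(** * Carleson condition from the dyadic A_infty constant *)

Section sparse_carleson.
Context {R : realType} {d : nat}.
Local Notation E := (euclidean R d).
Variables (mu : {measure set E -> \bar R}) (D S : set (set E)).
Hypotheses (lf : locally_finite mu) (gD : dyadic_grid D) (sS : sparse mu D S).
Variable Q : nat -> set E.
Hypotheses (nQ : nested_sequence Q) (QS : forall k, S (Q k) \/ Q k = set0).

Let SD : S `<=` D. Proof. by case: sS. Qed.
Let mQ k : measurable (Q k). Proof. exact: nested_meas nQ k. Qed.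

Lemma grid_fin_meas A : D A -> (mu A < +oo)%E.
Proof.
move=> DA; have [K cK AK] := grid_compact gD DA.
apply: le_lt_trans (compact_fin_meas lf cK).
by apply: le_measure; rewrite ?inE//; [exact: grid_meas DA|exact: compact_meas].
Qed.

Lemma grid_fin_num A : D A -> mu A \is a fin_num.
Proof. by move=> DA; rewrite ge0_fin_numE//; exact: grid_fin_meas. Qed.

(** Only the first n cubes are removed, as many as occur in a partial sum. *)
Definition below n k : set E := \bigcup_(j in [set j | (j < n)%N /\ Q j `<` Q k]) Q j.

Lemma below_meas n k : measurable (below n k).
Proof.
apply: fin_bigcup_measurable; last by move=> j _.
by apply: (sub_finite_set _ (finite_II n)) => j [].
Qed.

(** Each cube strictly inside Q k lies in some maximal one, and the maximal ones have
    total measure at most half of that of Q k by sparseness. *)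
Lemma below_le n k : S (Q k) -> (mu (below n k) <= 2^-1%:E * mu (Q k))%E.
Proof.
move=> Sk; case: sS => _ /(_ _ (SD Sk)); apply: le_trans.
have /choice[P HP] : forall j, exists P, S (Q j) -> Q j `<` Q k ->
    children S (Q k) P /\ Q j `<=` P.
  move=> j; have [[Sj jk]|H] := pselect (S (Q j) /\ Q j `<` Q k).
    have [P chP jP] := sub_child gD SD (SD Sk) Sj jk.
    by exists P.
  by exists set0 => Sj jk; exfalso; apply: H.
pose J := [set j | [/\ (j < n)%N, Q j `<` Q k & S (Q j)]].
have finJ : finite_set J by apply: (sub_finite_set _ (finite_II n)) => j [].
apply: (@le_trans _ _ (\sum_(A \in P @` J) mu A)%E).
  apply: (@content_sub_fsum _ _ _ mu _ (P @` J) _ id).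
  - exact: finite_image.
  - move=> _ [j [jn jk Sj] <-]; have [[SP _ _] _] := HP _ Sj jk.
    exact: grid_meas (SD SP).
  - exact: (below_meas n _).
  - move=> x [j [jn jk] jx]; case: (QS j) => [Sj|j0]; last by rewrite j0 in jx.
    have [_ jP] := HP _ Sj jk.
    by exists (P j); [exists j|exact: jP].
apply: esum_ge; exists (P @` J) => //; split; first exact: finite_image.
by move=> _ [j [jn jk Sj] <-]; have [] := HP _ Sj jk.
Qed.

Definition free_part n k : set E := Q k `\` below n k.

Lemma free_part_meas n k : measurable (free_part n k).
Proof. by apply: measurableD => //; exact: (below_meas n _). Qed.

Lemma free_part_ge n k : (mu (Q k) <= 2%:E * mu (free_part n k))%E.
Proof.
case: (QS k) => [Sk|->]; last by rewrite measure0 mule_ge0.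
have : (mu (Q k) <= mu (free_part n k) + mu (below n k))%E.
  rewrite -measureU; last 3 first.
  - exact: (free_part_meas n _).
  - exact: (below_meas n _).
  - by rewrite /free_part setDE -setIA setICl setI0.
  apply: le_measure; rewrite ?inE//.
    by apply: measurableU; [exact: (free_part_meas n _)|exact: (below_meas n _)].
  by move=> x kx; have [|] := pselect (below n k x); [right|left].
move=> /le_trans /(_ (leeD2l _ (below_le n Sk))).
have fk := grid_fin_num (SD Sk).
have ff : mu (free_part n k) \is a fin_num.
  rewrite ge0_fin_numE//; apply: le_lt_trans (grid_fin_meas (SD Sk)).
  by apply: le_measure; rewrite ?inE//; [exact: (free_part_meas n _)|move=> x []].
rewrite -(fineK fk) -(fineK ff) -!EFinM -EFinD !lee_fin; lra.
Qed.

(** Of two nested cubes, the larger one gave up the smaller one. *)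
Lemma free_part_disjoint n i j x : (i < n)%N -> (j < n)%N ->
  free_part n i x -> free_part n j x -> i = j.
Proof.
move=> iN jN [ix ib] [jx jb].
have [//|ij] := eqVneq i j.
have Qij : Q i <> Q j.
  by move=> /(nested_inj nQ) => /(_ (ex_intro _ x ix)); apply/eqP.
exfalso; have [ij0|sub|sub] := nested_or_disjoint nQ i j.
- by have : (Q i `&` Q j) x by []; rewrite ij0.
- by apply: jb; exists i => //; split => //; split => // ji; apply: Qij; apply/seteqP.
- by apply: ib; exists j => //; split => //; split => // ji; apply: Qij; apply/seteqP.
Qed.

Variables (w : E -> R) (a : R).
Hypotheses (iw : forall A, D A -> mu.-integrable A (EFin \o w)).
Hypotheses (w0 : forall A, D A -> 0 <= \int[mu]_(x in A) w x).
Hypothesis wa : (Ainfty_const mu D w <= a%:E)%E.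

Let wE A : D A -> (\int[mu]_(x in A) (w x)%:E = (\int[mu]_(x in A) w x)%:E)%E.
Proof.
by move=> DA; rewrite /Rintegral fineK//; apply: integrable_fin_num; [exact: grid_meas DA|exact: iw].
Qed.

Lemma ravg_ge0 A : D A -> 0 <= ravg mu A w.
Proof. by move=> DA; rewrite mulr_ge0 ?w0// invr_ge0 fine_ge0. Qed.

Lemma ravg_local A B : A `<=` B -> ravg mu A (\1_B \* w) = ravg mu A w.
Proof.
move=> AB; congr (_ * _); apply: eq_Rintegral => x /set_mem Ax /=.
by rewrite indicE mem_set ?mul1r//; exact: AB.
Qed.

Lemma int_ravg A : D A -> (\int[mu]_(x in A) (w x)%:E = (ravg mu A w)%:E * mu A)%E.
Proof.
move=> DA; have fA := grid_fin_num DA.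
have [A0|A0] := eqVneq (mu A) 0%E.
  rewrite A0 mule0; apply: null_set_integral => //; first exact: grid_meas DA.
  exact: (measurable_int _ (iw DA)).
rewrite wE// -(fineK fA) -EFinM /ravg mulrAC mulVf ?mul1r//.
by rewrite fine_eq0.
Qed.

(** The integral of w over Q i is at most twice the average of w over Q i times
    the measure of the free part of Q i. These free parts are disjoint subsets of
    Q j, and there the dyadic maximal function of 1_{Q j} w is at least
    the average; so the sum is at most twice the integral of the maximal
    function over Q j. *)
Lemma sparse_carleson n j : carleson mu Q n (2 * a) w (Q j).
Proof.
rewrite /carleson; case: (QS j) => [Sj|->]; last first.
  rewrite integral_set0 mule0 big1// => i /asboolP; rewrite subset0 => ->.
  by rewrite integral_set0.
have Dj := SD Sj.
set J := Q j in Dj *.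
have Jw : (\int[mu]_(x in J) dyadic_maximal mu D (\1_J \* w)%R x <=
    a%:E * \int[mu]_(x in J) (w x)%:E)%E.
  have M0 x : J x -> (0 <= dyadic_maximal mu D (\1_J \* w)%R x)%E.
    move=> Jx; apply: (@le_trans _ _ (ravg mu J (\1_J \* w))%:E).
      by rewrite lee_fin ravg_local// ravg_ge0.
    by apply: ereal_sup_ubound; exists J => //; rewrite indicE mem_set ?mul1r.
  apply: le_of_ratio_le.
  - exact: integral_ge0.
  - by rewrite wE// lee_fin w0.
  - by rewrite wE// ltry.
  - by apply: le_trans wa; apply: ereal_sup_ubound; exists J.
rewrite EFinM -muleA; apply: le_trans (lee_wpmul2l _ Jw) => //.
pose m x := \sum_(i < n | `[< Q i `<=` J >]) \1_(free_part n i) x * ravg mu (Q i) w.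
have r0 i : 0 <= ravg mu (Q i) w.
  case: (QS i) => [/SD/ravg_ge0//|->].
  by rewrite /ravg Rintegral_set0 mulr0.
apply: (@le_trans _ _ (2%:E * \int[mu]_x (m x)%:E)%E).
  rewrite /m nnint_sum; last 2 first.
  - by move=> i; apply: measurable_funM => //; apply: measurable_indic; exact: (free_part_meas n _).
  - by move=> i x; rewrite mulr_ge0.
  rewrite ge0_sume_distrr; last first.
    by move=> i _; apply: integral_ge0 => x _; rewrite lee_fin mulr_ge0.
  apply: lee_sum => i _.
  under [in leRHS]eq_integral do rewrite mulrC.
  rewrite nnintZ//; last by apply: measurable_indic; exact: (free_part_meas n _).
  rewrite integral_indic//; last exact: (free_part_meas n _).
  rewrite setIT.
  case: (QS i) => [Si|i0]; last first.
    by rewrite {1}i0 integral_set0 !mule_ge0// lee_fin.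
  rewrite int_ravg; last exact: SD.
  rewrite muleCA; apply: lee_wpmul2l; first by rewrite lee_fin.
  exact: free_part_ge.
apply: lee_wpmul2l => //.
have -> : (\int[mu]_x (m x)%:E = \int[mu]_(x in J) (m x)%:E)%E.
  rewrite [RHS]integral_mkcond; apply: eq_integral => x _; rewrite patchE.
  case: ifPn => // /negP xJ; congr EFin; rewrite /m big1// => i /asboolP iJ.
  rewrite indicE; case: (boolP (x \in _)) => [/set_mem[ix _]|]; last by rewrite mul0r.
  by exfalso; apply: xJ; apply/mem_set; exact: iJ.
apply: ge0_le_integral_on.
  by move=> x _; rewrite lee_fin; apply: sumr_ge0 => i _; rewrite mulr_ge0.
move=> x Jx.
have [[i [iJ ix]]|none] := pselect (exists i : 'I_n, Q i `<=` J /\ free_part n i x).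
  rewrite /m (bigD1 i)/=; last exact/asboolP.
  rewrite big1 ?addr0; last first.
    move=> k /andP[_ ki]; rewrite indicE.
    case: (boolP (x \in _)) => [/set_mem kx|]; last by rewrite mul0r.
    have := free_part_disjoint (ltn_ord k) (ltn_ord i) kx ix.
    by move=> /val_inj ki'; rewrite ki' eqxx in ki.
  apply: ereal_sup_ubound; exists (Q i).
    by case: (QS i) => [/SD//|i0]; case: ix; rewrite i0.
  rewrite ravg_local// !indicE !mem_set//; by case: ix.
rewrite (_ : m x = 0).
  apply: (@le_trans _ _ (ravg mu J (\1_J \* w))%:E).
    by rewrite lee_fin ravg_local// ravg_ge0.
  by apply: ereal_sup_ubound; exists J => //; rewrite indicE mem_set ?mul1r.
rewrite /m big1// => i /asboolP iJ; rewrite indicE.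
case: (boolP (x \in _)) => [/set_mem ix|]; last by rewrite mul0r.
by exfalso; apply: none; exists i.
Qed.

End sparse_carleson.

(** * Positive semidefinite sesquilinear forms *)

Section complex_numbers.
Context {R : rcfType}.
Implicit Types z w : R[i].
Local Notation Re := (@complex.Re R).
Local Notation Im := (@complex.Im R).

Lemma conjE z : Num.conj z = conjc z. Proof. by []. Qed.

Lemma cReD z w : Re (z + w) = Re z + Re w.
Proof. by case: z w => [a b] [c d]. Qed.

Lemma cImD z w : Im (z + w) = Im z + Im w.
Proof. by case: z w => [a b] [c d]. Qed.

Lemma cReM z w : Re (z * w) = Re z * Re w - Im z * Im w.
Proof. by case: z w => [a b] [c d]. Qed.

Lemma cImM z w : Im (z * w) = Re z * Im w + Im z * Re w.
Proof. by case: z w => [a b] [c d]. Qed.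

Lemma cRe_conj z : Re (Num.conj z) = Re z. Proof. by case: z. Qed.
Lemma cIm_conj z : Im (Num.conj z) = - Im z. Proof. by case: z. Qed.

Lemma complexP z w : Re z = Re w -> Im z = Im w -> z = w.
Proof. by case: z w => [a b] [c d] /= -> ->. Qed.

Lemma cRe_sum I (r : seq I) (P : pred I) (F : I -> R[i]) :
  Re (\sum_(i <- r | P i) F i) = \sum_(i <- r | P i) Re (F i).
Proof. exact: (big_morph _ cReD). Qed.

Lemma cIm_sum I (r : seq I) (P : pred I) (F : I -> R[i]) :
  Im (\sum_(i <- r | P i) F i) = \sum_(i <- r | P i) Im (F i).
Proof. exact: (big_morph _ cImD). Qed.

Lemma ge0_ReE z : (0 <= z) = (Im z == 0) && (0 <= Re z).
Proof. by rewrite lecE. Qed.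

Lemma norm_ReE z : Re `|z| = Num.sqrt (Re z ^+ 2 + Im z ^+ 2).
Proof. by rewrite normc_def. Qed.

Lemma Re_norm_le z : `|Re z| <= Re `|z|.
Proof.
rewrite norm_ReE -sqrtr_sqr; apply: ler_wsqrtr.
by rewrite lerDl sqr_ge0.
Qed.

Lemma Im_norm_le z : `|Im z| <= Re `|z|.
Proof.
rewrite norm_ReE -sqrtr_sqr; apply: ler_wsqrtr.
by rewrite lerDr sqr_ge0.
Qed.

End complex_numbers.

(** Evaluates the quadratic polynomial at its minimum - s / q. *)
Lemma discriminant_le (R : realFieldType) (a s q : R) : 0 <= q ->
  (forall t : R, 0 <= a + 2 * t * s + t ^+ 2 * q) -> s ^+ 2 <= a * q.
Proof.
move=> q0 key; have [q1|q1] := eqVneq q 0.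
  rewrite q1 mulr0 exprn_even_le0//=; apply/eqP.
  have [//|s0] := eqVneq s 0.
  have := key (- (a + 1) / (2 * s)).
  rewrite q1 mulr0 addr0.
  have -> : 2 * (- (a + 1) / (2 * s)) * s = - (a + 1) by field.
  lra.
have q2 : 0 < q by rewrite lt_def q1.
have := key (- s / q).
have -> : a + 2 * (- s / q) * s + (- s / q) ^+ 2 * q = (a * q - s ^+ 2) / q by field.
by rewrite pmulr_lge0 ?invr_gt0// subr_ge0.
Qed.

Record psd_form (R : rcfType) (V : lmodType R[i]) (B : V -> V -> R[i]) : Prop := {
  psdDl : forall u v w, B (u + v) w = B u w + B v w ;
  psdZl : forall a u v, B (a *: u) v = a * B u v ;
  psdDr : forall u v w, B u (v + w) = B u v + B u w ;
  psdZr : forall a u v, B u (a *: v) = Num.conj a * B u v ;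
  psd_ge0 : forall u, 0 <= B u u }.

Section psd.
Context {R : rcfType} (V : lmodType R[i]) (B : V -> V -> R[i]).
Hypothesis pB : psd_form B.
Local Notation Re := (@complex.Re R).
Local Notation Im := (@complex.Im R).

Definition qf u := Re (B u u).

Lemma qf_ge0 u : 0 <= qf u.
Proof. by have := psd_ge0 pB u; rewrite ge0_ReE => /andP[]. Qed.

Lemma psd_diag u : B u u = (qf u)%:C%C.
Proof.
have := psd_ge0 pB u; rewrite ge0_ReE => /andP[/eqP i0 _].
by apply: complexP.
Qed.

(** Hermitian symmetry comes for free over the complex numbers: the form is real
    at u + v and at u + i v (polarization). *)
Lemma psd_sym u v : B v u = Num.conj (B u v).
Proof.
have I0 w : Im (B w w) = 0 by rewrite psd_diag.
have := I0 (u + v); have := I0 (u + 'i%C *: v).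
rewrite !(psdDl pB) !(psdDr pB) !(psdZl pB) !(psdZr pB) !cImD !cImM ?cReM ?cImD !I0.
rewrite cRe_conj cIm_conj /= => h1 h2.
apply: complexP; rewrite ?cRe_conj ?cIm_conj; lra.
Qed.

Lemma qfZ a u : qf (a *: u) = (Re a ^+ 2 + Im a ^+ 2) * qf u.
Proof.
rewrite /qf (psdZl pB) (psdZr pB) psd_diag !cReM !cImM cRe_conj cIm_conj /=; ring.
Qed.

Lemma qfD u v : qf (u + v) = qf u + 2 * Re (B u v) + qf v.
Proof.
rewrite /qf !(psdDl pB) !(psdDr pB) !cReD (psd_sym u v) cRe_conj; ring.
Qed.

Lemma psd_Re_CauchySchwarz u v : Re (B u v) ^+ 2 <= qf u * qf v.
Proof.
apply: discriminant_le (qf_ge0 v) _ => t.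
have := qf_ge0 (u + t%:C%C *: v).
by rewrite qfD qfZ (psdZr pB) cReM cRe_conj cIm_conj /= expr0n/= addr0 oppr0 mul0r subr0 mulrA.
Qed.

(** Rotating v by the phase of B u v reduces the modulus to a real part. *)
Lemma psd_CauchySchwarz u v : Re `|B u v| <= Num.sqrt (qf u) * Num.sqrt (qf v).
Proof.
set b := B u v; pose n2 := Re b ^+ 2 + Im b ^+ 2.
have n20 : 0 <= n2 by rewrite addr_ge0 ?sqr_ge0.
have := psd_Re_CauchySchwarz u (b *: v).
rewrite (psdZr pB) -/b qfZ -/n2 cReM cRe_conj cIm_conj.
have -> : Re b * Re b - - Im b * Im b = n2 by rewrite /n2; ring.
have quv : 0 <= qf u * qf v by rewrite mulr_ge0 ?qf_ge0.
move=> h; rewrite norm_ReE -/n2 -sqrtrM ?qf_ge0//.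
apply: ler_wsqrtr.
have [->//|n2n] := eqVneq n2 0.
have n2p : 0 < n2 by rewrite lt_def n2n.
rewrite -(ler_pM2l n2p) -expr2; apply: le_trans h _.
by rewrite mulrCA.
Qed.

Lemma sqrt_qfD u v : Num.sqrt (qf (u + v)) <= Num.sqrt (qf u) + Num.sqrt (qf v).
Proof.
rewrite -[leRHS]ger0_norm ?addr_ge0 ?sqrtr_ge0// -sqrtr_sqr; apply: ler_wsqrtr.
rewrite sqrrD !sqr_sqrtr ?qf_ge0// qfD lerD2r lerD2l mulr2n mulrDl mul1r.
suff : Re (B u v) <= Num.sqrt (qf u) * Num.sqrt (qf v) by move=> h; exact: lerD.
apply: le_trans (psd_CauchySchwarz u v).
exact: le_trans (ler_norm _) (Re_norm_le _).
Qed.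

Lemma sqrt_qf_sum (I : Type) (r : seq I) (P : pred I) (a : I -> R[i]) (e : I -> V) :
  Num.sqrt (qf (\sum_(i <- r | P i) a i *: e i)) <=
  \sum_(i <- r | P i) Re `|a i| * Num.sqrt (qf (e i)).
Proof.
elim: r => [|i r IH].
  have q0 : qf 0 = 0 by rewrite -(scale0r 0) qfZ /= expr0n/= addr0 mul0r.
  by rewrite !big_nil q0 sqrtr0.
rewrite !big_cons; case: (P i) => //.
apply: le_trans (sqrt_qfD _ _) _; apply: lerD => //.
by rewrite qfZ sqrtrM ?addr_ge0 ?sqr_ge0// norm_ReE.
Qed.
End psd.

(** * Completeness, Riesz representation and square roots *)

Section hilbert.
Context {R : realType} {H : completeNormedModType R[i]}.
Local Notation Re := (@complex.Re R).
Local Notation Im := (@complex.Im R).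
Local Notation nm := (@rnorm R H).
Implicit Types (u v w : H).

Lemma rnormE (V : normedZmodType R[i]) (u : V) : `|u| = (rnorm u)%:C%C.
Proof.
rewrite /rnorm; have := normr_ge0 u; rewrite ge0_ReE => /andP[/eqP i0 _].
exact: complexP.
Qed.

Lemma rnorm_ge0 (V : normedZmodType R[i]) (u : V) : 0 <= rnorm u.
Proof. by have := normr_ge0 u; rewrite rnormE lecR. Qed.

Lemma rnorm_triangle (V : normedZmodType R[i]) (u v : V) : rnorm (u + v) <= rnorm u + rnorm v.
Proof. by rewrite -lecR rmorphD/= -!rnormE; exact: ler_normD. Qed.

Lemma rnormN (V : normedZmodType R[i]) (u : V) : rnorm (- u) = rnorm u.
Proof. by rewrite /rnorm normrN. Qed.

Lemma rnormM (a b : R[i]) : rnorm (a * b) = rnorm a * rnorm b.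
Proof. by apply: (@complexI R); rewrite rmorphM/= -!rnormE normrM. Qed.

Lemma rnormZ (a : R[i]) u : nm (a *: u) = rnorm a * nm u.
Proof. by apply: (@complexI R); rewrite rmorphM/= -!rnormE normrZ. Qed.

Lemma rnorm_real (a : R) : rnorm (a%:C%C : R[i]) = `|a|.
Proof. by rewrite /rnorm norm_ReE /= expr0n addr0 sqrtr_sqr. Qed.

Lemma rnorm_eq0 u : nm u = 0 -> u = 0.
Proof. by move=> u0; apply/eqP; rewrite -normr_eq0 rnormE u0. Qed.

Lemma rnorm0 : nm 0 = 0.
Proof. by rewrite /rnorm normr0. Qed.

(** Convergence with an explicit rate: r controls both the oscillation of the
    sequence and the distance to the limit. *)
Lemma hilbert_complete (x : nat -> H) (r : nat -> R) :
  (forall n m, (n <= m)%N -> nm (x m - x n) <= r n) -> r @ \oo --> 0 ->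
  exists l, forall n, nm (l - x n) <= r n.
Proof.
move=> xr r0.
have xcvg : cvg (x @ \oo).
  apply: cauchy_cvg; apply: cauchy_exP => e e0.
  have eE : e = (Re e)%:C%C.
    by move: e0; rewrite ltcE => /andP[/eqP/= ei _]; apply: complexP.
  have e0' : 0 < Re e by move: e0; rewrite ltcE => /andP[].
  have [N _ HN] := (@cvgr0Pnorm_lt _ _ _ _ _ _).1 r0 _ e0'.
  exists (x N), N => // m /= Nm.
  rewrite -ball_normE /ball_/= distrC rnormE eE ltcR.
  apply: le_lt_trans (xr _ _ Nm) _.
  by apply: le_lt_trans (ler_norm _) _; exact: (HN N (leqnn N)).
exists (limn x) => n; apply/ler_addgt0Pr => e e0.
have ec : 0 < e%:C%C by rewrite ltcR.
have [N _ HN] := (@cvgrPdist_lt _ _ _ _ _ _ _).1 xcvg _ ec.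
pose m := maxn n N.
have /HN : (N <= m)%N by rewrite leq_maxr.
rewrite rnormE ltcR => lm.
rewrite (_ : limn x - x n = (x m - x n) + (limn x - x m)); last first.
  by rewrite [RHS]addrC addrA subrK.
apply: le_trans (rnorm_triangle _ _) _; apply: lerD; last exact: ltW.
by apply: xr; rewrite leq_maxl.
Qed.

Lemma linear_add (T : H -> H) : linear T -> forall u v, T (u + v) = T u + T v.
Proof. by move=> lT u v; have := lT 1 u v; rewrite !scale1r. Qed.

Lemma linear_zero (T : H -> H) : linear T -> T 0 = 0.
Proof.
by move=> lT; apply: (addrI (T 0)); rewrite -(linear_add lT) !addr0.
Qed.

Lemma linear_scale (T : H -> H) : linear T -> forall a u, T (a *: u) = a *: T u.
Proof. by move=> lT a u; have := lT a u 0; rewrite (linear_zero lT) !addr0. Qed.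

Lemma linear_opp (T : H -> H) : linear T -> forall u, T (- u) = - T u.
Proof. by move=> lT u; rewrite -scaleN1r (linear_scale lT) scaleN1r. Qed.

Lemma linear_sub (T : H -> H) : linear T -> forall u v, T (u - v) = T u - T v.
Proof. by move=> lT u v; rewrite (linear_add lT) (linear_opp lT). Qed.

Lemma bounded_opP (T : H -> H) : bounded_op T <->
  linear T /\ exists2 K : R, 0 <= K & forall u, nm (T u) <= K * nm u.
Proof.
split=> [[lT cT]|[lT [K K0 TK]]]; (split; first by []);
  pose f : {linear H -> H} := HB.pack T (GRing.isLinear.Build _ _ _ _ T lT).
  have /linear_boundedP/pinfty_ex_gt0[M M0 HM] :=
    (linear_bounded_continuous f).2 cT.
  have MR : M = (Re M)%:C%C.
    by move: M0; rewrite ltcE => /andP[/eqP/= ei _]; apply: complexP.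
  exists (Re M); first by move: M0; rewrite ltcE => /andP[_ /ltW].
  by move=> u; have := HM u; rewrite !rnormE MR -rmorphM/= lecR.
apply: ((linear_bounded_continuous f).1).
apply/linear_boundedP; exists K%:C%C.
split; first by rewrite realE lecR K0.
move=> r Kr u; rewrite /= rnormE; apply: (@le_trans _ _ (K%:C%C * `|u|)).
  by rewrite rnormE -rmorphM/= lecR; exact: TK.
by apply: ler_wpM2r => //; exact: ltW.
Qed.

End hilbert.

Section hilbert_operators.
Context {R : realType} {H : completeNormedModType R[i]}.
Variable dot : {dot H for Num.conj}.
Hypothesis hn : hilbert_norm dot.
Local Notation Re := (@complex.Re R).
Local Notation Im := (@complex.Im R).
Local Notation nm := (@rnorm R H).
Implicit Types (u v w : H) (T : H -> H).

Lemma psd_dot : psd_form dot.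
Proof.
split.
- by move=> u v w; exact: linearDl.
- by move=> a u v; exact: linearZl_LR.
- by move=> u v w; exact: linearDr.
- by move=> a u v; exact: linearZr_LR.
- by move=> u; exact: dnorm_ge0.
Qed.

Lemma qf_dot u : qf dot u = nm u ^+ 2.
Proof. by rewrite /qf -hn rnormE -rmorphXn. Qed.

Lemma sqrt_qf_dot u : Num.sqrt (qf dot u) = nm u.
Proof. by rewrite qf_dot sqrtr_sqr ger0_norm// rnorm_ge0. Qed.

Lemma dot_CauchySchwarz u v : rnorm (dot u v) <= nm u * nm v.
Proof. by rewrite -!sqrt_qf_dot; exact: (psd_CauchySchwarz psd_dot). Qed.

Lemma Re_dot_le u v : `|Re (dot u v)| <= nm u * nm v.
Proof. exact: le_trans (Re_norm_le _) (dot_CauchySchwarz u v). Qed.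

Lemma dot_sym u v : dot v u = Num.conj (dot u v).
Proof. exact: (psd_sym psd_dot). Qed.

Lemma dotNr u v : dot u (- v) = - dot u v.
Proof. by rewrite -scaleN1r (psdZr psd_dot) rmorphN1 mulN1r. Qed.

Lemma dotNl u v : dot (- u) v = - dot u v.
Proof. by rewrite -scaleN1r (psdZl psd_dot) mulN1r. Qed.

Lemma dotBl u v w : dot (u - v) w = dot u w - dot v w.
Proof. by rewrite (psdDl psd_dot) dotNl. Qed.

Lemma dotBr u v w : dot w (u - v) = dot w u - dot w v.
Proof. by rewrite (psdDr psd_dot) dotNr. Qed.

Lemma dot_inj u v : (forall w, dot u w = dot v w) -> u = v.
Proof.
move=> uv; apply/eqP; rewrite -subr_eq0; apply/eqP; apply: rnorm_eq0.
apply/eqP; rewrite -sqrf_eq0 -qf_dot /qf dotBl uv subrr.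
by [].
Qed.

Lemma cReN (z : R[i]) : Re (- z) = - Re z. Proof. by case: z. Qed.

Lemma Re_i_conj (z : R[i]) : Re (Num.conj 'i%C * z) = Im z.
Proof. by rewrite cReM cRe_conj cIm_conj /= mul0r sub0r mulN1r opprK. Qed.

Lemma Re_i (z : R[i]) : Re ('i%C * z) = - Im z.
Proof. by rewrite cReM /= mul0r mul1r sub0r. Qed.

(** A near-minimizer x n of |y|^2 - 2 Re (l y) satisfies the Euler equation
    Re (x n|h) = Re (l h) up to an error e n |h|. Testing the difference of two of
    these equations with h = x k - x n shows that the sequence is Cauchy,
    and the limit satisfies the equation exactly. *)
Lemma riesz (l : H -> R[i]) (K : R) :
  (forall a u v, l (a *: u + v) = a * l u + l v) ->
  (forall v, rnorm (l v) <= K * nm v) ->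
  exists x, forall v, l v = dot v x.
Proof.
move=> ll lK.
have lD u v : l (u + v) = l u + l v by have := ll 1 u v; rewrite scale1r mul1r.
have l0 : l 0 = 0 by apply: (addrI (l 0)); rewrite -lD !addr0.
have lZ a u : l (a *: u) = a * l u by have := ll a u 0; rewrite l0 !addr0.
pose F y : R := nm y ^+ 2 - 2 * Re (l y).
have Flb y : - K ^+ 2 <= F y.
  have : Re (l y) <= K * nm y.
    by apply: le_trans (ler_norm _) _; apply: le_trans (Re_norm_le _) (lK _).
  have := sqr_ge0 (nm y - K); rewrite /F; nra.
have Finf : has_inf (range F).
  by split; [exists (F 0), 0|exists (- K ^+ 2) => _ [y _ <-]].
pose m := inf (range F).
have mF y : m <= F y by apply: ge_inf; [case: Finf|exists y].
pose e (n : nat) : R := n.+1%:R^-1.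
have e0 n : 0 < e n by rewrite invr_gt0.
have /choice[x xP] : forall n, exists y, F y < m + e n ^+ 2.
  move=> n; have [|_ [y _ <-] yF] := @inf_adherent _ (range F) (e n ^+ 2) _ Finf.
    by rewrite exprn_gt0.
  by exists y.
have euler n h : `|Re (dot (x n) h) - Re (l h)| <= e n * nm h.
  set s := Re (dot (x n) h) - Re (l h).
  have key (t : R) : 0 <= e n ^+ 2 + 2 * t * s + t ^+ 2 * nm h ^+ 2.
    have := mF (x n + t%:C%C *: h); rewrite /F.
    rewrite -qf_dot (qfD psd_dot) (qfZ psd_dot) (psdZr psd_dot) lD lZ.
    rewrite cReM !cReD cReM cRe_conj cIm_conj /= expr0n/= !qf_dot.
    have := xP n; rewrite /F /s; lra.
  rewrite -[leRHS]ger0_norm; last by rewrite mulr_ge0 ?rnorm_ge0// ltW.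
  rewrite -ler_sqr ?nnegrE// !real_normK ?num_real// exprMn.
  by apply: discriminant_le => //; exact: sqr_ge0.
have cau n k : (n <= k)%N -> nm (x k - x n) <= 2 * e n.
  move=> nk; set h := x k - x n.
  have [->|h0] := eqVneq (nm h) 0; first by rewrite mulr_ge0// ltW.
  have hp : 0 < nm h by rewrite lt_def h0 rnorm_ge0.
  rewrite -(ler_pM2r hp) -expr2 -qf_dot /qf {1}/h dotBl cReD cReN.
  have ekn : e k <= e n by rewrite lef_pV2 ?posrE// ler_nat.
  have := euler n h; have := euler k h; rewrite !ler_norml => /andP[_ a1] /andP[a2 _].
  have : e k * nm h <= e n * nm h by rewrite ler_pM2r.
  lra.
have ecvg : (fun n => 2 * e n) @ \oo --> 0.
  by rewrite -[X in _ --> X](mulr0 2); apply: cvgMl_tmp; exact: cvg_harmonic.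
have [y yP] := hilbert_complete cau ecvg.
have ReE h : Re (dot y h) = Re (l h).
  apply/eqP; rewrite -subr_eq0; apply/eqP; apply/normr0_eq0.
  apply/eqP; rewrite eq_le normr_ge0 andbT.
  have bd n : `|Re (dot y h) - Re (l h)| <= (2 * e n) * nm h + e n * nm h.
    have -> : Re (dot y h) - Re (l h) =
        Re (dot (y - x n) h) + (Re (dot (x n) h) - Re (l h)).
      by rewrite dotBl cReD cReN; lra.
    apply: le_trans (ler_normD _ _) _; apply: lerD => //.
    apply: le_trans (Re_dot_le _ _) _; apply: ler_wpM2r; first exact: rnorm_ge0.
    exact: yP.
  have c : (fun n => (2 * e n) * nm h + e n * nm h) @ \oo --> 0 * nm h + 0 * nm h.
    by apply: cvgD; apply: cvgMr_tmp => //; exact: cvg_harmonic.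
  rewrite -[leRHS](addr0 0) -[X in _ <= X + _](mul0r (nm h)) -[X in _ <= _ + X](mul0r (nm h)).
  by apply: (cvgr_to_ge c); apply: nearW.
exists y => v; rewrite dot_sym; apply: complexP.
  by rewrite cRe_conj ReE.
have := ReE ('i%C *: v); rewrite (psdZr psd_dot) lZ Re_i_conj Re_i cIm_conj => ->.
by rewrite opprK.
Qed.

End hilbert_operators.

Section square_roots.
Context {R : realType} {H : completeNormedModType R[i]}.
Variable dot : {dot H for Num.conj}.
Hypothesis hn : hilbert_norm dot.
Local Notation Re := (@complex.Re R).
Local Notation Im := (@complex.Im R).
Local Notation nm := (@rnorm R H).
Implicit Types (u v w : H) (T : H -> H).

(** Riesz representation in the second variable; linearity of the resulting
    operator follows from uniqueness of the representing vector. *)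
Lemma represent_form (a : H -> H -> R[i]) (K : R) :
  (forall c u v w, a (c *: u + v) w = c * a u w + a v w) ->
  (forall c u v w, a w (c *: u + v) = Num.conj c * a w u + a w v) ->
  (forall u v, rnorm (a u v) <= K * (nm u * nm v)) ->
  exists A, bounded_op A /\ forall u v, dot (A u) v = a u v.
Proof.
move=> al ar aK.
have K0 : 0 <= K \/ forall u v, a u v = 0.
  have [K0|K0] := leP 0 K; [by left|right] => u v.
  apply/eqP; rewrite -normr_eq0 rnormE eq_complex/= eqxx andbT.
  rewrite eq_le rnorm_ge0 andbT; apply: le_trans (aK u v) _.
  by rewrite mulr_le0_ge0 ?(ltW K0)// mulr_ge0 ?rnorm_ge0.
have /choice[A AP] : forall u, exists x, forall v, Num.conj (a u v) = dot v x.
  move=> u; apply: (riesz hn (K := K * nm u)).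
    by move=> c x y; rewrite ar rmorphD rmorphM/= conjCK.
  move=> v; rewrite -mulrA; apply: le_trans (aK u v).
  by rewrite /rnorm norm_conjC.
have {}AP u v : dot (A u) v = a u v by rewrite dot_sym// -AP conjCK.
exists A; split => //; apply/bounded_opP; split.
  move=> c u v; apply: (dot_inj hn) => w.
  by rewrite (psdDl (psd_dot dot)) (psdZl (psd_dot dot)) !AP al.
exists `|K| => // u.
have [->|u0] := eqVneq (nm (A u)) 0; first by rewrite mulr_ge0// rnorm_ge0.
have up : 0 < nm (A u) by rewrite lt_def u0 rnorm_ge0.
rewrite -(ler_pM2r up) -expr2 -(qf_dot hn) /qf AP.
apply: le_trans (ler_norm _) _; apply: le_trans (Re_norm_le _) _.
apply: le_trans (aK _ _) _; rewrite mulrA ler_pM2r//.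
by apply: ler_wpM2r; [exact: rnorm_ge0|exact: ler_norm].
Qed.

Definition op_form T u v := dot (T u) v.

Lemma psd_op T : linear T -> positive_op dot T -> psd_form (op_form T).
Proof.
move=> lT pT; split; rewrite /op_form.
- by move=> u v w; rewrite (linear_add lT) (psdDl (psd_dot dot)).
- by move=> a u v; rewrite (linear_scale lT) (psdZl (psd_dot dot)).
- by move=> u v w; rewrite (psdDr (psd_dot dot)).
- by move=> a u v; rewrite (psdZr (psd_dot dot)).
- exact: pT.
Qed.

Definition self_adjoint T := forall u v, dot (T u) v = dot u (T v).

Lemma positive_self_adjoint T : linear T -> positive_op dot T -> self_adjoint T.
Proof.
move=> lT pT u v; rewrite [RHS](dot_sym dot).
by rewrite -[LHS]/(op_form T u v) (psd_sym (psd_op lT pT) v u).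
Qed.

(** Cauchy-Schwarz for the form (T u|v) at v = T u reads
    |T u|^4 <= (T u|u) (T T u|T u), and the last factor is at most c |T u|^2. *)
Lemma positive_op_sqr_le T (c : R) : linear T -> positive_op dot T ->
  (forall u, nm (T u) <= c * nm u) -> forall u, nm (T u) ^+ 2 <= c * qf (op_form T) u.
Proof.
move=> lT pT Tc u.
have pf := psd_op lT pT.
have := psd_Re_CauchySchwarz pf u (T u).
rewrite {1}/op_form -/(qf dot (T u)) (qf_dot hn) => cs.
have q2 : qf (op_form T) (T u) <= c * nm (T u) ^+ 2.
  apply: le_trans (ler_norm _) _; apply: le_trans (Re_dot_le hn _ _) _.
  by rewrite expr2 mulrA; apply: ler_wpM2r; [exact: rnorm_ge0|exact: Tc].
have [->|t0] := eqVneq (nm (T u) ^+ 2) 0.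
  have c0 : 0 <= c * nm (T u) by exact: le_trans (rnorm_ge0 _) (Tc (T u)).
  have [u0|u0] := eqVneq (nm (T u)) 0; last first.
    rewrite mulr_ge0 ?(qf_ge0 pf)//.
    by move: c0; rewrite pmulr_lge0// lt_def u0 rnorm_ge0.
  rewrite (_ : qf (op_form T) u = 0) ?mulr0//.
  by rewrite /qf /op_form (rnorm_eq0 u0) -(scale0r 0) (psdZl (psd_dot dot)) mul0r.
have tp : 0 < nm (T u) ^+ 2 by rewrite lt_def t0 sqr_ge0.
rewrite -(ler_pM2r tp) -expr2; apply: le_trans cs _.
rewrite -mulrA mulrCA; apply: ler_wpM2l; first exact: qf_ge0.
exact: q2.
Qed.

Section sqrt_iteration.
Variables (A : H -> H).
Hypotheses (lA : linear A) (sA : self_adjoint A) (A1 : forall u, nm (A u) <= nm u).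

(** The limit Y of Y_{n+1} = (A + Y_n^2) / 2 satisfies (1 - Y)^2 = 1 - A. The
    scalar iteration [sqrt_bound], where A is replaced by 1, dominates the
    operator iteration step by step. *)
Fixpoint sqrt_iter n u : H :=
  if n is m.+1 then 2^-1%:C%C *: (A u + sqrt_iter m (sqrt_iter m u)) else 0.

Fixpoint sqrt_bound n : R :=
  if n is m.+1 then 2^-1 * (1 + sqrt_bound m ^+ 2) else 0.

Local Notation Y := sqrt_iter.
Local Notation y := sqrt_bound.

Lemma sqrt_bound_ge0 n : 0 <= y n.
Proof. by elim: n => //= n IH; rewrite mulr_ge0// addr_ge0// sqr_ge0. Qed.

Lemma sqrt_bound_le1 n : y n <= 1.
Proof.
elim: n => [|n IH] /=; first exact: ler01.
have : y n ^+ 2 <= 1 by rewrite exprn_ile1// sqrt_bound_ge0.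
lra.
Qed.

Lemma sqrt_bound_nd n : y n <= y n.+1.
Proof. by have := sqr_ge0 (1 - y n); rewrite /=; nra. Qed.

Lemma sqrt_iter_linear n : linear (Y n).
Proof.
elim: n => [|n IH] a u v /=; first by rewrite scaler0 addr0.
rewrite lA (IH a u v) (IH a) [in RHS]scalerA (mulrC a) -scalerA -scalerDr.
congr (_ *: _); rewrite scalerDr addrACA.
by [].
Qed.

(** The iterates behave like polynomials in A: they commute with all that commutes
    with A, in particular with each other. *)
Lemma sqrt_iter_comm T n : linear T -> (forall u, T (A u) = A (T u)) ->
  forall u, T (Y n u) = Y n (T u).
Proof.
move=> lT TA; elim: n => [|n IH] u /=; first exact: linear_zero.
by rewrite (linear_scale lT) (linear_add lT) TA !IH.
Qed.

Lemma sqrt_iter_comm_iter n m u : Y m (Y n u) = Y n (Y m u).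
Proof.
apply: sqrt_iter_comm => [|v]; first exact: sqrt_iter_linear.
by apply/esym; apply: sqrt_iter_comm.
Qed.

Lemma rnorm_half u : nm (2^-1%:C%C *: u) = 2^-1 * nm u.
Proof. by rewrite rnormZ rnorm_real ger0_norm. Qed.

Lemma sqrt_iter_le n u : nm (Y n u) <= y n * nm u.
Proof.
elim: n u => [|n IH] u /=; first by rewrite rnorm0 mul0r.
rewrite rnorm_half -mulrA ler_pM2l//.
apply: le_trans (rnorm_triangle _ _) _; rewrite mulrDl mul1r.
apply: lerD; first exact: A1.
apply: le_trans (IH _) _; rewrite expr2 -mulrA.
by apply: ler_wpM2l; [exact: sqrt_bound_ge0|exact: IH].
Qed.

(** 2 (Y_{n+2} - Y_{n+1}) = (Y_{n+1} + Y_n) (Y_{n+1} - Y_n) since iterates commute,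
    and the scalar iteration satisfies the same identity. *)
Lemma sqrt_iter_step n u : nm (Y n.+1 u - Y n u) <= (y n.+1 - y n) * nm u.
Proof.
elim: n u => [|n IH] u.
  rewrite /= !subr0 expr0n/= !addr0 rnorm_half mulr1 ler_pM2l//.
have -> : Y n.+2 u - Y n.+1 u = 2^-1%:C%C *: (Y n.+1 (Y n.+1 u - Y n u) +
    Y n (Y n.+1 u - Y n u)).
  rewrite !(linear_sub (sqrt_iter_linear _)) (sqrt_iter_comm_iter n n.+1 u) addrA subrK.
  rewrite -[Y n.+2 u]/(2^-1%:C%C *: (A u + Y n.+1 (Y n.+1 u))).
  rewrite -[X in _ - X]/(2^-1%:C%C *: (A u + Y n (Y n u))) -scalerBr.
  by congr (_ *: _); rewrite opprD addrACA subrr add0r.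
rewrite rnorm_half.
have -> : y n.+2 - y n.+1 = 2^-1 * ((y n.+1 + y n) * (y n.+1 - y n)).
  by rewrite -[y n.+2]/(2^-1 * (1 + y n.+1 ^+ 2)) -[X in _ - X]/(2^-1 * (1 + y n ^+ 2)); ring.
rewrite -mulrA ler_pM2l// mulrDl mulrDl.
apply: le_trans (rnorm_triangle _ _) _; apply: lerD.
  apply: le_trans (sqrt_iter_le _ _) _; rewrite -mulrA.
  by apply: ler_wpM2l; [exact: sqrt_bound_ge0|exact: IH].
apply: le_trans (sqrt_iter_le _ _) _; rewrite -mulrA.
by apply: ler_wpM2l; [exact: sqrt_bound_ge0|exact: IH].
Qed.

Lemma sqrt_iter_cauchy n m u : (n <= m)%N -> nm (Y m u - Y n u) <= (y m - y n) * nm u.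
Proof.
move=> /subnK <-; elim: (m - n)%N => [|k IH]; first by rewrite add0n !subrr rnorm0 mul0r.
rewrite addSn -(subrKA (Y (k + n) u)).
apply: le_trans (rnorm_triangle _ _) _.
apply: le_trans (lerD (sqrt_iter_step _ _) IH) _.
by rewrite -mulrDl subrKA.
Qed.

Lemma sqrt_iter_self_adjoint n : self_adjoint (Y n).
Proof.
elim: n => [|n IH] u v /=.
  by rewrite -(scale0r 0) (psdZl (psd_dot dot)) (psdZr (psd_dot dot)) rmorph0 !mul0r.
rewrite (psdZl (psd_dot dot)) (psdZr (psd_dot dot)) (psdDl (psd_dot dot)).
by rewrite (psdDr (psd_dot dot)) sA !IH conjE conjc_real.
Qed.

Lemma sqrt_limit : exists Z : H -> H, [/\ linear Z, forall u, nm (Z u) <= nm u,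
  self_adjoint Z & forall u, 2%:R *: Z u = A u + Z (Z u)].
Proof.
pose c := limn y.
have ycvg : y @ \oo --> c.
  apply: nondecreasing_is_cvgn; first by apply/nondecreasing_seqP; exact: sqrt_bound_nd.
  by exists 1 => _ [n _ <-]; exact: sqrt_bound_le1.
have yc n : y n <= c.
  by apply: nondecreasing_cvgn_le => //; apply/nondecreasing_seqP; exact: sqrt_bound_nd.
have r0 u : (fun n => (c - y n) * nm u) @ \oo --> 0.
  rewrite -(mul0r (nm u)) -(subrr c); apply: cvgMr_tmp => //.
  by apply: cvgB => //; exact: cvg_cst.
have small (b d : R) (r : nat -> R) : r @ \oo --> 0 -> (forall n, b <= d * r n) -> b <= 0.
  move=> rc bd.
  have c0 : (fun n => d * r n) @ \oo --> d * 0 by apply: cvgMl_tmp.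
  by rewrite -(mulr0 d); apply: (cvgr_to_ge c0); exact: nearW.
have /choice[Z ZP] : forall u, exists l, forall n, nm (l - Y n u) <= (c - y n) * nm u.
  move=> u; apply: hilbert_complete (r0 u) => n m nm'.
  apply: le_trans (sqrt_iter_cauchy _ nm') _.
  by apply: ler_wpM2r; [exact: rnorm_ge0|rewrite lerD2r].
have eqZ u l (d : R) (rr : nat -> R) : rr @ \oo --> 0 -> (forall n, nm (u - l) <= d * rr n) -> u = l.
  move=> rc h; apply/eqP; rewrite -subr_eq0; apply/eqP/rnorm_eq0.
  by apply/eqP; rewrite eq_le rnorm_ge0 andbT; exact: small rc h.
have cy0 : (fun n => c - y n) @ \oo --> 0.
  by rewrite -(subrr c); apply: cvgB => //; exact: cvg_cst.
have cy n : 0 <= c - y n by rewrite subr_ge0.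
have lZ : linear Z.
  move=> a u v; pose d := nm (a *: u + v) + (rnorm a * nm u + nm v).
  apply: (eqZ _ _ d _ cy0) => n.
  have -> : Z (a *: u + v) - (a *: Z u + Z v) =
     (Z (a *: u + v) - Y n (a *: u + v)) - (a *: (Z u - Y n u) + (Z v - Y n v)).
    by rewrite (sqrt_iter_linear n a u v) scalerBr (addrACA (a *: Z u)) -opprD opprB subrKA.
  apply: le_trans (rnorm_triangle _ _) _; rewrite rnormN /d mulrDl.
  apply: lerD; first by rewrite mulrC; exact: ZP.
  apply: le_trans (rnorm_triangle _ _) _; rewrite rnormZ mulrDl.
  apply: lerD; last by rewrite mulrC; exact: ZP.
  by rewrite -mulrA; apply: ler_wpM2l; [exact: rnorm_ge0|rewrite mulrC; exact: ZP].
have Z1 u : nm (Z u) <= nm u.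
  rewrite -subr_le0; apply: small (nm u) _ cy0 _ => n; rewrite lerBlDr.
  rewrite -[Z u](subrK (Y n u)); apply: le_trans (rnorm_triangle _ _) _.
  apply: lerD; first by rewrite mulrC; exact: ZP.
  apply: le_trans (sqrt_iter_le _ _) _.
  by rewrite ler_piMl ?rnorm_ge0// sqrt_bound_le1.
exists Z; split => //.
- move=> u v; apply/eqP; rewrite -subr_eq0 -normr_eq0 rnormE eq_complex/= eqxx andbT.
  rewrite eq_le rnorm_ge0 andbT; apply: small (2 * nm u * nm v) _ cy0 _ => n.
  have -> : dot (Z u) v - dot u (Z v) = dot (Z u - Y n u) v - dot u (Z v - Y n v).
    by rewrite dotBl dotBr sqrt_iter_self_adjoint opprB subrKA.
  apply: le_trans (rnorm_triangle _ _) _; rewrite rnormN.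
  have -> : 2 * nm u * nm v * (c - y n) = ((c - y n) * nm u) * nm v + nm u * ((c - y n) * nm v).
    by ring.
  apply: lerD; apply: le_trans (dot_CauchySchwarz hn _ _) _.
    by apply: ler_wpM2r; [exact: rnorm_ge0|exact: ZP].
  by apply: ler_wpM2l; [exact: rnorm_ge0|exact: ZP].
- move=> u; apply: (eqZ _ _ (4 * nm u) _ cy0) => n.
  have YE : 2%:R *: Y n.+1 u = A u + Y n (Y n u).
    have two : (2%:R : R[i]) = (2%:R : R)%:C%C by rewrite rmorph_nat.
    by rewrite /= scalerA two -rmorphM/= divff ?rmorph1 ?scale1r// pnatr_eq0.
  have -> : 2%:R *: Z u - (A u + Z (Z u)) = 2%:R *: (Z u - Y n.+1 u) -
      (Z (Z u - Y n u) + (Z (Y n u) - Y n (Y n u))).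
    rewrite scalerBr YE (linear_sub lZ) subrKA.
    set a := 2%:R *: Z u; set b := A u; set p := Z (Z u); set q := Y n (Y n u).
    by rewrite opprB !opprD !addrA subrK.
  apply: le_trans (rnorm_triangle _ _) _; rewrite rnormN.
  have -> : 4 * nm u * (c - y n) = 2 * ((c - y n) * nm u) +
       ((c - y n) * nm u + (c - y n) * nm u) by ring.
  apply: lerD.
    rewrite rnormZ (_ : rnorm _ = 2); last by rewrite /rnorm normr_nat.
    rewrite ler_pM2l//; apply: le_trans (ZP _ _) _.
    by apply: ler_wpM2r; [exact: rnorm_ge0|rewrite lerD2l lerN2 sqrt_bound_nd].
  apply: le_trans (rnorm_triangle _ _) _; apply: lerD.
    by apply: le_trans (Z1 _) _; exact: ZP.
  apply: le_trans (ZP _ _) _; apply: ler_wpM2l => //.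
  apply: le_trans (sqrt_iter_le _ _) _.
  by rewrite ler_piMl ?rnorm_ge0// sqrt_bound_le1.
Qed.

End sqrt_iteration.

(** After division by a bound c, the operator A = 1 - T / c is a contraction
    by [positive_op_sqr_le], and sqrt(c) (1 - Z) is a root when Z is the limit of the
    iteration for A. *)
Lemma positive_sqrt_exists T : bounded_op T -> positive_op dot T ->
  exists S, [/\ bounded_op S, positive_op dot S & forall u, S (S u) = T u].
Proof.
move=> /bounded_opP[lT [K K0 TK]] pT.
pose c := K + 1.
have c0 : 0 < c by rewrite ltr_wpDl.
have Tc u : nm (T u) <= c * nm u.
  by apply: le_trans (TK u) _; apply: ler_wpM2r; [exact: rnorm_ge0|rewrite lerDl].
pose A u := u - c^-1%:C%C *: T u.
have lA : linear A.
  move=> a u v; rewrite /A lT scalerDr opprD addrACA scalerBr !scalerA (mulrC a).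
  by [].
have sT := positive_self_adjoint lT pT.
have sA : self_adjoint A.
  move=> u v; rewrite /A dotBl dotBr (psdZl (psd_dot dot)) (psdZr (psd_dot dot)) sT.
  by rewrite conjE conjc_real.
have A1 u : nm (A u) <= nm u.
  rewrite -ler_sqr ?nnegrE ?rnorm_ge0// -!(qf_dot hn) /A -scaleNr.
  rewrite (qfD (psd_dot dot)) (qfZ (psd_dot dot)) (psdZr (psd_dot dot)).
  rewrite cReM cRe_conj cIm_conj /= oppr0 expr0n/= addr0 oppr0 mul0r subr0 sqrrN.
  have h := positive_op_sqr_le lT pT Tc u.
  have -> : Re (dot u (T u)) = qf (op_form T) u by rewrite /qf /op_form -sT.
  rewrite (qf_dot hn (T u)) -[leRHS]addr0 -addrA lerD2l mulNr mulrN.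
  rewrite addrC subr_le0.
  have -> : 2 * (c^-1 * qf (op_form T) u) = c^-1 ^+ 2 * (2 * (c * qf (op_form T) u)).
    by field; rewrite gt_eqF.
  rewrite ler_pM2l ?exprn_gt0 ?invr_gt0//.
  have : 0 <= c * qf (op_form T) u by rewrite mulr_ge0 ?(ltW c0)// (qf_ge0 (psd_op lT pT)).
  by lra.
have [Z [lZ Z1 sZ ZE]] := sqrt_limit lA sA A1.
pose s := Num.sqrt c.
have s0 : 0 <= s by rewrite sqrtr_ge0.
pose S u := s%:C%C *: (u - Z u).
have lS : linear S.
  by move=> a u v; rewrite /S lZ opprD addrACA -scalerBr scalerDr !scalerA (mulrC a).
exists S; split.
- apply/bounded_opP; split=> //; exists (s * 2); first by rewrite mulr_ge0.
  move=> u; rewrite /S rnormZ rnorm_real ger0_norm// -mulrA; apply: ler_wpM2l => //.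
  apply: le_trans (rnorm_triangle _ _) _; rewrite rnormN mulr2n mulrDl !mul1r.
  by rewrite lerD2l.
- move=> u; rewrite /S (psdZl (psd_dot dot)) dotBl.
  have rZ : Im (dot (Z u) u) = 0.
    have := congr1 Im (dot_sym dot u (Z u)).
    by rewrite -sZ cIm_conj; lra.
  rewrite mulr_ge0 ?lecR//; rewrite ge0_ReE; apply/andP; split.
    by rewrite cImD (psd_diag (psd_dot dot) u) /=; case: (dot (Z u) u) rZ => a b /= ->; rewrite subr0.
  rewrite cReD cReN subr_ge0 -/(qf dot u) (qf_dot hn).
  apply: le_trans (ler_norm _) _; apply: le_trans (Re_dot_le hn _ _) _.
  by rewrite expr2; apply: ler_wpM2r; [exact: rnorm_ge0|exact: Z1].
- move=> u; rewrite /S (linear_scale lZ) -scalerBr scalerA -rmorphM/= -expr2 sqr_sqrtr ?(ltW c0)//.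
  rewrite (linear_sub lZ).
  have -> : u - Z u - (Z u - Z (Z u)) = u - A u.
    have -> : A u = Z u + Z u - Z (Z u) by rewrite -mulr2n -scaler_nat ZE addrK.
    by rewrite -[Z u + Z u - _]addrA [in RHS]opprD addrA.
  by rewrite /A subKr scalerA -rmorphM/= divff ?rmorph1 ?scale1r// gt_eqF.
Qed.

Lemma op_sqrtP T : bounded_op T -> positive_op dot T ->
  [/\ bounded_op (op_sqrt dot T), positive_op dot (op_sqrt dot T) &
      forall u, op_sqrt dot T (op_sqrt dot T u) = T u].
Proof.
move=> bT pT; rewrite /op_sqrt; case: xgetP => [S -> //|].
by have [S HS] := positive_sqrt_exists bT pT => /(_ S).
Qed.

Lemma rnorm_op_sqrt T u : bounded_op T -> positive_op dot T ->
  nm (op_sqrt dot T u) ^+ 2 = qf (op_form T) u.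
Proof.
move=> bT pT; have [[lS _] pS SS] := op_sqrtP bT pT.
by rewrite -(qf_dot hn) /qf /op_form -SS [in RHS](positive_self_adjoint lS pS).
Qed.

End square_roots.

(** * Integrals of complex functions *)

Section complex_integrals.
Context {R : realType} {d : nat}.
Local Notation E := (euclidean R d).
Local Notation C := R[i].
Local Notation Re := (@complex.Re R).
Local Notation Im := (@complex.Im R).
Variables (mu : {measure set E -> \bar R}).
Implicit Types (f g : E -> C) (A : set E).

Lemma integrable_lin A (f g : E -> R) (a b : R) : measurable A ->
  mu.-integrable A (fun x => (f x)%:E) -> mu.-integrable A (fun x => (g x)%:E) ->
  mu.-integrable A (fun x => (a * f x + b * g x)%:E).
Proof.
move=> mA fi gi.
apply: (eq_integrable mA ((fun x => a%:E * (f x)%:E) \+ (fun x => b%:E * (g x)%:E))%E) => //.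
by apply: integrableD => //; exact: integrableZl.
Qed.

Lemma Rintegral_lin A (f g : E -> R) (a b : R) : measurable A ->
  mu.-integrable A (fun x => (f x)%:E) -> mu.-integrable A (fun x => (g x)%:E) ->
  \int[mu]_(x in A) (a * f x + b * g x) = a * \int[mu]_(x in A) f x + b * \int[mu]_(x in A) g x.
Proof.
move=> mA fi gi; rewrite RintegralD//; last 2 first.
- apply: (eq_integrable mA (fun x => a%:E * (f x)%:E)%E) => //; exact: integrableZl.
- apply: (eq_integrable mA (fun x => b%:E * (g x)%:E)%E) => //; exact: integrableZl.
by rewrite !RintegralZl.
Qed.

Lemma cintegrableZD A f g (a : C) : measurable A ->
  cintegrable mu A f -> cintegrable mu A g -> cintegrable mu A (fun x => a * f x + g x).
Proof.
move=> mA [fr fi] [gr gi]; split.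
  apply: (eq_integrable mA (fun x => (1 * (Re a * Re (f x) + (- Im a) * Im (f x)) + 1 * Re (g x))%:E)).
    by move=> x _; rewrite !cReD cReM !mul1r mulNr.
  by apply: integrable_lin => //; exact: integrable_lin.
apply: (eq_integrable mA (fun x => (1 * (Re a * Im (f x) + Im a * Re (f x)) + 1 * Im (g x))%:E)).
  by move=> x _; rewrite !cImD cImM !mul1r.
by apply: integrable_lin => //; exact: integrable_lin.
Qed.

Lemma cintegralZD A f g (a : C) : measurable A ->
  cintegrable mu A f -> cintegrable mu A g ->
  cintegral mu A (fun x => a * f x + g x) = a * cintegral mu A f + cintegral mu A g.
Proof.
move=> mA [fr fi] [gr gi]; rewrite /cintegral; apply: complexP.
  rewrite cReD cReM /=.
  rewrite -[LHS]/(\int[mu]_(x in A) Re (a * f x + g x)).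
  under eq_Rintegral do rewrite cReD cReM -mulNr -[_ + Re (g _)]mul1r mulrDr mul1r.
  transitivity (\int[mu]_(x in A) (1 * (Re a * Re (f x) + (- Im a) * Im (f x)) + 1 * Re (g x))).
    by apply: eq_Rintegral => x _; rewrite !mul1r.
  rewrite Rintegral_lin//; last exact: integrable_lin.
  by rewrite Rintegral_lin// !mul1r mulNr.
rewrite cImD cImM /=.
transitivity (\int[mu]_(x in A) (1 * (Re a * Im (f x) + Im a * Re (f x)) + 1 * Im (g x))).
  by apply: eq_Rintegral => x _; rewrite cImD cImM !mul1r.
rewrite Rintegral_lin//; last exact: integrable_lin.
by rewrite Rintegral_lin// !mul1r.
Qed.

Lemma cintegrable0 A : cintegrable mu A (fun=> 0).
Proof. by split; exact: integrable0. Qed.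

Lemma cintegral0 A : cintegral mu A (fun=> 0) = 0.
Proof.
rewrite /cintegral; apply: complexP => /=; rewrite /Rintegral.
  by rewrite integral0.
by rewrite integral0.
Qed.

Lemma cintegrable_sum A (I : Type) (r : seq I) (f : I -> E -> C) (a : I -> C) :
  measurable A -> (forall i, cintegrable mu A (f i)) ->
  cintegrable mu A (fun x => \sum_(i <- r) a i * f i x).
Proof.
move=> mA fi; elim: r => [|i r IH].
  by under eq_fun do rewrite big_nil; exact: cintegrable0.
by under eq_fun do rewrite big_cons; exact: cintegrableZD.
Qed.

Lemma cintegral_sum A (I : Type) (r : seq I) (f : I -> E -> C) (a : I -> C) :
  measurable A -> (forall i, cintegrable mu A (f i)) ->
  cintegral mu A (fun x => \sum_(i <- r) a i * f i x) =
  \sum_(i <- r) a i * cintegral mu A (f i).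
Proof.
move=> mA fi; elim: r => [|i r IH].
  by under eq_fun do rewrite big_nil; rewrite big_nil cintegral0.
under eq_fun do rewrite big_cons; rewrite big_cons cintegralZD// ?IH//.
exact: cintegrable_sum.
Qed.

Lemma cintegralS A B f : measurable A -> measurable B -> A `<=` B ->
  cintegrable mu B f -> cintegrable mu A f.
Proof. by move=> mA mB AB [fr fi]; split; exact: integrableS fr || exact: integrableS fi. Qed.

(** Measurability on compact sets is enough because the space is a countable union
    of closed cubes centered at the origin. *)
Lemma cmeasurable_loc f : loc_cintegrable mu f -> cmeasurable f.
Proof.
move=> lf.
pose K (n : nat) : set E := closed_cube (0 : 'rV[R]_d) (2 * n%:R).
have KT : \bigcup_n K n = [set: E].
  apply/seteqP; split => // x _.
  pose M := \sum_i `|(x : 'rV[R]_d) ord0 i|.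
  exists (Num.bound M) => // i.
  rewrite mxE sub0r add0r in_itv /=.
  rewrite -ler_norml [2 * _ / 2](_ : _ = (Num.bound M)%:R); last by field.
  have M0 : 0 <= M by apply: sumr_ge0.
  apply: (@le_trans _ _ M).
    by rewrite /M (bigD1 i)//= lerDl sumr_ge0.
  by rewrite ltW// archi_boundP.
have cK n : compact (K n : set 'rV[R]_d) by exact: compact_closed_cube.
have mK n : measurable (K n) by exact: compact_meas.
split; rewrite -KT; apply/measurable_fun_bigcup => // n.
  by apply/measurable_EFinP; case: (lf _ (cK n)) => /measurable_int.
by apply/measurable_EFinP; case: (lf _ (cK n)) => _ /measurable_int.
Qed.

End complex_integrals.

(** * Averages of operator weights *)

Section operator_weight_averages.
Context {R : realType} {d : nat} {H : completeNormedModType R[i]}.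
Local Notation E := (euclidean R d).
Local Notation C := R[i].
Local Notation Re := (@complex.Re R).
Local Notation Im := (@complex.Im R).
Variable dot : {dot H for Num.conj}.
Hypothesis hn : hilbert_norm dot.
Variables (mu : {measure set E -> \bar R}) (D : set (set E)).
Hypotheses (lf : locally_finite mu) (gD : dyadic_grid D).
Variable U : E -> H -> H.
Hypotheses (lU : forall x, linear (U x)) (pU : {ae mu, forall x, positive_op dot (U x)}).
Hypothesis iU : op_weakly_loc_integrable dot mu D U.

Lemma weight_coef_grid Q u v : D Q -> cintegrable mu Q (fun x => dot (U x u) v).
Proof.
move=> DQ; have [K cK QK] := grid_compact gD DQ.
case: iU => /(_ u v _ cK) + _; apply: cintegralS => //.
  exact: grid_meas DQ.
exact: compact_meas.
Qed.

Lemma weight_coef_meas u v : cmeasurable (fun x => dot (U x u) v).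
Proof. by case: iU => /(_ u v) /cmeasurable_loc. Qed.

(** The averages of the coefficients form a bounded sesquilinear form, which is
    represented by an operator. *)
Lemma op_avgP Q : D Q -> bounded_op (op_avg dot mu U Q) /\
  forall u v, dot (op_avg dot mu U Q u) v = cavg mu Q (fun x => dot (U x u) v).
Proof.
move=> DQ; have mQ := grid_meas gD DQ.
rewrite /op_avg; case: xgetP => [A -> //|none]; exfalso.
have [K HK] := (iU.2 Q DQ).
have [A [bA AE]] : exists A, bounded_op A /\
    forall u v, dot (A u) v = cavg mu Q (fun x => dot (U x u) v).
  apply: (represent_form hn (K := (fine (mu Q))^-1 * K)).
  - move=> c u v w; rewrite /cavg mulrCA -mulrDr; congr (_ * _).
    rewrite -cintegralZD//; try exact: weight_coef_grid.
    congr cintegral; apply/funext => x.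
    by rewrite lU (psdDl (psd_dot dot)) (psdZl (psd_dot dot)).
  - move=> c u v w; rewrite /cavg mulrCA -mulrDr; congr (_ * _).
    rewrite -cintegralZD//; try exact: weight_coef_grid.
    congr cintegral; apply/funext => x.
    by rewrite (psdDr (psd_dot dot)) (psdZr (psd_dot dot)).
  - move=> u v; rewrite /cavg rnormM rnorm_real ger0_norm ?invr_ge0 ?fine_ge0//.
    rewrite -mulrA; apply: ler_wpM2l; first by rewrite invr_ge0 fine_ge0.
    by have := HK u v; rewrite !rnormE -!rmorphM/= lecR.
exact: (none A).
Qed.

Lemma quad_ae_ge0 e : {ae mu, forall x, 0 <= quad_weight dot U e x}.
Proof.
apply: filterS pU => x pUx.
by have := pUx e; rewrite ge0_ReE => /andP[].
Qed.

Lemma quad_grid_int Q e : D Q -> mu.-integrable Q (EFin \o quad_weight dot U e).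
Proof. by move=> DQ; case: (weight_coef_grid e e DQ). Qed.

Lemma quad_meas e : measurable_fun [set: E] (quad_weight dot U e).
Proof. by case: (weight_coef_meas e e). Qed.

(** |U(x)^(1/2) e| wherever U(x) is positive; as a square root of a scalar it is
    defined, nonnegative and measurable also on the exceptional null set. *)
Definition wnorm e x : R := Num.sqrt (quad_weight dot U e x).

Lemma wnorm_ge0 e x : 0 <= wnorm e x.
Proof. exact: sqrtr_ge0. Qed.

Lemma wnorm_meas e : measurable_fun [set: E] (wnorm e).
Proof.
apply: measurableT_comp (quad_meas e).
exact: continuous_measurable_fun (@sqrt_continuous R).
Qed.

Lemma int_wnorm Q e : D Q ->
  (\int[mu]_(x in Q) (wnorm e x ^+ 2)%:E = \int[mu]_(x in Q) (quad_weight dot U e x)%:E)%E.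
Proof.
move=> DQ; have mQ := grid_meas gD DQ; apply: ae_eq_integral => //.
- apply/measurable_EFinP; apply: measurable_funX.
  exact: measurable_funTS (wnorm_meas e).
- by apply/measurable_EFinP; exact: measurable_funTS (quad_meas e).
- by apply: filterS (quad_ae_ge0 e) => x q0 _; rewrite /wnorm sqr_sqrtr.
Qed.

Lemma int_quad_ge0 Q e : D Q -> 0 <= \int[mu]_(x in Q) quad_weight dot U e x.
Proof.
move=> DQ; rewrite /Rintegral -int_wnorm//; apply: fine_ge0.
by apply: integral_ge0 => x _; rewrite lee_fin sqr_ge0.
Qed.

Lemma int_quadE Q e : D Q -> (\int[mu]_(x in Q) (quad_weight dot U e x)%:E =
   (\int[mu]_(x in Q) quad_weight dot U e x)%:E)%E.
Proof.
move=> DQ; rewrite /Rintegral fineK//; apply: integrable_fin_num.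
  exact: grid_meas DQ.
exact: quad_grid_int.
Qed.

Lemma op_avg_positive Q : D Q -> positive_op dot (op_avg dot mu U Q).
Proof.
move=> DQ u; have [_ ->] := op_avgP DQ; have mQ := grid_meas gD DQ.
rewrite /cavg mulr_ge0//.
  by rewrite lecR invr_ge0 fine_ge0.
rewrite ge0_ReE; apply/andP; split; last exact: int_quad_ge0.
rewrite /cintegral/=; apply/eqP.
transitivity (\int[mu]_(x in Q) (0 : R)).
  congr fine; apply: ae_eq_integral => //.
    by apply/measurable_EFinP; apply: measurable_funTS; case: (weight_coef_meas u u).
  by apply: filterS pU => x /(_ u); rewrite ge0_ReE => /andP[/eqP ->].
by rewrite /Rintegral integral0.
Qed.

(** When mu Q = 0 the average uses 0^-1 = 0, and both sides vanish. *)
Lemma int_wnormE Q e : D Q -> (\int[mu]_(x in Q) (wnorm e x ^+ 2)%:E =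
   (fine (mu Q) * qf (op_form dot (op_avg dot mu U Q)) e)%:E)%E.
Proof.
move=> DQ; have mQ := grid_meas gD DQ; rewrite int_wnorm//.
have [_ AE] := op_avgP DQ.
rewrite /qf /op_form AE /cavg cReM /= mul0r subr0.
have [m0|m0] := eqVneq (fine (mu Q)) 0.
  rewrite m0 mul0r; apply: null_set_integral => //.
    by apply/measurable_EFinP; exact: measurable_funTS (quad_meas e).
  by rewrite -(fineK (grid_fin_num lf gD DQ)) m0.
by rewrite mulrA divff// mul1r -int_quadE.
Qed.

Lemma wnorm_carleson S (Q : nat -> set E) (a : R) e n j :
  sparse mu D S -> nested_sequence Q -> (forall k, S (Q k) \/ Q k = set0) ->
  (op_Ainfty_const dot mu D U <= a%:E)%E ->
  carleson mu Q n (2 * a) (fun x => wnorm e x ^+ 2) (Q j).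
Proof.
move=> sS nQ QS Ua; have SD : S `<=` D by case: sS.
have [->|e0] := eqVneq e 0.
  rewrite /carleson.
  have z A : (\int[mu]_(x in A) (wnorm 0 x ^+ 2)%:E = 0)%E.
    apply: integral0_eq => x _; rewrite /wnorm /quad_weight (linear_zero (lU x)).
    by rewrite (_ : dot 0 0 = 0) ?sqrtr0 ?expr0n// -(scale0r 0) (psdZl (psd_dot dot)) mul0r.
  by rewrite z mule0 big1.
have := @sparse_carleson R d mu D S lf gD sS Q nQ QS (quad_weight dot U e) a
  (fun A => @quad_grid_int A e) (fun A => @int_quad_ge0 A e) _ n j.
have qa : (Ainfty_const mu D (quad_weight dot U e) <= a%:E)%E.
  by apply: le_trans Ua; apply: ereal_sup_ubound; exists e.
move=> /(_ qa); rewrite /carleson.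
have w0 k : (\int[mu]_(x in Q k) (wnorm e x ^+ 2)%:E =
    \int[mu]_(x in Q k) (quad_weight dot U e x)%:E)%E.
  case: (QS k) => [/SD|->]; first exact: int_wnorm.
  by rewrite !integral_set0.
by rewrite w0; under [in X in _ -> X]eq_bigr do rewrite w0.
Qed.

Lemma quad_charge Q e : D Q -> (0 < mu Q)%E ->
  {ae mu, forall x, 0 < quad_weight dot U e x} -> 0 < \int[mu]_(x in Q) quad_weight dot U e x.
Proof.
move=> DQ mQ0 q0; have mQ := grid_meas gD DQ.
rewrite lt_def int_quad_ge0// andbT; apply/eqP => I0.
have mq : measurable_fun Q (fun x => (quad_weight dot U e x)%:E).
  by apply/measurable_EFinP; exact: measurable_funTS (quad_meas e).
have /(ae_eq_integral_abs mu mQ mq) z : (\int[mu]_(x in Q) `|(quad_weight dot U e x)%:E| = 0)%E.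
  rewrite -[RHS]/(0%:E) -I0 -int_quadE//; apply: ae_eq_integral => //.
    exact: measurableT_comp.
  by apply: filterS q0 => x qx _; rewrite gee0_abs// lee_fin ltW.
have : {ae mu, forall x, ~ Q x}.
  by apply: filterS2 z q0 => x zx qx Qx; have := zx Qx => -[] x0; rewrite x0 ltxx in qx.
case=> N [mN N0 QN]; move: mQ0; rewrite lt_def => /andP[/eqP + _]; apply.
apply/eqP; rewrite eq_le measure_ge0 andbT -N0; apply: le_measure; rewrite ?inE//.
by move=> x Qx; apply: QN => /=; apply.
Qed.

(** On Q the maximal function of 1_Q w is at least the average of w over Q. *)
Lemma op_Ainfty_ge1 Q e : D Q -> (0 < mu Q)%E -> e != 0 ->
  {ae mu, forall x, 0 < quad_weight dot U e x} -> (1 <= op_Ainfty_const dot mu D U)%E.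
Proof.
move=> DQ mQ0 e0 q0; have mQ := grid_meas gD DQ.
apply: (@le_trans _ _ (Ainfty_const mu D (quad_weight dot U e))); last first.
  by apply: ereal_sup_ubound; exists e.
have I0 := quad_charge DQ mQ0 q0.
apply: (@le_trans _ _ ((\int[mu]_(x in Q) dyadic_maximal mu D (\1_Q \* quad_weight dot U e)%R x)
    / (\int[mu]_(x in Q) (quad_weight dot U e x)%:E))%E); last first.
  by apply: ereal_sup_ubound; exists Q.
rewrite int_quadE// inver gt_eqF// lee_pdivlMr// mul1e -int_quadE//.
rewrite (int_ravg lf gD (fun A => @quad_grid_int A e))//.
rewrite -integral_cst//; apply: ge0_le_integral_on.
  by move=> x _; rewrite lee_fin; exact: (ravg_ge0 (fun A => @int_quad_ge0 A e)).
move=> x Qx; apply: ereal_sup_ubound; exists Q => //.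
by rewrite ravg_local// indicE mem_set// mul1r.
Qed.

End operator_weight_averages.

(** * Inverse weights and the A_2 condition *)

Section inverse_operators.
Context {R : realType} {H : completeNormedModType R[i]}.
Variable dot : {dot H for Num.conj}.
Hypothesis hn : hilbert_norm dot.
Local Notation Re := (@complex.Re R).
Local Notation nm := (@rnorm R H).
Implicit Types (u v w : H) (T S : H -> H).

Lemma op_inv_linear T : linear (op_inv T).
Proof.
rewrite /op_inv; case: xgetP => [S -> [[lS _] _ _] //|_] a u v.
by rewrite scaler0 addr0.
Qed.

Lemma op_invP T : invertible_op T -> is_inverse T (op_inv T).
Proof. by move=> [S TS]; rewrite /op_inv; case: xgetP => [S' -> //|/(_ S)]. Qed.

Section positive_invertible.
Variable T : H -> H.
Hypotheses (bT : bounded_op T) (pT : positive_op dot T) (iT : invertible_op T).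

Let lT : linear T. Proof. by case: bT. Qed.
Let sT : self_adjoint dot T. Proof. exact: positive_self_adjoint. Qed.
Let TK u : T (op_inv T u) = u. Proof. by case: (op_invP iT) => _ _ ->. Qed.

Lemma op_form_inv u v : op_form dot (op_inv T) u v = op_form dot T (op_inv T u) (op_inv T v).
Proof. by rewrite /op_form sT TK. Qed.

Lemma op_inv_positive : positive_op dot (op_inv T).
Proof. by move=> u; rewrite -/(op_form dot _ u u) op_form_inv; exact: pT. Qed.

(** With b = T y, the inner product (u|b) is the value of the form of T at
    u and y, and the form of T at y is the form of T^-1 at b. *)
Lemma dual_CauchySchwarz u b : rnorm (dot u b) <=
  Num.sqrt (qf (op_form dot T) u) * Num.sqrt (qf (op_form dot (op_inv T)) b).
Proof.
rewrite /qf op_form_inv -!/(qf _ _) -{1}(TK b) -sT.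
exact: (psd_CauchySchwarz (psd_op lT pT)).
Qed.

(** With u = T y, |u|^2 is bounded by a multiple of (T y|y) = (T^-1 u|u). *)
Lemma op_inv_qf_gt0 u : u != 0 -> 0 < qf (op_form dot (op_inv T)) u.
Proof.
move=> u0; rewrite /qf op_form_inv -/(qf _ _).
have [_ [K K0 TK']] := (bounded_opP T).1 bT.
have := positive_op_sqr_le hn lT pT TK' (op_inv T u); rewrite TK => h.
have nu : 0 < nm u ^+ 2.
  rewrite exprn_gt0// lt_def rnorm_ge0 andbT; apply: contra u0 => /eqP /rnorm_eq0 ->.
  exact: eqxx.
rewrite lt_def (qf_ge0 (psd_op lT pT)) andbT; apply/eqP => q0.
by move: h; rewrite q0 mulr0 leNgt nu.
Qed.

End positive_invertible.

Lemma op_norm_le T (a : R) : linear T -> (op_norm T ^+ 2 <= a%:E)%E ->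
  forall u, nm (T u) <= Num.sqrt a * nm u.
Proof.
move=> lT Ta u.
have ub v : `|v| <= 1 -> ((nm (T v))%:E <= op_norm T)%E.
  by move=> v1; apply: ereal_sup_ubound; exists v.
have N0 : (0 <= op_norm T)%E.
  by have := ub 0; rewrite normr0 (linear_zero lT) rnorm0; apply; exact: ler01.
have [n n0 [nE na]] : exists2 n, 0 <= n & op_norm T = n%:E /\ n <= Num.sqrt a.
  move: Ta N0; case: (op_norm T) => [n| |]//.
    rewrite expe2 -EFinM !lee_fin -expr2 => na n0; exists n => //; split => //.
    by rewrite -[n]ger0_norm// -sqrtr_sqr; apply: ler_wsqrtr.
apply: le_trans (_ : n * nm u <= _); last by apply: ler_wpM2r => //; exact: rnorm_ge0.
have [u0|u0] := eqVneq (nm u) 0.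
  by rewrite (rnorm_eq0 u0) (linear_zero lT) rnorm0 mulr0.
have up : 0 < nm u by rewrite lt_def u0 rnorm_ge0.
have := ub ((nm u)^-1%:C%C *: u); rewrite nE lee_fin (linear_scale lT) !rnormE rnormZ.
rewrite rnormZ rnorm_real ger0_norm ?invr_ge0 ?rnorm_ge0// mulVf//.
by move=> /(_ (lexx _)); rewrite ler_pdivrMl// mulrC.
Qed.

(** The operator SB SA is the adjoint of SA SB: with z = SB (SA p),
    |z|^2 = (p|SA (SB z)). *)
Lemma sqrt_comp_adjoint_le (SA SB : H -> H) (k : R) :
  linear SA -> linear SB -> self_adjoint dot SA -> self_adjoint dot SB ->
  (forall u, nm (SA (SB u)) <= k * nm u) -> forall p, nm (SB (SA p)) <= k * nm p.
Proof.
move=> lA lB sA sB hk p; set z := SB (SA p).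
have [z0|z0] := eqVneq (nm z) 0.
  rewrite z0; have := hk p; have [->|p0] := eqVneq (nm p) 0; first by rewrite mulr0.
  exact: le_trans (rnorm_ge0 _).
have zp : 0 < nm z by rewrite lt_def z0 rnorm_ge0.
rewrite -(ler_pM2r zp) -expr2 -(qf_dot hn) /qf {1}/z sB sA.
apply: le_trans (ler_norm _) _; apply: le_trans (Re_dot_le hn _ _) _.
rewrite mulrAC [leRHS]mulrC; apply: ler_wpM2l; [exact: rnorm_ge0|exact: hk].
Qed.

End inverse_operators.

Section A2.
Context {R : realType} {d : nat} {H : completeNormedModType R[i]}.
Local Notation E := (euclidean R d).
Local Notation Re := (@complex.Re R).
Variable dot : {dot H for Num.conj}.
Hypothesis hn : hilbert_norm dot.
Variables (mu : {measure set E -> \bar R}) (D : set (set E)).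
Hypotheses (lf : locally_finite mu) (gD : dyadic_grid D).
Variable W : E -> H -> H.
Hypothesis oW : operator_weight dot mu D W.
Local Notation V := (inv_weight W).

Lemma weight_linear x : linear (W x).
Proof. by case: oW => /(_ x)[]. Qed.

Lemma weight_pos : {ae mu, forall x, positive_op dot (W x)}.
Proof. by case: oW => _ + _ _ _; apply: filterS => x []. Qed.

Lemma weight_int : op_weakly_loc_integrable dot mu D W.
Proof. by case: oW. Qed.

Lemma inv_weight_linear x : linear (V x).
Proof. exact: op_inv_linear. Qed.

Lemma inv_weight_pos : {ae mu, forall x, positive_op dot (V x)}.
Proof.
case: oW => bW + _ _ _; apply: filterS => x [pW iW].
exact: op_inv_positive.
Qed.

Lemma inv_weight_int : op_weakly_loc_integrable dot mu D V.
Proof. by case: oW. Qed.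

Lemma weight_quad_gt0 e : e != 0 -> {ae mu, forall x, 0 < quad_weight dot W e x}.
Proof. by move=> e0; case: oW => _ _ /(_ e e0)[]. Qed.

Lemma inv_weight_quad_gt0 e : e != 0 -> {ae mu, forall x, 0 < quad_weight dot V e x}.
Proof.
move=> e0; case: oW => bW + _ _ _; apply: filterS => x [pW iW].
exact: op_inv_qf_gt0.
Qed.

Lemma weight_duality : {ae mu, forall x, forall u b,
  rnorm (dot u b) <= wnorm dot W u x * wnorm dot V b x}.
Proof.
case: oW => bW + _ _ _; apply: filterS => x [pW iW] u b.
exact: dual_CauchySchwarz.
Qed.

Lemma weight_sqrt : {ae mu, forall x, forall u,
  rnorm (op_sqrt dot (W x) u) ^+ 2 = quad_weight dot W u x}.
Proof.
case: oW => bW + _ _ _; apply: filterS => x [pW iW] u.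
exact: rnorm_op_sqrt.
Qed.

(** With A and B the averages of W and W^-1, the left side is
    |B^(1/2) A^(1/2) p|^2 at p = A^(1/2) c, and the norm of
    B^(1/2) A^(1/2) is that of its adjoint. *)
Lemma A2_testing Q (a : R) c : D Q -> (A2_const dot mu D W <= a%:E)%E ->
  qf (op_form dot (op_avg dot mu V Q)) (op_avg dot mu W Q c) <=
  a * qf (op_form dot (op_avg dot mu W Q)) c.
Proof.
move=> DQ Aa.
have [bA _] := op_avgP hn gD weight_linear weight_int DQ.
have [bB _] := op_avgP hn gD inv_weight_linear inv_weight_int DQ.
have pA := op_avg_positive hn gD weight_linear weight_pos weight_int DQ.
have pB := op_avg_positive hn gD inv_weight_linear inv_weight_pos inv_weight_int DQ.
set A := op_avg dot mu W Q in bA pA *; set B := op_avg dot mu V Q in bB pB *.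
have [[lSA _] pSA SSA] := op_sqrtP hn bA pA.
have [[lSB _] pSB SSB] := op_sqrtP hn bB pB.
have lSAB : linear (op_sqrt dot A \o op_sqrt dot B).
  by move=> k u v /=; rewrite lSB lSA.
have ha : (op_norm (op_sqrt dot A \o op_sqrt dot B) ^+ 2 <= a%:E)%E.
  by apply: le_trans Aa; apply: ereal_sup_ubound; exists Q.
have a0 : 0 <= a.
  rewrite -lee_fin; apply: le_trans ha.
  rewrite expe2; case: (op_norm _) => [r| |]; last 2 first.
  - by rewrite mulyy leey.
  - by rewrite mulNyNy leey.
  - by rewrite -EFinM lee_fin -expr2 sqr_ge0.
have hk := op_norm_le lSAB ha.
have := sqrt_comp_adjoint_le hn lSA lSB (positive_self_adjoint lSA pSA)
  (positive_self_adjoint lSB pSB) hk (op_sqrt dot A c).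
rewrite SSA -(rnorm_op_sqrt hn c bA pA) -(rnorm_op_sqrt hn _ bB pB) => h.
rewrite -[a]sqr_sqrtr// -exprMn ler_sqr ?nnegrE ?rnorm_ge0//.
by rewrite mulr_ge0 ?sqrtr_ge0 ?rnorm_ge0.
Qed.

(** Otherwise [A2_testing] forces the average of W to annihilate e. *)
Lemma A2_gt0 Q (e : H) : D Q -> (0 < mu Q)%E -> e != 0 -> (0 < A2_const dot mu D W)%E.
Proof.
move=> DQ mQ0 e0; rewrite ltNge; apply/negP => A0.
have := A2_testing e DQ A0; rewrite mul0r => q0.
set A := op_avg dot mu W Q in q0.
have f0 : 0 < fine (mu Q).
  by rewrite fine_gt0// mQ0/=; exact: grid_fin_meas lf gD _ DQ.
have Ae : A e = 0.
  apply/eqP; apply: contraLR q0 => Ae; rewrite -ltNge.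
  have := quad_charge gD inv_weight_pos inv_weight_int DQ mQ0 (inv_weight_quad_gt0 Ae).
  rewrite -lte_fin -(int_quadE gD inv_weight_int _ DQ).
  rewrite -(int_wnorm gD inv_weight_pos inv_weight_int _ DQ).
  rewrite (int_wnormE hn lf gD inv_weight_linear inv_weight_pos inv_weight_int)//.
  by rewrite lte_fin pmulr_rgt0.
have := quad_charge gD weight_pos weight_int DQ mQ0 (weight_quad_gt0 e0).
rewrite -lte_fin -(int_quadE gD weight_int _ DQ).
rewrite -(int_wnorm gD weight_pos weight_int _ DQ).
rewrite (int_wnormE hn lf gD weight_linear weight_pos weight_int)//.
rewrite lte_fin pmulr_rgt0// /qf /op_form -/A Ae.
by rewrite linear0l ltxx.
Qed.

End A2.

(** * Convergence of scalar Lerner series *)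

Section enumerated_sums.
Context {R : realType}.

Lemma nneseries_partial_cvg (P : pred nat) (p : nat -> R) (M : R) :
  (forall k, 0 <= p k) -> (forall n, \sum_(k < n | P k) p k <= M) ->
  (\sum_(k <oo | P k) (p k)%:E)%E \is a fin_num /\
  (fun n => \sum_(k < n | P k) p k) @ \oo --> fine (\sum_(k <oo | P k) (p k)%:E)%E.
Proof.
move=> p0 pM.
pose s n := \sum_(k < n | P k) p k.
have sE n : (\sum_(0 <= k < n | P k) (p k)%:E)%E = (s n)%:E.
  by rewrite sumEFin big_mkord.
have snd : {homo s : n m / (n <= m)%N >-> n <= m}.
  apply/nondecreasing_seqP => n; rewrite /s [leRHS]big_mkcond big_ord_recr/=.
  by rewrite -big_mkcond/= lerDl; case: ifP.
have scvg : cvgn s.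
  by apply: nondecreasing_is_cvgn => //; exists M => _ [n _ <-]; exact: pM.
have -> : (\sum_(k <oo | P k) (p k)%:E)%E = (limn s)%:E.
  rewrite -EFin_lim//; apply: congr_lim; apply/funext => n; exact: sE.
by split.
Qed.

(** For absolutely summable families the sum over S, defined without an order,
    is the limit of the partial sums of any enumeration of S. *)
Lemma rsum_enum_cvg (T : choiceType) (S : set T) (Q : nat -> T) (P : pred nat)
    (a : T -> R) (M : R) :
  set_inj [set` P] Q -> Q @` [set` P] = S ->
  (forall n, \sum_(k < n | P k) `|a (Q k)| <= M) ->
  (fun n => \sum_(k < n | P k) a (Q k)) @ \oo --> rsum S a.
Proof.
move=> Qi QS aM; rewrite /rsum -QS.
have pE A : ((EFin \o a)^\+ A = (Num.max (a A) 0)%:E)%E by rewrite funeposE EFin_max.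
have mE A : ((EFin \o a)^\- A = (Num.max (- a A) 0)%:E)%E by rewrite funenegE EFin_max EFinN.
rewrite (esum_pred_image (EFin \o a)^\+%E Q P)//.
rewrite (esum_pred_image (EFin \o a)^\-%E Q P)//.
under eq_eseriesr do rewrite pE.
under [X in (_ - X)%E]eq_eseriesr do rewrite mE.
have b1 n : \sum_(k < n | P k) Num.max (a (Q k)) 0 <= M.
  apply: le_trans (aM n); apply: ler_sum => k _.
  by rewrite ge_max ler_norm normr_ge0.
have b2 n : \sum_(k < n | P k) Num.max (- a (Q k)) 0 <= M.
  apply: le_trans (aM n); apply: ler_sum => k _.
  by rewrite ge_max -normrN ler_norm normr_ge0.
have n1 k : 0 <= Num.max (a (Q k)) 0 by rewrite le_max lexx orbT.
have n2 k : 0 <= Num.max (- a (Q k)) 0 by rewrite le_max lexx orbT.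
have [fp cp] := nneseries_partial_cvg n1 b1.
have [fm cm] := nneseries_partial_cvg n2 b2.
rewrite fineB//.
have -> : (fun n => \sum_(k < n | P k) a (Q k)) =
  (fun n => \sum_(k < n | P k) Num.max (a (Q k)) 0) \-
  (fun n => \sum_(k < n | P k) Num.max (- a (Q k)) 0).
  apply/funext => n /=; rewrite -sumrB; apply: eq_bigr => k _.
  have [a0|a0] := leP 0 (a (Q k)).
    by rewrite (max_idPr _) ?subr0// oppr_le0.
  by rewrite (max_idPl _) ?sub0r ?opprK// oppr_ge0 ltW.
exact: cvgB.
Qed.

Lemma measurable_rsum d (E : measurableType d) (T : choiceType) (S : set T)
    (Q : nat -> T) (P : pred nat) (a : T -> E -> R) :
  set_inj [set` P] Q -> Q @` [set` P] = S ->
  (forall k, P k -> measurable_fun [set: E] (a (Q k))) ->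
  measurable_fun [set: E] (fun x => rsum S (fun A => a A x)).
Proof.
move=> Qi QS ma; rewrite /rsum -QS.
apply: (measurableT_comp (fine_measurable measurableT)).
have pE (f : T -> R) A : ((EFin \o f)^\+ A = (Num.max (f A) 0)%:E)%E.
  by rewrite funeposE EFin_max.
have mE (f : T -> R) A : ((EFin \o f)^\- A = (Num.max (- f A) 0)%:E)%E.
  by rewrite funenegE EFin_max EFinN.
apply: emeasurable_funB.
  rewrite (_ : (fun x => _) = fun x => (\sum_(k <oo | k \in P) (Num.max (a (Q k) x) 0)%:E)%E).
    apply: ge0_emeasurable_sum => [k x _ _|k Pk]; first by rewrite lee_fin le_max lexx orbT.
    by apply/measurable_EFinP; apply: measurable_maxr => //; exact: ma.
  apply/funext => x; rewrite (esum_pred_image (EFin \o a^~ x)^\+%E Q P)//.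
  by apply: eq_eseriesr => k _; rewrite pE.
rewrite (_ : (fun x => _) = fun x => (\sum_(k <oo | k \in P) (Num.max (- a (Q k) x) 0)%:E)%E).
  apply: ge0_emeasurable_sum => [k x _ _|k Pk]; first by rewrite lee_fin le_max lexx orbT.
  apply/measurable_EFinP; apply: measurable_maxr => //.
  by apply: measurableT_comp => //; exact: ma.
apply/funext => x; rewrite (esum_pred_image (EFin \o a^~ x)^\-%E Q P)//.
by apply: eq_eseriesr => k _; rewrite mE.
Qed.

End enumerated_sums.

Section bounded_functions.
Context {R : realType} {d : nat}.
Local Notation E := (euclidean R d).
Local Notation C := R[i].
Local Notation Re := (@complex.Re R).
Local Notation Im := (@complex.Im R).
Variables (mu : {measure set E -> \bar R}).
Implicit Types (f g : E -> C) (A : set E).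

(** The norm is set to 0 when mu vanishes; then every property holds almost
    everywhere. *)
Lemma Linfty_norm_ae f (M : R) : (Linfty_norm mu f <= M%:E)%E ->
  {ae mu, forall x, rnorm (f x) <= M}.
Proof.
rewrite /Linfty_norm unlock; case: ifPn => [m0 /ess_supP|m0 _].
  by apply: filterS => x /=; rewrite lee_fin ger0_norm// rnorm_ge0.
exists setT; split => //.
by apply/eqP; rewrite eq_le measure_ge0 andbT leNgt.
Qed.

Lemma rnorm_measurable f : cmeasurable f -> measurable_fun [set: E] (fun x => rnorm (f x)).
Proof.
move=> [mr mi]; under eq_fun do rewrite /rnorm norm_ReE.
apply: measurableT_comp; first exact: continuous_measurable_fun (@sqrt_continuous R).
by apply: measurable_funD; exact: measurable_funX.
Qed.

Lemma rnorm_le_sum (z : C) : rnorm z <= `|Re z| + `|Im z|.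
Proof.
rewrite /rnorm norm_ReE -[leRHS]ger0_norm ?addr_ge0// -sqrtr_sqr.
apply: ler_wsqrtr; rewrite sqrrD !real_normK ?num_real//.
by rewrite lerD2r lerDl mulrn_wge0// mulr_ge0.
Qed.

Lemma cmeasurableM f g : cmeasurable f -> cmeasurable g -> cmeasurable (fun x => f x * g x).
Proof.
move=> [fr fi] [gr gi]; split.
  under eq_fun do rewrite cReM.
  by apply: measurable_funB; exact: measurable_funM.
under eq_fun do rewrite cImM.
by apply: measurable_funD; exact: measurable_funM.
Qed.

Lemma cintegrable_dominated A f (h : E -> R) : measurable A -> cmeasurable f ->
  measurable_fun [set: E] h -> {ae mu, forall x, rnorm (f x) <= h x} ->
  (\int[mu]_(x in A) `|h x|%:E < +oo)%E -> cintegrable mu A f.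
Proof.
move=> mA [mr mi] mh fh hA.
have dom (k : E -> R) : measurable_fun [set: E] k -> {ae mu, forall x, `|k x| <= h x} ->
    mu.-integrable A (fun x => (k x)%:E).
  move=> mk kh; apply/integrableP; split.
    by apply/measurable_EFinP; exact: measurable_funTS.
  apply: le_lt_trans hA; rewrite integral_mkcond [leRHS]integral_mkcond.
  apply: ge0_le_integral_ae.
  - by move=> x; rewrite patchE; case: ifP.
  - by move=> x; rewrite patchE; case: ifP.
  - apply: filterS kh => x kx; rewrite !patchE; case: ifP => // _.
    by rewrite /= lee_fin; apply: le_trans kx _; exact: ler_norm.
split; apply: dom => //; apply: filterS fh => x; apply: le_trans.
  exact: Re_norm_le.
exact: Im_norm_le.
Qed.

Hypothesis lf : locally_finite mu.

Lemma L0infty_bounds f : L0infty mu f -> exists (M : R) (K : set E),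
  [/\ 0 <= M, measurable K, (mu K < +oo)%E, {ae mu, forall x, rnorm (f x) <= M} &
      forall x, ~ K x -> f x = 0].
Proof.
move=> [_ fM [K cK fK]].
have M0 : (0 <= Linfty_norm mu f)%E by exact: Lnorm_ge0.
have fin : Linfty_norm mu f \is a fin_num by rewrite ge0_fin_numE.
exists (fine (Linfty_norm mu f)), K; split.
- exact: fine_ge0.
- exact: compact_meas.
- exact: compact_fin_meas.
- by apply: Linfty_norm_ae; rewrite fineK.
- exact: fK.
Qed.

Lemma L0infty_square f : L0infty mu f -> exists N : R, 0 <= N /\
  (\int[mu]_x (rnorm (f x) ^+ 2)%:E <= N%:E)%E.
Proof.
move=> Lf; have [M [K [M0 mK Kfin fM fK]]] := L0infty_bounds Lf.
exists (M ^+ 2 * fine (mu K)); split; first by rewrite mulr_ge0 ?sqr_ge0// fine_ge0.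
apply: (@le_trans _ _ (\int[mu]_x (\1_K x * M ^+ 2)%:E)%E).
  apply: ge0_le_integral_ae.
  - by move=> x; rewrite lee_fin sqr_ge0.
  - by move=> x; rewrite lee_fin mulr_ge0// sqr_ge0.
  - apply: filterS fM => x fx; rewrite lee_fin indicE.
    case: (boolP (x \in K)) => [_|/negP xK].
      by rewrite mul1r ler_sqr ?nnegrE// rnorm_ge0.
    by rewrite fK ?mul0r; [rewrite /rnorm normr0 expr0n|move=> Kx; apply: xK; exact: mem_set].
under eq_integral do rewrite mulrC.
rewrite (nnintZ mu (measurable_indic mK) _ (sqr_ge0 M))//.
by rewrite integral_indic// setIT (EFinM (M ^+ 2)) fineK// ge0_fin_numE.
Qed.

Lemma L0infty_int A f : measurable A -> (mu A < +oo)%E -> L0infty mu f ->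
  mu.-integrable A (fun x => (rnorm (f x))%:E).
Proof.
move=> mA Afin Lf; have [M [K [M0 mK Kfin fM fK]]] := L0infty_bounds Lf.
have [mf _ _] := Lf.
apply/integrableP; split.
  by apply/measurable_EFinP; apply: measurable_funTS; exact: rnorm_measurable.
apply: (@le_lt_trans _ _ (\int[mu]_(x in A) M%:E)%E); last first.
  by rewrite integral_cst// lte_mul_pinfty.
rewrite integral_mkcond [leRHS]integral_mkcond; apply: ge0_le_integral_ae.
- by move=> x; rewrite patchE; case: ifP.
- by move=> x; rewrite patchE; case: ifP.
- apply: filterS fM => x fx; rewrite !patchE; case: ifP => // _.
  by rewrite /= lee_fin ger0_norm// rnorm_ge0.
Qed.

Lemma L0infty_cintegrableM A f (p : E -> C) : measurable A -> (mu A < +oo)%E -> L0infty mu f ->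
  cmeasurable p -> (Linfty_norm mu p <= 1)%E ->
  cintegrable mu A (fun x => p x * f x).
Proof.
move=> mA Afin Lf mp p1; have [mf _ _] := Lf.
apply: (cintegrable_dominated (h := fun x => rnorm (f x))) => //.
- exact: cmeasurableM.
- exact: rnorm_measurable.
- apply: filterS (Linfty_norm_ae p1) => x px; rewrite rnormM.
  by rewrite ler_piMl// rnorm_ge0.
- have /integrableP[_] := L0infty_int mA Afin Lf.
  by under eq_integral do rewrite abse_EFin.
Qed.

Lemma rnorm_cavg_le A f (p : E -> C) : measurable A -> (mu A < +oo)%E -> L0infty mu f ->
  cmeasurable p -> (Linfty_norm mu p <= 1)%E ->
  rnorm (cavg mu A (fun x => p x * f x)) <= 2 * ravg mu A (fun x => rnorm (f x)).
Proof.
move=> mA Afin Lf mp p1; have [mf _ _] := Lf.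
have [ir ii] := L0infty_cintegrableM mA Afin Lf mp p1.
have iff := L0infty_int mA Afin Lf.
have key (k : C -> R) : (forall z, `|k z| <= rnorm z) ->
    mu.-integrable A (fun x => (k (p x * f x))%:E) ->
    `|\int[mu]_(x in A) k (p x * f x)| <= \int[mu]_(x in A) rnorm (f x).
  move=> kn ik; apply: le_trans (le_normr_Rintegral mA ik) _.
  rewrite /Rintegral fine_le//.
  - exact: (integrable_fin_num mA (integrable_norm ik)).
  - exact: integrable_fin_num.
  - rewrite integral_mkcond [leRHS]integral_mkcond; apply: ge0_le_integral_ae.
    + by move=> x; rewrite patchE; case: ifP.
    + by move=> x; rewrite patchE; case: ifP => // _; rewrite lee_fin rnorm_ge0.
    + apply: filterS (Linfty_norm_ae p1) => x px; rewrite !patchE; case: ifP => // _.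
      rewrite lee_fin; apply: le_trans (kn _) _; rewrite rnormM.
      by rewrite ler_piMl// rnorm_ge0.
rewrite /cavg rnormM rnorm_real ger0_norm ?invr_ge0 ?fine_ge0// /ravg mulrCA.
apply: ler_wpM2l; first by rewrite invr_ge0 fine_ge0.
apply: le_trans (rnorm_le_sum _) _; rewrite mulr2n mulrDl mul1r.
by apply: lerD; apply: key => // z; [exact: Re_norm_le|exact: Im_norm_le].
Qed.

End bounded_functions.

Section scalar_lerner.
Context {R : realType} {d : nat}.
Local Notation E := (euclidean R d).
Local Notation C := R[i].
Local Notation Re := (@complex.Re R).
Local Notation Im := (@complex.Im R).
Variables (mu : {measure set E -> \bar R}) (D S : set (set E)).
Hypotheses (lf : locally_finite mu) (gD : dyadic_grid D) (sS : sparse mu D S).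
Variable Q : nat -> set E.
Hypotheses (nQ : nested_sequence Q) (QS : forall k, S (Q k) \/ Q k = set0).
Hypotheses (SQ : forall A, S A -> exists k, Q k = A).
Variables psi phi : set E -> E -> C.
Hypotheses (apsi : admissible mu S psi) (aphi : admissible mu S phi).

Let SD : S `<=` D. Proof. by case: sS. Qed.
Let mQ k : measurable (Q k). Proof. exact: nested_meas nQ k. Qed.

Definition selected : pred nat := fun k => `[< S (Q k) >].

Lemma selected_inj : set_inj [set` selected] Q.
Proof.
move=> j k /set_mem Sj _ jk; apply: (nested_inj nQ) => //.
have {}Sj : S (Q j) by exact/asboolP.
exact: (grid_nonempty gD (SD Sj)).
Qed.

Lemma selected_image : Q @` [set` selected] = S.
Proof.
apply/seteqP; split => [_ [k /asboolP Sk <-]//|A SA].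
by have [k kA] := SQ SA; exists k => //; apply/asboolP; rewrite kA.
Qed.

Lemma enum_fin k : (mu (Q k) < +oo)%E.
Proof.
case: (QS k) => [/SD Dk|->]; first exact: grid_fin_meas lf gD _ Dk.
by rewrite measure0.
Qed.

Lemma enum_fin_num k : mu (Q k) \is a fin_num.
Proof. by rewrite ge0_fin_numE// enum_fin. Qed.

Definition lerner_coef (g : E -> C) k : C := cavg mu (Q k) (fun y => phi (Q k) y * g y).

Definition lerner_partial (g : E -> C) n (x : E) : C :=
  \sum_(k < n | selected k) psi (Q k) x * lerner_coef g k.

(** The bound by 1 is only an almost everywhere bound for each cube; the
    exceptional sets of countably many cubes are united. *)
Lemma psi_ae : {ae mu, forall x, forall k, selected k -> rnorm (psi (Q k) x) <= \1_(Q k) x}.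
Proof.
have : forall k, {ae mu, forall x, selected k -> rnorm (psi (Q k) x) <= \1_(Q k) x}.
  move=> k; have [/asboolP Sk|] := boolP (selected k); last by move=> _; exact: aeW.
  have [_ psi0 psi1] := apsi Sk.
  apply: filterS (Linfty_norm_ae psi1) => x px _; rewrite indicE.
  case: (boolP (x \in Q k)) => [//|/negP xk].
  by rewrite psi0 ?/rnorm ?normr0// => Qx; apply: xk; exact: mem_set.
by move/ae_foralln.
Qed.

Lemma ravg_nonneg A (w : E -> R) : (forall x, 0 <= w x) -> 0 <= ravg mu A w.
Proof.
by move=> w0; apply: mulr_ge0; [rewrite invr_ge0 fine_ge0|exact: Rintegral_ge0].
Qed.

Lemma Ainfty_cst (c : R) : 0 <= c -> (Ainfty_const mu D (cst c) <= 1%:E)%E.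
Proof.
move=> c0; apply: ge_ereal_sup => _ [A DA <-].
have mA := grid_meas gD DA; have fA := grid_fin_num lf gD DA.
have iE : (\int[mu]_(x in A) (cst c x)%:E = c%:E * mu A)%E.
  by rewrite -[LHS]/(\int[mu]_(x in A) cst c%:E x)%E integral_cst.
rewrite iE.
set X := (\int[mu]_(x in A) _)%E.
have M0 x : A x -> (0 <= dyadic_maximal mu D (\1_A \* cst c)%R x)%E.
  move=> Ax; apply: (@le_trans _ _ (\1_A x * ravg mu A (\1_A \* cst c))%:E).
    by rewrite lee_fin mulr_ge0//; apply: ravg_nonneg => y; rewrite mulr_ge0.
  by apply: ereal_sup_ubound; exists A.
have avg_le B : D B -> ravg mu B (\1_A \* cst c) <= c.
  move=> DB; have mB := grid_meas gD DB; have fB := grid_fin_num lf gD DB.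
  have iB : (\int[mu]_(x in B) ((\1_A \* cst c)%R x)%:E <= c%:E * mu B)%E.
    rewrite -integral_cst//; apply: ge0_le_integral_on => y _.
      by rewrite lee_fin mulr_ge0.
    by rewrite lee_fin /= ler_piMl// indicE; case: (_ \in _).
  rewrite /ravg; have [m0|m0] := eqVneq (fine (mu B)) 0.
    by rewrite m0 invr0 mul0r.
  have mp : 0 < fine (mu B) by rewrite lt_def m0 fine_ge0.
  rewrite ler_pdivrMl// mulrC.
  have -> : c * fine (mu B) = fine (c%:E * mu B) by rewrite fineM.
  rewrite /Rintegral fine_le ?fin_numM// ge0_fin_numE; last first.
    by apply: integral_ge0 => y _; rewrite lee_fin mulr_ge0.
  by apply: le_lt_trans iB _; rewrite lte_mul_pinfty// -ge0_fin_numE.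
have Xle : (X <= c%:E * mu A)%E.
  rewrite -integral_cst//; apply: ge0_le_integral_on => // x Ax.
  apply: ge_ereal_sup => _ [B DB <-]; rewrite lee_fin indicE.
  by case: (x \in B); rewrite ?mul1r ?avg_le// mul0r.
have X0 : (0 <= X)%E by exact: integral_ge0.
have yr : (c%:E * mu A = (c * fine (mu A))%:E)%E by rewrite EFinM fineK.
move: Xle; rewrite yr => Xle.
have [y0|y0] := eqVneq (c * fine (mu A)) 0.
  have -> : X = 0%E by apply/eqP; rewrite eq_le X0 andbT; rewrite y0 in Xle.
  by rewrite mul0e lee_fin.
rewrite inver (negbTE y0) lee_pdivrMr ?mul1e//.
by rewrite lt_def y0 mulr_ge0// fine_ge0.
Qed.

(** For a constant weight the maximal function of 1_A c is at most c, so the A_infty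
    constant is at most 1. *)
Lemma cst_carleson (c : R) n j : carleson mu Q n 2 (cst (c ^+ 2)) (Q j).
Proof.
have := @sparse_carleson R d mu D S lf gD sS Q nQ QS (cst (c ^+ 2)) 1 _ _
  (Ainfty_cst (sqr_ge0 c)) n j.
rewrite mulr1; apply.
- move=> A DA; apply: measurable_bounded_integrable => //.
  + exact: grid_meas DA.
  + exact: grid_fin_meas lf gD _ DA.
  + by exists (c ^+ 2); split; rewrite ?num_real// => M cM x _ /=; rewrite ger0_norm ?sqr_ge0// ltW.
- by move=> A DA; apply: Rintegral_ge0 => x _; exact: sqr_ge0.
Qed.

Definition abs_avg (g : E -> C) k : R := ravg mu (Q k) (fun x => rnorm (g x)).

Lemma abs_avg_ge0 g k : 0 <= abs_avg g k.
Proof.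
by apply: ravg_nonneg => x; exact: rnorm_ge0.
Qed.

(** [sparse_duality] with h = |g| and the constant functions s k = t k equal to
    the average a of |g| over Q k: here x k = mu (Q k) a^2 is equal to the integral
    of h a over Q k unless mu (Q k) = 0. *)
Lemma scalar_majorant g : L0infty mu g -> exists L : E -> \bar R,
  [/\ measurable_fun [set: E] L,
      forall n x, (((\sum_(k < n) \1_(Q k) x * abs_avg g k) ^+ 2)%R%:E <= L x)%E &
      (\int[mu]_x L x < +oo)%E].
Proof.
move=> Lg; have [N [N0 gN]] := L0infty_square lf Lg.
have mg : measurable_fun [set: E] (fun x => rnorm (g x)).
  by apply: rnorm_measurable; case: Lg.
pose x k := fine (mu (Q k)) * abs_avg g k ^+ 2.
have intc k (c : R) : (\int[mu]_(z in Q k) c%:E = (fine (mu (Q k)) * c)%:E)%E.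
  by rewrite -[LHS]/(\int[mu]_(z in Q k) cst c%:E z)%E integral_cst// mulrC EFinM fineK// enum_fin_num.
have mc k : measurable_fun [set: E] (cst (abs_avg g k)) by exact: measurable_cst.
have c0 k (z : E) : 0 <= cst (abs_avg g k) z by exact: abs_avg_ge0.
have tx k : (\int[mu]_(z in Q k) (cst (abs_avg g k) z ^+ 2)%:E = (x k)%:E)%E
  by exact: (intc k (abs_avg g k ^+ 2)).
have sx k : (\int[mu]_(z in Q k) (cst (abs_avg g k) z ^+ 2)%:E <= (1 * x k)%:E)%E.
  by rewrite tx mul1r.
have xh k : ((x k)%:E <= \int[mu]_(z in Q k) (rnorm (g z) * cst (abs_avg g k) z)%:E)%E.
  have ig : mu.-integrable (Q k) (fun z => (rnorm (g z))%:E).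
    by apply: L0infty_int => //; exact: enum_fin.
  have -> : (\int[mu]_(z in Q k) (rnorm (g z) * cst (abs_avg g k) z)%:E =
      (\int[mu]_(z in Q k) rnorm (g z) * abs_avg g k)%R%:E)%E.
    rewrite -(RintegralZr _ (mQ k) ig) /Rintegral fineK//.
    apply: integrable_fin_num => //.
    apply: (eq_integrable (mQ k) (fun z => (abs_avg g k)%:E * (rnorm (g z))%:E)%E).
      by move=> z _; rewrite muleC.
    exact: integrableZl.
  rewrite lee_fin /x; have [m0|m0] := eqVneq (fine (mu (Q k))) 0.
    by rewrite m0 mul0r mulr_ge0 ?abs_avg_ge0//; apply: Rintegral_ge0 => z _; exact: rnorm_ge0.
  have aE : fine (mu (Q k)) * abs_avg g k = \int[mu]_(z in Q k) rnorm (g z).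
    by rewrite /abs_avg /ravg mulrA divff// mul1r.
  by rewrite expr2 mulrA aE.
have [L [mL HL IL]] := sparse_duality nQ (ltr0Sn R 1) (ltr0Sn R 1) ltr01
  mg (fun z => rnorm_ge0 (g z)) mc c0 mc c0 gN tx sx xh
  (fun n j k _ => cst_carleson (abs_avg g k) n j) (fun n j k _ => cst_carleson (abs_avg g k) n j).
by exists L; split => //; apply: le_lt_trans IL _; rewrite ltry.
Qed.

Lemma lerner_coef_le g k : L0infty mu g -> selected k ->
  rnorm (lerner_coef g k) <= 2 * abs_avg g k.
Proof.
move=> Lg /asboolP Sk; have [mp _ p1] := aphi Sk.
exact: (rnorm_cavg_le lf (mQ k) (enum_fin k) Lg mp p1).
Qed.

Lemma sum_lerner_terms_le g n x : L0infty mu g ->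
  (forall k, selected k -> rnorm (psi (Q k) x) <= \1_(Q k) x) ->
  \sum_(k < n | selected k) rnorm (psi (Q k) x * lerner_coef g k) <=
  2 * \sum_(k < n) \1_(Q k) x * abs_avg g k.
Proof.
move=> Lg px; rewrite mulr_sumr big_mkcond; apply: ler_sum => k _.
have A0 : 0 <= 2 * (\1_(Q k) x * abs_avg g k) by rewrite mulr_ge0// mulr_ge0// abs_avg_ge0.
case: ifPn => // sk; rewrite rnormM mulrCA.
by apply: ler_pM; rewrite ?rnorm_ge0//; [exact: px|exact: lerner_coef_le].
Qed.

(** Where the majorant of [scalar_majorant] is finite, the series converges
    absolutely; real and imaginary parts of the terms are bounded by
    2 <|g|>_Q, and the last bound uses sqrt y <= 1 + y to obtain an integrable
    majorant. *)
Lemma lerner_cvg_bound g : L0infty mu g -> exists L : E -> \bar R,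
  [/\ measurable_fun [set: E] L, forall x, (0 <= L x)%E, (\int[mu]_x L x < +oo)%E &
    {ae mu, forall x,
      [/\ (fun n => Re (lerner_partial g n x)) @ \oo --> Re (lerner mu S psi phi g x),
          (fun n => Im (lerner_partial g n x)) @ \oo --> Im (lerner mu S psi phi g x) &
          rnorm (lerner mu S psi phi g x) <= 4 * (1 + fine (L x))]}].
Proof.
move=> Lg; have [L [mL HL IL]] := scalar_majorant Lg.
have L0 x : (0 <= L x)%E.
  by apply: le_trans (HL 0%N x); rewrite lee_fin sqr_ge0.
exists L; split => //.
have Lfin : {ae mu, forall x, L x \is a fin_num}.
  have iL : mu.-integrable setT L.
    apply/integrableP; split => //.
    by under eq_integral do rewrite gee0_abs//.
  by apply: filterS (integrable_ae measurableT iL) => x; apply.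
apply: filterS2 psi_ae Lfin => x px Lx.
pose M := 2 * Num.sqrt (fine (L x)).
have tM n : \sum_(k < n | selected k) rnorm (psi (Q k) x * lerner_coef g k) <= M.
  apply: le_trans (sum_lerner_terms_le n Lg px) _; rewrite ler_pM2l//.
  have s0 : 0 <= \sum_(k < n) \1_(Q k) x * abs_avg g k.
    by apply: sumr_ge0 => k _; rewrite mulr_ge0// abs_avg_ge0.
  rewrite -[leLHS]ger0_norm// -sqrtr_sqr; apply: ler_wsqrtr.
  by rewrite -lee_fin fineK//; exact: HL.
have conv (p : C -> R) : (forall z, `|p z| <= rnorm z) ->
   (forall (n : nat) (F : 'I_n -> C) (P : pred 'I_n),
      p (\sum_(k < n | P k) F k) = \sum_(k < n | P k) p (F k)) ->
   (fun n => p (lerner_partial g n x)) @ \oo -->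
      rsum S (fun A => p (psi A x * cavg mu A (fun y => phi A y * g y))).
  move=> pn psum.
  rewrite (_ : (fun n => _) = fun n => \sum_(k < n | selected k)
      p (psi (Q k) x * lerner_coef g k)); last first.
    by apply/funext => n; rewrite /lerner_partial psum.
  apply: (@rsum_enum_cvg R _ S Q selected
    (fun A => p (psi A x * cavg mu A (fun y => phi A y * g y))) M
    selected_inj selected_image) => n.
  by apply: le_trans (tM n); apply: ler_sum => k _; exact: pn.
have cr := conv Re (fun z => Re_norm_le z) (fun n F P => cRe_sum _ P F).
have ci := conv Im (fun z => Im_norm_le z) (fun n F P => cIm_sum _ P F).
split => //.
have pb (p : C -> R) l : (forall z, `|p z| <= rnorm z) ->
    (fun n => p (lerner_partial g n x)) @ \oo --> l -> `|l| <= M.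
  move=> pn cl; have ca : (fun n => `|p (lerner_partial g n x)|) @ \oo --> `|l| by exact: cvg_norm.
  apply: (cvgr_to_le ca); apply: nearW => n; apply: le_trans (pn _) _.
  apply: le_trans (tM n); rewrite /lerner_partial.
  elim/big_ind2 : _ => [|a b a' b' ab ab'|//]; first by rewrite /rnorm normr0.
  by apply: le_trans (rnorm_triangle _ _) _; exact: lerD.
apply: le_trans (rnorm_le_sum _) _.
have := pb _ _ (fun z => Re_norm_le z) cr; have := pb _ _ (fun z => Im_norm_le z) ci.
have : Num.sqrt (fine (L x)) <= 1 + fine (L x).
  have f0 : 0 <= fine (L x) by exact: fine_ge0.
  rewrite -[leRHS]ger0_norm ?addr_ge0// -sqrtr_sqr; apply: ler_wsqrtr.
  by nra.
by rewrite /M /lerner /csum /=; lra.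
Qed.

Lemma lerner_cmeasurable g : L0infty mu g -> cmeasurable (lerner mu S psi phi g).
Proof.
move=> Lg.
have m k : selected k -> cmeasurable (fun x => psi (Q k) x * lerner_coef g k).
  move=> /asboolP Sk; have [mp _ _] := apsi Sk.
  by apply: cmeasurableM => //; split; exact: measurable_cst.
split; apply: (measurable_rsum selected_inj selected_image) => k sk.
  by case: (m k sk).
by case: (m k sk).
Qed.

Lemma lerner_loc g : L0infty mu g -> loc_cintegrable mu (lerner mu S psi phi g).
Proof.
move=> Lg K cK; have [L [mL L0 IL HL]] := lerner_cvg_bound Lg.
have mK := compact_meas cK; have Kfin := compact_fin_meas lf cK.
apply: (cintegrable_dominated (h := fun x => 4 * (1 + fine (L x)))) => //.
- exact: lerner_cmeasurable.
- apply: measurable_funM => //; apply: measurable_funD => //.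
  exact: measurableT_comp (fine_measurable measurableT) mL.
- by apply: filterS HL => x [].
apply: (@le_lt_trans _ _ (\int[mu]_(x in K) (4%:E + 4%:E * L x))%E).
  apply: ge0_le_integral_on => // x _.
  rewrite ger0_norm; last by rewrite mulr_ge0// addr_ge0// fine_ge0.
  rewrite mulrDr mulr1 EFinD leeD2l// EFinM; apply: lee_wpmul2l => //.
  by case: (L x) (L0 x) => [r| |] //=; rewrite ?leey.
rewrite ge0_integralD//; last 2 first.
- by move=> x _; rewrite mule_ge0.
- by apply: measurable_funeM; exact: measurable_funTS.
rewrite integral_cst// ge0_integralZl//; last exact: measurable_funTS.
apply: lte_add_pinfty; first by rewrite lte_mul_pinfty.
apply: lte_mul_pinfty => //; apply: le_lt_trans IL; exact: ge0_subset_integral.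
Qed.

End scalar_lerner.

(** * The vector-valued estimate *)

Section vector_lerner.
Context {R : realType} {d : nat} {H : completeNormedModType R[i]}.
Local Notation E := (euclidean R d).
Local Notation C := R[i].
Local Notation Re := (@complex.Re R).
Local Notation Im := (@complex.Im R).
Variable dot : {dot H for Num.conj}.
Hypothesis hn : hilbert_norm dot.
Variables (mu : {measure set E -> \bar R}) (D S : set (set E)).
Hypotheses (lf : locally_finite mu) (gD : dyadic_grid D) (sS : sparse mu D S).
Variable W : E -> H -> H.
Hypothesis oW : operator_weight dot mu D W.
Local Notation V := (inv_weight W).
Variable Q : nat -> set E.
Hypotheses (nQ : nested_sequence Q) (QS : forall k, S (Q k) \/ Q k = set0).
Hypotheses (SQ : forall A, S A -> exists k, Q k = A).
Variables psi phi : set E -> E -> C.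
Hypotheses (apsi : admissible mu S psi) (aphi : admissible mu S phi).
Variables (m : nat) (g : 'I_m -> E -> C) (e : 'I_m -> H).
Hypothesis Lg : forall i, L0infty mu (g i).

Let SD : S `<=` D. Proof. by case: sS. Qed.
Let mQ k : measurable (Q k). Proof. exact: nested_meas nQ k. Qed.

(** The quadratic form of W at sum_i z_i e_i as a polynomial in the real and
    imaginary parts of the z_i; this form shows measurability and continuity. *)
Definition quad_poly (zr zi : 'I_m -> R) x : R :=
  \sum_i \sum_j ((zr i * zr j + zi i * zi j) * Re (dot (W x (e i)) (e j)) -
                 (zi i * zr j - zr i * zi j) * Im (dot (W x (e i)) (e j))).

Lemma dot_sumr (I : Type) (r : seq I) (P : pred I) (u : H) (z : I -> C) (v : I -> H) :
  dot u (\sum_(i <- r | P i) z i *: v i) = \sum_(i <- r | P i) Num.conj (z i) * dot u (v i).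
Proof.
rewrite (big_morph (dot u) (psdDr (psd_dot dot) u) (id1 := 0)) ?linear0r//.
by apply: eq_bigr => i _; rewrite (psdZr (psd_dot dot)).
Qed.

Lemma dot_suml (I : Type) (r : seq I) (P : pred I) (u : H) (z : I -> C) (v : I -> H) :
  dot (\sum_(i <- r | P i) z i *: v i) u = \sum_(i <- r | P i) z i * dot (v i) u.
Proof.
rewrite (big_morph (fun w => dot w u) (fun a b => psdDl (psd_dot dot) a b u) (id1 := 0)) ?linear0l//.
by apply: eq_bigr => i _; rewrite (psdZl (psd_dot dot)).
Qed.

Lemma linear_sum_op (T : H -> H) (I : Type) (r : seq I) (P : pred I) (z : I -> C) (v : I -> H) :
  linear T -> T (\sum_(i <- r | P i) z i *: v i) = \sum_(i <- r | P i) z i *: T (v i).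
Proof.
move=> lT; rewrite (big_morph T (linear_add lT) (linear_zero lT)).
by apply: eq_bigr => i _; rewrite (linear_scale lT).
Qed.

Lemma quad_weight_sum (z : 'I_m -> C) x :
  quad_weight dot W (\sum_i z i *: e i) x = quad_poly (Re \o z) (Im \o z) x.
Proof.
rewrite /quad_weight (linear_sum_op _ _ _ _ (weight_linear oW x)) dot_suml cRe_sum.
apply: eq_bigr => i _; rewrite dot_sumr mulr_sumr cRe_sum; apply: eq_bigr => j _ /=.
rewrite !cReM !cImM cRe_conj cIm_conj; ring.
Qed.

Lemma quad_poly_meas (zr zi : 'I_m -> E -> R) :
  (forall i, measurable_fun [set: E] (zr i)) -> (forall i, measurable_fun [set: E] (zi i)) ->
  measurable_fun [set: E] (fun x => quad_poly (zr^~ x) (zi^~ x) x).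
Proof.
move=> mr mi; apply: measurable_bigsum => i; apply: measurable_bigsum => j.
have [cr ci] := weight_coef_meas (weight_int oW) (e i) (e j).
apply: measurable_funB; apply: measurable_funM => //.
  by apply: measurable_funD; exact: measurable_funM.
by apply: measurable_funB; exact: measurable_funM.
Qed.

Lemma quad_poly_cvg (zr zi : nat -> 'I_m -> R) (lr li : 'I_m -> R) x :
  (forall i, zr^~ i @ \oo --> lr i) -> (forall i, zi^~ i @ \oo --> li i) ->
  (fun n => quad_poly (zr n) (zi n) x) @ \oo --> quad_poly lr li x.
Proof.
move=> cr ci; apply: cvg_big => [|i _]; first exact: add_continuous.
apply: cvg_big => [|j _]; first exact: add_continuous.
apply: cvgB; apply: cvgMr_tmp.
  by apply: cvgD; exact: cvgM.
by apply: cvgB; exact: cvgM.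
Qed.

Definition vec_fun : E -> H := tensor_op idfun g e.
Definition vec_coef k : H := \sum_i lerner_coef mu Q phi (g i) k *: e i.
Definition vec_norm x : R := wnorm dot W (vec_fun x) x.

Lemma vec_norm_meas : measurable_fun [set: E] vec_norm.
Proof.
apply: measurableT_comp; first exact: continuous_measurable_fun (@sqrt_continuous R).
under eq_fun do rewrite quad_weight_sum.
apply: quad_poly_meas => i; have [[mr mi] _ _] := Lg i => //.
Qed.

(** With b = A c, where A is the average of W over the cube and c the average of
    phi f, mu (Q k) (A c|c) is the real part of mu (Q k) (c|b), which is
    the integral of phi (f|b). *)
Lemma vec_testing k : D (Q k) -> S (Q k) ->
  ((fine (mu (Q k)) * qf (op_form dot (op_avg dot mu W (Q k))) (vec_coef k))%:E <=
   \int[mu]_(x in Q k) (vec_norm x *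
       wnorm dot V (op_avg dot mu W (Q k) (vec_coef k)) x)%:E)%E.
Proof.
move=> Dk Sk; set b := op_avg dot mu W (Q k) (vec_coef k).
have [mphi _ phi1] := aphi Sk.
have Qfin := enum_fin lf gD sS QS k.
have cphi i : cintegrable mu (Q k) (fun y => phi (Q k) y * g i y).
  exact: L0infty_cintegrableM.
pose F y : C := \sum_i dot (e i) b * (phi (Q k) y * g i y).
have cF : cintegrable mu (Q k) F by exact: cintegrable_sum.
have FE y : F y = phi (Q k) y * dot (vec_fun y) b.
  rewrite /F /vec_fun /tensor_op dot_suml mulr_sumr; apply: eq_bigr => i _ /=; ring.
have rhs0 : (0 <= \int[mu]_(x in Q k) (vec_norm x * wnorm dot V b x)%:E)%E.
  by apply: integral_ge0 => x _; rewrite lee_fin mulr_ge0// wnorm_ge0.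
have [m0|m0] := eqVneq (fine (mu (Q k))) 0; first by rewrite m0 mul0r.
have -> : fine (mu (Q k)) * qf (op_form dot (op_avg dot mu W (Q k))) (vec_coef k) =
    \int[mu]_(x in Q k) Re (F x).
  transitivity (Re (cintegral mu (Q k) F)); last by [].
  rewrite cintegral_sum// /qf /op_form -/b dot_sym cRe_conj dot_suml !cRe_sum mulr_sumr.
  apply: eq_bigr => i _; rewrite /lerner_coef /cavg -mulrA cReM /= mul0r subr0.
  by rewrite mulrA divff// mul1r mulrC.
have -> : ((\int[mu]_(x in Q k) Re (F x))%:E = \int[mu]_(x in Q k) (Re (F x))%:E)%E.
  by rewrite /Rintegral fineK//; apply: integrable_fin_num => //; case: cF.
have mF : measurable_fun (Q k) (fun x => (Re (F x))%:E) by case: cF => /measurable_int.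
apply: le_trans (lee_abs _) _; apply: le_trans (le_abse_integral mu (mQ k) mF) _.
rewrite integral_mkcond [leRHS]integral_mkcond; apply: ge0_le_integral_ae.
- by move=> x; rewrite patchE; case: ifP.
- by move=> x; rewrite patchE; case: ifP => // _; rewrite lee_fin mulr_ge0// wnorm_ge0.
- apply: filterS2 (Linfty_norm_ae phi1) (weight_duality oW) => x px dx.
  rewrite !patchE; case: ifP => // _; rewrite /= lee_fin.
  apply: le_trans (Re_norm_le _) _; rewrite -/(rnorm _) FE rnormM.
  apply: le_trans (dx (vec_fun x) b).
  by rewrite ler_piMl// rnorm_ge0.
Qed.

Section vector_majorant.
Variables (al be ga : R).
Hypotheses (al0 : 0 < al) (be0 : 0 < be) (ga0 : 0 < ga).
Hypothesis A2al : (A2_const dot mu D W <= al%:E)%E.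
Hypothesis Wbe : (op_Ainfty_const dot mu D W <= be%:E)%E.
Hypothesis Vga : (op_Ainfty_const dot mu D V <= ga%:E)%E.
Hypothesis f1 : (\int[mu]_x (vec_norm x ^+ 2)%:E <= 1)%E.

(** [sparse_duality] with h = |W^(1/2) f|, t k = |W^(1/2) c| and
    s k = |W^(-1/2) A c|; 144 = 36 * 2 * 2 collects the factors 2 of
    the two Carleson constants. *)
Lemma vec_majorant : exists L : E -> \bar R,
  [/\ measurable_fun [set: E] L,
      forall n x, (((\sum_(k < n) \1_(Q k) x * wnorm dot W (vec_coef k) x) ^+ 2)%R%:E <= L x)%E &
      (\int[mu]_x L x <= (144 * al * be * ga)%:E)%E].
Proof.
pose A k := op_avg dot mu W (Q k).
pose x k := fine (mu (Q k)) * qf (op_form dot (A k)) (vec_coef k).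
have null k : Q k = set0 -> x k = 0 by move=> k0; rewrite /x k0 measure0 mul0r.
have mt k : measurable_fun [set: E] (wnorm dot W (vec_coef k)).
  exact: wnorm_meas (weight_int oW) _.
have ms k : measurable_fun [set: E] (wnorm dot V (A k (vec_coef k))).
  exact: wnorm_meas (inv_weight_int oW) _.
have tx k : (\int[mu]_(z in Q k) (wnorm dot W (vec_coef k) z ^+ 2)%:E = (x k)%:E)%E.
  case: (QS k) => [/SD Dk|k0]; last by rewrite null// k0 integral_set0.
  exact: (int_wnormE hn lf gD (weight_linear oW) (weight_pos oW) (weight_int oW) _ Dk).
have sx k : (\int[mu]_(z in Q k) (wnorm dot V (A k (vec_coef k)) z ^+ 2)%:E <= (al * x k)%:E)%E.
  case: (QS k) => [/SD Dk|k0]; last by rewrite null// k0 integral_set0 mulr0.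
  rewrite (int_wnormE hn lf gD (@inv_weight_linear _ _ _ W) (inv_weight_pos oW)
    (inv_weight_int oW) _ Dk).
  rewrite lee_fin /x mulrCA; apply: ler_wpM2l; first exact: fine_ge0.
  exact: (A2_testing hn gD oW _ Dk A2al).
have xh k : ((x k)%:E <= \int[mu]_(z in Q k) (vec_norm z * wnorm dot V (A k (vec_coef k)) z)%:E)%E.
  case: (QS k) => [Sk|k0]; last by rewrite null// k0 integral_set0.
  exact: (vec_testing (SD Sk) Sk).
have [L [mL HL IL]] := sparse_duality nQ
  (mulr_gt0 (ltr0Sn R 1) ga0) (mulr_gt0 (ltr0Sn R 1) be0) al0
  vec_norm_meas (fun z => wnorm_ge0 _ _ _ z) ms (fun k z => wnorm_ge0 _ _ _ z)
  mt (fun k z => wnorm_ge0 _ _ _ z) f1 tx sx xh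
  (fun n j k _ => wnorm_carleson lf gD (@inv_weight_linear _ _ _ W)
     (inv_weight_pos oW) (inv_weight_int oW) (A k (vec_coef k)) n j sS nQ QS Vga)
  (fun n j k _ => wnorm_carleson lf gD (weight_linear oW)
     (weight_pos oW) (weight_int oW) (vec_coef k) n j sS nQ QS Wbe).
exists L; split => //.
rewrite (_ : 144 * al * be * ga = 36 * (2 * ga) * (2 * be) * al * 1)//; ring.
Qed.

End vector_majorant.

Definition vec_lerner : E -> H := tensor_op (lerner mu S psi phi) g e.

Lemma vec_lerner_wli : weakly_loc_integrable dot mu vec_lerner.
Proof.
move=> v K cK; rewrite /vec_lerner /tensor_op.
rewrite (_ : (fun x => _) = fun x => \sum_i dot (e i) v * lerner mu S psi phi (g i) x).
  apply: cintegrable_sum; first exact: compact_meas.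
  by move=> i; exact: (lerner_loc lf gD sS nQ QS SQ apsi aphi (Lg i)).
by apply/funext => x; rewrite dot_suml; apply: eq_bigr => i _; rewrite mulrC.
Qed.

Lemma L2W_normE (F : E -> H) : weakly_loc_integrable dot mu F ->
  L2W_norm dot mu W F = sqrte (\int[mu]_x (wnorm dot W (F x) x ^+ 2)%:E)%E.
Proof.
move=> wF; rewrite /L2W_norm asboolT//; congr sqrte; apply: ge0_eq_integral_ae.
- by move=> x; rewrite lee_fin sqr_ge0.
- by move=> x; rewrite lee_fin sqr_ge0.
- apply: filterS2 (weight_sqrt hn oW) (weight_pos oW) => x -> px.
  rewrite /wnorm sqr_sqrtr//.
  by have := px (F x); rewrite ge0_ReE => /andP[].
Qed.

Lemma lerner_partial_sum n x :
  \sum_i lerner_partial mu S Q psi phi (g i) n x *: e i =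
  \sum_(k < n | selected S Q k) psi (Q k) x *: vec_coef k.
Proof.
rewrite /lerner_partial /vec_coef.
under eq_bigr do rewrite scaler_suml.
rewrite exchange_big/=; apply: eq_bigr => k _; rewrite scaler_sumr.
by apply: eq_bigr => i _; rewrite scalerA.
Qed.

(** The triangle inequality holds for partial sums, and the quadratic form is
    continuous in the finitely many scalar coefficients. *)
Lemma vec_lerner_le (L : E -> \bar R) :
  (forall n x, (((\sum_(k < n) \1_(Q k) x * wnorm dot W (vec_coef k) x) ^+ 2)%R%:E <= L x)%E) ->
  {ae mu, forall x, ((wnorm dot W (vec_lerner x) x ^+ 2)%:E <= L x)%E}.
Proof.
move=> HL.
pose T i x := lerner mu S psi phi (g i) x.
pose P i n x := lerner_partial mu S Q psi phi (g i) n x.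
have conv : {ae mu, forall x, forall i : 'I_m,
    (fun n => Re (P i n x)) @ \oo --> Re (T i x) /\
    (fun n => Im (P i n x)) @ \oo --> Im (T i x)}.
  have c i : {ae mu, forall x, (fun n => Re (P i n x)) @ \oo --> Re (T i x) /\
      (fun n => Im (P i n x)) @ \oo --> Im (T i x)}.
    have [L' [_ _ _ H']] := lerner_cvg_bound lf gD sS nQ QS SQ apsi aphi (Lg i).
    by apply: filterS H' => x [].
  by apply: filter_forall.
apply: filterS3 (psi_ae Q apsi) (weight_pos oW) conv => x px pW cx.
have pf := psd_op (weight_linear oW x) pW.
have cq : (fun n => quad_weight dot W (\sum_i P i n x *: e i) x) @ \oo -->
    quad_weight dot W (vec_lerner x) x.
  rewrite /vec_lerner /tensor_op (quad_weight_sum (fun i => T i x)).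
  under eq_fun => n do rewrite (quad_weight_sum (fun i => P i n x)).
  by apply: quad_poly_cvg => i; case: (cx i).
have le n : ((quad_weight dot W (\sum_i P i n x *: e i) x)%:E <= L x)%E.
  apply: le_trans (HL n x); rewrite lee_fin /P lerner_partial_sum.
  set u := \sum_(k < n | _) _.
  rewrite -[leLHS](@sqr_sqrtr _ (qf (op_form dot (W x)) u)) ?(qf_ge0 pf)//.
  have s0 : 0 <= \sum_(k < n) \1_(Q k) x * wnorm dot W (vec_coef k) x.
    by apply: sumr_ge0 => k _; rewrite mulr_ge0// wnorm_ge0.
  rewrite ler_sqr ?nnegrE ?sqrtr_ge0//.
  apply: le_trans (sqrt_qf_sum pf _ _ _ _) _.
  rewrite big_mkcond; apply: ler_sum => k _.
  case: ifPn => sk; last by rewrite mulr_ge0// wnorm_ge0.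
  by apply: ler_wpM2r; [exact: sqrtr_ge0|exact: px].
have q0 : 0 <= quad_weight dot W (vec_lerner x) x by exact: (qf_ge0 pf).
rewrite /wnorm sqr_sqrtr//.
have [Lx|] := boolP (L x \is a fin_num); last first.
  have L0 : (0 <= L x)%E by apply: le_trans (HL 0%N x); rewrite lee_fin sqr_ge0.
  by rewrite ge0_fin_numE// ltey negbK => /eqP ->; rewrite leey.
rewrite -(fineK Lx) lee_fin; apply: (cvgr_to_le cq); apply: nearW => n.
by rewrite -lee_fin fineK//; exact: le.
Qed.

Lemma vec_lerner_bound (al be ga : R) : 0 < al -> 0 < be -> 0 < ga ->
  (A2_const dot mu D W <= al%:E)%E ->
  (op_Ainfty_const dot mu D W <= be%:E)%E ->
  (op_Ainfty_const dot mu D V <= ga%:E)%E ->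
  (L2W_norm dot mu W vec_fun <= 1)%E ->
  (L2W_norm dot mu W vec_lerner <=
     (12 * Num.sqrt al * Num.sqrt be * Num.sqrt ga)%:E)%E.
Proof.
move=> al0 be0 ga0 A2al Wbe Vga.
have [wf|nwf] := pselect (weakly_loc_integrable dot mu vec_fun); last first.
  by rewrite /L2W_norm asboolF// leye_eq.
rewrite (L2W_normE wf) (L2W_normE vec_lerner_wli) => f1.
have {}f1 : (\int[mu]_x (vec_norm x ^+ 2)%:E <= 1)%E.
  have s1 : (sqrte 1 = 1 :> \bar R)%E by rewrite /= sqrtr1.
  by move: f1; rewrite -[leRHS]s1 lee_sqrt.
have [L [mL HL IL]] := vec_majorant al0 be0 ga0 A2al Wbe Vga f1.
apply: (@le_trans _ _ (sqrte (144 * al * be * ga)%:E)).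
  rewrite lee_sqrt; last by rewrite lee_fin !mulr_ge0// ltW.
  apply: le_trans IL; apply: ge0_le_integral_ae.
  - by move=> x; rewrite lee_fin sqr_ge0.
  - by move=> x; apply: le_trans (HL 0%N x); rewrite lee_fin sqr_ge0.
  - exact: vec_lerner_le HL.
rewrite /= lee_fin !sqrtrM ?mulr_ge0 ?(ltW al0) ?(ltW be0)//.
rewrite (_ : 144 = 12 ^+ 2) ?sqrtr_sqr ?ger0_norm//; ring.
Qed.

End vector_lerner.

(** The cubes of sidelength 1 cover the space and are countably many. *)
Lemma grid_charged {R : realType} {d : nat} (mu : {measure set (euclidean R d) -> \bar R})
    (D : set (set (euclidean R d))) :
  dyadic_grid D -> (0 < mu setT)%E -> exists2 Q, D Q & (0 < mu Q)%E.
Proof.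
move=> gD mu0; apply: contrapT => none.
have [Q [nQ DQ cQ]] := grid_enum gD (@subset_refl _ D).
have Q0 k : mu (Q k) = 0%E.
  case: (DQ k) => [Dk|->]; last exact: measure0.
  apply/eqP; rewrite eq_le measure_ge0 andbT leNgt; apply/negP => Qk.
  by apply: none; exists (Q k).
have neg : mu.-negligible (\bigcup_k Q k).
  apply: negligible_bigcup => k; apply/negligibleP; [exact: nested_meas nQ k|exact: Q0].
have QT : \bigcup_k Q k = setT.
  apply/seteqP; split => // x _.
  case: gD => _ _ /(_ 0)[cov _ _] _.
  have : cover [set Q | D Q /\ is_cube ((2 : R) ^ (0 : int)) Q] id x by rewrite cov.
  by move=> [A [DA _] Ax]; have [k kA] := cQ A DA; exists k => //; rewrite kA.
move: mu0; rewrite -QT; move/negligibleP : neg => -> //; first by rewrite ltxx.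
by apply: bigcup_measurable => k _; exact: nested_meas nQ k.
Qed.

Lemma L2W_norm_ae0 {R : realType} {d : nat} {H : completeNormedModType R[i]}
    (dot : {dot H for Num.conj}) (mu : {measure set (euclidean R d) -> \bar R})
    (W : euclidean R d -> H -> H) (F : euclidean R d -> H) :
  weakly_loc_integrable dot mu F ->
  {ae mu, forall x, op_sqrt dot (W x) (F x) = 0} -> L2W_norm dot mu W F = 0%E.
Proof.
move=> wF F0; rewrite /L2W_norm asboolT// (_ : integral _ _ _ = 0%E) ?sqrte0//.
rewrite (@ge0_eq_integral_ae _ _ _ _ _ (cst 0%E)) ?integral0//.
  by move=> x; rewrite lee_fin sqr_ge0.
by apply: filterS F0 => x ->; rewrite rnorm0 expr0n.
Qed.

Lemma fine_gt0_of_ge1 {R : realType} (y : \bar R) :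
  (1 <= y)%E -> y \is a fin_num -> 0 < fine y.
Proof. by case: y => [r| |]//; rewrite lee_fin => r1 _; exact: lt_le_trans r1. Qed.

Lemma EFin_sqrt_prod {R : realType} (k : R) (a b c : \bar R) :
  a \is a fin_num -> b \is a fin_num -> c \is a fin_num ->
  (k * Num.sqrt (fine a) * Num.sqrt (fine b) * Num.sqrt (fine c))%:E =
  (k%:E * sqrte a * sqrte b * sqrte c)%E.
Proof. by case: a b c => [a| |] [b| |] [c| |]. Qed.

Theorem corollary2p2 (R : realType) (d : nat)
    (mu : {measure set (euclidean R d) -> \bar R}) :
  locally_finite mu -> (doubling_const mu < +oo)%E ->
  exists2 Cmu : R, 0 < Cmu &
    forall (D : set (set (euclidean R d)))
      (H : completeNormedModType R[i]) (dot : {dot H for Num.conj})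
      (W : euclidean R d -> H -> H),
      dyadic_grid D ->
      hilbert_norm dot -> separable_space H ->
      operator_weight dot mu D W -> (A2_const dot mu D W < +oo)%E ->
      (ereal_sup [set N | exists S psi phi,
          [/\ sparse mu D S, admissible mu S psi, admissible mu S phi &
              N = tensor_op_norm dot mu W (lerner mu S psi phi)]]
       <= Cmu%:E * sqrte (A2_const dot mu D W)
                 * sqrte (op_Ainfty_const dot mu D W)
                 * sqrte (op_Ainfty_const dot mu D (inv_weight W)))%E.
Proof.
move=> lf _; exists 12 => // D H dot W gD hn _ oW A2fin.
apply: ge_ereal_sup => _ [S [psi [phi [sS apsi aphi ->]]]].
apply: ge_ereal_sup => _ [n [g [e [Lg f1 ->]]]].
have [Q [nQ QS SQ]] := grid_enum gD sS.1.
have wli := vec_lerner_wli dot lf gD sS nQ QS SQ apsi aphi e Lg.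
have triv : {ae mu, forall x, op_sqrt dot (W x) (vec_lerner mu S psi phi g e x) = 0} ->
   (L2W_norm dot mu W (tensor_op (lerner mu S psi phi) g e) <=
     12%:E * sqrte (A2_const dot mu D W) * sqrte (op_Ainfty_const dot mu D W)
        * sqrte (op_Ainfty_const dot mu D (inv_weight W)))%E.
  move=> ae0; rewrite (L2W_norm_ae0 wli ae0).
  by rewrite !mule_ge0// sqrte_ge0.
have [mu0|mu0] := leP (mu setT) 0%E.
  apply: triv; exists setT; split => //.
  by apply/eqP; rewrite eq_le mu0 measure_ge0.
have [[u u0]|H0] := pselect (exists u : H, u != 0); last first.
  apply: triv; apply: aeW => x; apply: contrapT => u0; apply: H0.
  by eexists; apply/eqP; exact: u0.
have [P DP mP] := grid_charged gD mu0.
have A20 := A2_gt0 hn lf gD oW DP mP u0.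
have W1 := op_Ainfty_ge1 lf gD (weight_pos oW) (weight_int oW) DP mP u0 (weight_quad_gt0 oW u0).
have V1 := op_Ainfty_ge1 lf gD (inv_weight_pos oW) (inv_weight_int oW) DP mP u0
  (inv_weight_quad_gt0 hn oW u0).
have A2num : A2_const dot mu D W \is a fin_num.
  by rewrite ge0_fin_numE; [exact: A2fin|exact: ltW].
have al0 : 0 < fine (A2_const dot mu D W) by apply: fine_gt0; rewrite A20 A2fin.
have s0 : (0 < 12%:E * sqrte (A2_const dot mu D W))%E.
  by rewrite -(fineK A2num); apply: mule_gt0; rewrite // lte_fin sqrtr_gt0.
have sqrt_ge1 (y : \bar R) : (1 <= y)%E -> (0 < sqrte y)%E.
  by case: y => [r| |]//=; rewrite !lte_fin ?lee_fin sqrtr_gt0; exact: lt_le_trans.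
have [Wfin|] := boolP (op_Ainfty_const dot mu D W \is a fin_num); last first.
  rewrite ge0_fin_numE ?(le_trans _ W1)// ltey negbK => /eqP WE.
  by rewrite WE (gt0_muley s0) gt0_mulye ?leey// sqrt_ge1.
have [Vfin|] := boolP (op_Ainfty_const dot mu D (inv_weight W) \is a fin_num); last first.
  rewrite ge0_fin_numE ?(le_trans _ V1)// ltey negbK => /eqP VE.
  by rewrite VE gt0_muley ?leey// mule_gt0// sqrt_ge1.
have be0 := fine_gt0_of_ge1 W1 Wfin.
have ga0 := fine_gt0_of_ge1 V1 Vfin.
rewrite -(EFin_sqrt_prod 12 A2num Wfin Vfin).
apply: (vec_lerner_bound hn lf gD sS oW nQ QS SQ apsi aphi Lg al0 be0 ga0 _ _ _ f1).
- by rewrite (fineK A2num) lexx.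
- by rewrite (fineK Wfin) lexx.
- by rewrite (fineK Vfin) lexx.
Qed.
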